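(* Let $(R,\mathfrak{m})$ be a Noetherian local ring of dimension $d$ and of prime characteristic $p>0$, and let $t\le d$ be a positive integer such that $H^j_{\mathfrak{m}}(R)/0^F_{H^j_{\mathfrak{m}}(R)}$ has finite length for all $j<t$. Then there exists a positive integer $C$ such that for every filter regular sequence $x_1,\ldots,x_t$ of $R$ we have $\mathrm{Fte}((x_1,\ldots,x_t))\le C$.
   Context: For an ideal $I$ of $R$ and $e\ge 0$, $I^{[p^e]}=(x^{p^e}\mid x\in I)$. The Frobenius closure of $I$ is $I^F=\{x\in R\mid x^{p^e}\in I^{[p^e]}\text{ for some }e\ge 0\}$. The Frobenius test exponent of $I$ is $\mathrm{Fte}(I)=\min\{e\ge 0\mid (I^F)^{[p^e]}=I^{[p^e]}\}$ (this minimum exists by Noetherianity). The Frobenius endomorphism $x\mapsto x^p$ of $R$ induces a natural Frobenius action $F$ on each local cohomology module $H^j_{\mathfrak{m}}(R)$ (e.g. via the Čech complex), and $0^F_{H^j_{\mathfrak{m}}(R)}=\{z\in H^j_{\mathfrak{m}}(R)\mid F^e(z)=0\text{ for some }e\ge0\}$. A sequence $x_1,\ldots,x_t$ of elements of $R$ is a filter regular sequence if $(x_1,\ldots,x_t)\subseteq\mathfrak{m}$ and, for each $i=1,\ldots,t$, $x_i\notin\mathfrak{p}$ for all $\mathfrak{p}\in\operatorname{Ass}_R(R/(x_1,\ldots,x_{i-1}))\setminus\{\mathfrak{m}\}$. *)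

(* Defs.v *)
(* Commutative algebra notions (ideals, Noetherian, local,
   Krull dimension, associated primes, Frobenius powers/closure, Frobenius
   test exponent) and local cohomology H^j_m(R) via the Cech complex on a
   finite generating list of m, with its natural Frobenius action. *)
From HB Require Import structures.
From mathcomp Require Import all_boot all_order all_algebra.
Set Implicit Arguments. Unset Strict Implicit. Unset Printing Implicit Defensive.
Import GRing.Theory.
Local Open Scope ring_scope.

Section CommAlg.
Variable R : comNzRingType.

Definition sub_set (I J : R -> Prop) := forall r, I r -> J r.
Definition same_set (I J : R -> Prop) := forall r, I r <-> J r.
Definition strict_set (I J : R -> Prop) := sub_set I J /\ exists r, J r /\ ~ I r.

Definition is_ideal (I : R -> Prop) :=
  I 0 /\ (forall a b, I a -> I b -> I (a + b)) /\ (forall r a, I a -> I (r * a)).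

Definition ideal_gen (S : R -> Prop) : R -> Prop := fun r =>
  exists (n : nat) (c g : nat -> R),
    (forall i, (i < n)%N -> S (g i)) /\ r = \sum_(i < n) c i * g i.

Definition ideal_of_seq (l : seq R) : R -> Prop := ideal_gen (fun x => x \in l).

Definition noetherian :=
  forall I, is_ideal I -> exists l : seq R, same_set I (ideal_of_seq l).

Definition is_prime (P : R -> Prop) :=
  is_ideal P /\ ~ P 1 /\ forall a b, P (a * b) -> P a \/ P b.

Definition is_local_max (m : R -> Prop) :=
  is_ideal m /\ ~ m 1 /\ forall I, is_ideal I -> ~ I 1 -> sub_set I m.

Definition prime_chain (n : nat) (Q : nat -> R -> Prop) :=
  (forall i, (i <= n)%N -> is_prime (Q i)) /\
  (forall i, (i < n)%N -> strict_set (Q i) (Q i.+1)).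

Definition krull_dim (d : nat) :=
  (exists Q, prime_chain d Q) /\ ~ (exists Q, prime_chain d.+1 Q).

Definition frob_pow (q : nat) (I : R -> Prop) : R -> Prop :=
  ideal_gen (fun y => exists x, I x /\ y = x ^+ q).

Definition frob_closure (p : nat) (I : R -> Prop) : R -> Prop :=
  fun x => exists e, frob_pow (p ^ e) I (x ^+ (p ^ e)).

(* Fte(I) <= C, i.e. min { e | (I^F)^[p^e] = I^[p^e] } <= C *)
Definition Fte_le (p : nat) (I : R -> Prop) (C : nat) :=
  exists e, (e <= C)%N /\
    same_set (frob_pow (p ^ e) (frob_closure p I)) (frob_pow (p ^ e) I).

Definition colon (I : R -> Prop) (a : R) : R -> Prop := fun r => I (r * a).
Definition ass (I P : R -> Prop) := is_prime P /\ exists a, same_set P (colon I a).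

Definition filter_regular (m : R -> Prop) (ys : seq R) :=
  sub_set (ideal_of_seq ys) m /\
  forall i, (i < size ys)%N -> forall P,
    ass (ideal_gen (fun y => exists k, (k < i)%N /\ y = ys`_k)) P ->
    ~ same_set P m -> ~ P (ys`_i).

Variable xs : seq R.

(* a degree-j cochain: S |-> c S / (x_S)^n for the j-subsets S *)
Definition cochain := (({set 'I_(size xs)} -> R) * nat)%type.

Definition xS (S : {set 'I_(size xs)}) : R := \prod_(i in S) xs`_i.

Definition zero_loc (j : nat) (c : cochain) :=
  forall S : {set 'I_(size xs)}, #|S| = j -> exists N : nat, xS S ^+ N * c.1 S = 0.

Definition add_co (c c' : cochain) : cochain :=
  (fun S => c.1 S * xS S ^+ c'.2 + c'.1 S * xS S ^+ c.2, (c.2 + c'.2)%N).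
Definition sub_co (c c' : cochain) : cochain :=
  (fun S => c.1 S * xS S ^+ c'.2 - c'.1 S * xS S ^+ c.2, (c.2 + c'.2)%N).
Definition scale_co (r : R) (c : cochain) : cochain := (fun S => r * c.1 S, c.2).

Definition eq_loc (j : nat) (c c' : cochain) := zero_loc j (sub_co c c').

Definition dco (c : cochain) : cochain :=
  (fun T : {set 'I_(size xs)} => \sum_(k in T)
      (-1) ^+ #|[set i in T | (val i < val k)%N]| * c.1 (T :\ k) * xs`_k ^+ c.2,
   c.2).

Definition cocycle (j : nat) (c : cochain) := zero_loc j.+1 (dco c).
Definition coboundary (j : nat) (c : cochain) :=
  match j with
  | 0 => zero_loc 0 c
  | _.+1 => exists b, eq_loc j (dco b) c
  end.

Definition frob_co (q : nat) (c : cochain) : cochain :=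
  (fun S => c.1 S ^+ q, (q * c.2)%N).

(* representatives of elements of 0^F_{H^j_m(R)} *)
Definition frob_nil (p j : nat) (c : cochain) :=
  cocycle j c /\ exists e, coboundary j (frob_co (p ^ e) c).

(* R-submodules of H^j_m(R) / 0^F, as predicates on representing cocycles *)
Definition is_qsub (p j : nat) (P : cochain -> Prop) :=
  (forall c, P c -> cocycle j c) /\
  (forall c, frob_nil p j c -> P c) /\
  (forall c c', P c -> P c' -> P (add_co c c')) /\
  (forall r c, P c -> P (scale_co r c)) /\
  (forall c c', P c -> cocycle j c' -> eq_loc j c c' -> P c').

Definition strict_co (P Q : cochain -> Prop) :=
  (forall c, P c -> Q c) /\ exists c, Q c /\ ~ P c.

Definition finite_length_quot (p j : nat) :=
  exists L : nat, forall (k : nat) (P : nat -> cochain -> Prop),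
    (forall i, (i <= k)%N -> is_qsub p j (P i)) ->
    (forall i, (i < k)%N -> strict_co (P i) (P i.+1)) -> (k <= L)%N.

End CommAlg.

(* Main.v *)
(* A sequence is filter regular when it is regular up to [m]-torsion, so that the
   connecting maps [H^j(R/(I,x)) -> H^{j+1}(R/I)] send a class of [R/(ys)] into
   [H^t_m(R)] with controlled kernels.  An element of the Frobenius closure of [(ys)]
   becomes nilpotent there, and the Hartshorne-Speiser-Lyubeznik theorem kills it by
   a power of Frobenius depending only on [H^t_m(R)].
   - Torsion part: the kernels come from [H^j_m(R)], [j < t]; a power of [m] maps
     those into their Frobenius-nilpotent part, whose exponent is again bounded.
   - Non-torsion part: extend [ys] by powers [z ^ n] of a filter regular [z] and
     assume the claim for [t + 1] elements.  Then [y / z ^ n] defines a class in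
     [H^1_m(R/(ys))] and, through the connecting maps, in [H^{t+1}_m(R)].  The kernels
     are artinian modules in which the submodule annihilated by [ys] is killed by a
     power of [z] independent of [n], so Krull's intersection theorem applies.  The
     induction starts at [t = dim R], where everything is torsion.
   For the Hartshorne-Speiser-Lyubeznik theorem one reduces to an artinian [G] with
   [G = R F(G)] on which every element of the completion acts as zero or
   surjectively.  The kernels [N_i] of [F^i] increase; [G] has finitely many layers
   with simple socle, and by duality each supports a single faithful step, so
   [s N_{i+1} <= N_i] for some surjective [s]; since [F (s u) = s ^ p F u] this
   forces [s ^ 2 G <= N_i], whence [G = 0]. *)
Require Import Defs.
From HB Require Import structures.
From mathcomp Require Import all_boot all_order all_algebra.
From mathcomp Require Import boolp functions ring zify.
From mathcomp Require classical_sets.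
Set Implicit Arguments. Unset Strict Implicit. Unset Printing Implicit Defensive.
Import GRing.Theory.
Local Open Scope ring_scope.

(** * Artinian modules *)

(** Frobenius sends [H^j(R/I)] to [H^j(R/I^[p])], so the Hartshorne-Speiser-Lyubeznik theorem is not
    applied to a quotient [R/I]. It is used for [R] alone, in every degree, and its exponent is
    carried to quotients along the connecting maps. The bounds survive this because they are
    quantified over all filter regular sequences of a given length, and Frobenius replaces a
    sequence by its [p]-th powers, again filter regular of the same length. For the torsion part,
    length [i + 1] in degree [j] costs length [i] in degrees [j] and [j + 1]; hence the ranges
    [i + j <= t] for exponents and [i + j < t] for powers of [m]. The non-torsion part leaves the
    range in which finite length is assumed, so there only an annihilator [z ^ N], uniform in a
    whole family of classes, is obtained. No quotient module is formed: a module is a pair [B], [Z]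
    of submodules of one ambient module, read as [Z / B], and an identity in it is membership in
    [B]. *)

Section Submodules.
Variables (R : comNzRingType) (V : lmodType R).
Implicit Types (X Y Z B K A : V -> Prop) (u v w : V) (r a b : R).

Definition submod X :=
  X 0 /\ (forall u v, X u -> X v -> X (u + v)) /\ (forall r u, X u -> X (r *: u)).

Definition incl X Y := forall u, X u -> Y u.

Lemma incl_refl X : incl X X. Proof. by move=> u. Qed.

Lemma predext X Y : incl X Y -> incl Y X -> X = Y.
Proof. by move=> h1 h2; apply/funext => u; apply/propext; split; [apply: h1|apply: h2]. Qed.

Lemma submod0 X : submod X -> X 0. Proof. by case. Qed.
Lemma submodD X u v : submod X -> X u -> X v -> X (u + v).
Proof. by case=> _ [h _]; apply: h. Qed.
Lemma submodZ X r u : submod X -> X u -> X (r *: u).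
Proof. by case=> _ [_ h]; apply: h. Qed.
Lemma submodN X u : submod X -> X u -> X (- u).
Proof. by move=> sX Xu; rewrite -scaleN1r; apply: submodZ. Qed.
Lemma submodB X u v : submod X -> X u -> X v -> X (u - v).
Proof. by move=> sX Xu Xv; apply: submodD => //; apply: submodN. Qed.

Lemma submod_subr X u v : submod X -> X (u - v) -> X v -> X u.
Proof. by move=> sX h1 h2; rewrite -(subrK v u); apply: submodD. Qed.
Lemma submod_subl X u v : submod X -> X (u - v) -> X u -> X v.
Proof. by move=> sX h1 h2; rewrite -(subKr u v); apply: submodB. Qed.

Lemma submod_sum X (I : Type) (s : seq I) (P : pred I) (f : I -> V) : submod X ->
  (forall i, P i -> X (f i)) -> X (\sum_(i <- s | P i) f i).
Proof.
move=> sX h; elim/big_rec: _ => [|i u Pi Xu]; first exact: submod0.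
by apply: submodD => //; apply: h.
Qed.

Definition meet X Y u := X u /\ Y u.
Definition join X Y u := exists v w, X v /\ Y w /\ u = v + w.
Definition addgen X w u := exists r v, X v /\ u = v + r *: w.
Definition tcolon r X Z u := Z u /\ X (r *: u).
Definition scaled r X B u := exists v, X v /\ B (u - r *: v).

Lemma submod_meet X Y : submod X -> submod Y -> submod (meet X Y).
Proof.
move=> sX sY; split; first by split; apply: submod0.
split=> [u v [? ?] [? ?]|r u [? ?]]; split; by [apply: submodD|apply: submodZ].
Qed.

Lemma submod_join X Y : submod X -> submod Y -> submod (join X Y).
Proof.
move=> sX sY; split.
  by exists 0, 0; rewrite addr0; split; [|split=> //]; apply: submod0.
split=> [u u' [v [w [Xv [Yw ->]]]] [v' [w' [Xv' [Yw' ->]]]]|r u [v [w [Xv [Yw ->]]]]].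
  by exists (v + v'), (w + w'); rewrite addrACA; split; [|split=> //]; apply: submodD.
by exists (r *: v), (r *: w); rewrite scalerDr; split; [|split=> //]; apply: submodZ.
Qed.

Lemma submod_addgen X w : submod X -> submod (addgen X w).
Proof.
move=> sX; split; first by exists 0, 0; rewrite scale0r addr0; split=> //; apply: submod0.
split=> [u u' [r [v [Xv ->]]] [r' [v' [Xv' ->]]]|r u [r' [v [Xv ->]]]].
  by exists (r + r'), (v + v'); rewrite scalerDl addrACA; split=> //; apply: submodD.
by exists (r * r'), (r *: v); rewrite scalerDr scalerA; split=> //; apply: submodZ.
Qed.

Lemma submod_tcolon r X Z : submod X -> submod Z -> submod (tcolon r X Z).
Proof.
move=> sX sZ; split; first by split; rewrite ?scaler0; apply: submod0.
split=> [u v [? ?] [? ?]|a u [? ?]]; split; rewrite ?scalerDr.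
- exact: submodD. - exact: submodD.
- exact: submodZ. - by rewrite scalerA mulrC -scalerA; apply: submodZ.
Qed.

Lemma submod_scaled r X B : submod X -> submod B -> submod (scaled r X B).
Proof.
move=> sX sB; split.
  by exists 0; rewrite scaler0 subr0; split; apply: submod0.
split=> [u u' [v [Xv h]] [v' [Xv' h']]|a u [v [Xv h]]].
  exists (v + v'); split; first exact: submodD.
  by rewrite scalerDr opprD addrACA; apply: submodD.
exists (a *: v); split; first exact: submodZ.
by rewrite scalerA mulrC -scalerA -scalerBr; apply: submodZ.
Qed.

Lemma incl_joinl X Y : submod Y -> incl X (join X Y).
Proof. by move=> sY u Xu; exists u, 0; rewrite addr0; split=> //; split=> //; apply: submod0. Qed.
Lemma incl_joinr X Y : submod X -> incl Y (join X Y).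
Proof. by move=> sX u Yu; exists 0, u; rewrite add0r; split=> //; apply: submod0. Qed.
Lemma incl_addgen X w : incl X (addgen X w).
Proof. by move=> u Xu; exists 0, u; rewrite scale0r addr0. Qed.
Lemma mem_addgen X w : submod X -> addgen X w w.
Proof. by move=> sX; exists 1, 0; rewrite scale1r add0r; split=> //; apply: submod0. Qed.
Lemma addgen_min X Y w : submod Y -> incl X Y -> Y w -> incl (addgen X w) Y.
Proof. by move=> sY h Yw u [r [v [Xv ->]]]; apply: submodD => //; [apply: h|apply: submodZ]. Qed.
Lemma incl_scaled r X B : submod X -> incl B (scaled r X B).
Proof. by move=> sX u Bu; exists 0; rewrite scaler0 subr0; split=> //; apply: submod0. Qed.

Definition artin B Z := forall M : nat -> V -> Prop,
  (forall i, submod (M i)) -> (forall i, incl B (M i)) -> (forall i, incl (M i) Z) ->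
  (forall i, incl (M i.+1) (M i)) ->
  exists n, forall i, (n <= i)%N -> incl (M n) (M i).

Lemma chain_le (M : nat -> V -> Prop) i j : (forall i, incl (M i.+1) (M i)) ->
  (i <= j)%N -> incl (M j) (M i).
Proof.
move=> h /subnKC <-; elim: (j - i)%N => [|k IH]; rewrite ?addn0 // addnS.
by move=> u /h /IH.
Qed.

Lemma artin_min B Z (P : (V -> Prop) -> Prop) X0 : artin B Z ->
  (forall X, P X -> [/\ submod X, incl B X & incl X Z]) -> P X0 ->
  exists X, P X /\ forall Y, P Y -> incl Y X -> incl X Y.
Proof.
move=> art hP PX0; apply: contrapT => /forallNP hno.
pose T := {X | P X}.
have step (t : T) : exists t' : T, incl (sval t') (sval t) /\ ~ incl (sval t) (sval t').
  case: t => X PX /=; have := hno X => /not_andP[//|/existsNP[Y]].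
  move=> /not_implyP[PY /not_implyP[YX nXY]].
  by exists (exist _ Y PY).
have [f hf] := choice step.
pose M := fix M n := if n is k.+1 then f (M k) else exist P X0 PX0.
have [n hn] : exists n, forall i, (n <= i)%N -> incl (sval (M n)) (sval (M i)).
  by apply: art => i; [case: (hP _ (svalP (M i)))..|apply: (hf _).1].
by case: (hf (M n)) => _; apply; apply: (hn n.+1).
Qed.

Lemma artin_sub B Z Z' : artin B Z -> incl Z' Z -> artin B Z'.
Proof. by move=> a h M h1 h2 h3 h4; apply: a => // i u /h3/h. Qed.

(* Kirby's criterion: the submodules [x ^+ n *: (M i :&: (0 : x ^+ n.+1))] of
   [(0 : x)] decrease in both indices and determine the chain [M]. *)
Lemma kirby B Z x : submod B -> submod Z -> incl B Z ->
  (forall u, Z u -> exists n, B (x ^+ n *: u)) ->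
  artin B (tcolon x B Z) -> artin B Z.
Proof.
move=> sB sZ BZ tor art M sM BM MZ Mdec.
pose W i n w := exists u, [/\ M i u, B (x ^+ n.+1 *: u) & B (w - x ^+ n *: u)].
have sW i n : submod (W i n).
  split; first by exists 0; rewrite !scaler0 subr0; split; apply: submod0.
  split=> [w w' [u [h1 h2 h3]] [u' [h1' h2' h3']]|r w [u [h1 h2 h3]]].
    exists (u + u'); split; first exact: submodD.
      by rewrite scalerDr; apply: submodD.
    by rewrite scalerDr opprD addrACA; apply: submodD.
  exists (r *: u); split; first exact: submodZ.
    by rewrite scalerA mulrC -scalerA; apply: submodZ.
  by rewrite scalerA mulrC -scalerA -scalerBr; apply: submodZ.
have BW i n : incl B (W i n).
  by move=> w Bw; exists 0; rewrite !scaler0 subr0; split=> //; apply: submod0.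
have WZ i n : incl (W i n) (tcolon x B Z).
  move=> w [u [h1 h2 h3]]; split.
    by apply: (submod_subr sZ (BZ _ h3)); apply: submodZ => //; apply: MZ h1.
  have /(submod_subr sB) : B (x *: w - x *: (x ^+ n *: u)) by rewrite -scalerBr; apply: submodZ.
  by apply; rewrite scalerA -exprS.
have Wi i n : incl (W i.+1 n) (W i n).
  by move=> w [u [h1 h2 h3]]; exists u; split=> //; apply: Mdec.
have Wn i n : incl (W i n.+1) (W i n).
  move=> w [u [h1 h2 h3]]; exists (x *: u); split; first exact: submodZ.
    by rewrite scalerA -exprSr.
  by rewrite scalerA -exprSr.
have Wlei i j n : (i <= j)%N -> incl (W j n) (W i n).
  by exact: (fun h => @chain_le (W^~ n) i j (fun k => @Wi k n) h).
have Wlen i j n : (i <= j)%N -> incl (W n j) (W n i) by exact: (fun h => @chain_le (W n) i j (Wn n) h).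
have [k0 hk0] : exists n, forall i, (n <= i)%N -> incl (W n n) (W i i).
  by apply: (art (fun i => W i i)) => // i u /Wi/Wn.
have small k : exists I, forall n, (n < k)%N -> forall i, (I <= i)%N -> incl (W I n) (W i n).
  elim: k => [|k [I hI]]; first by exists 0%N.
  have [J hJ] : exists J, forall i, (J <= i)%N -> incl (W J k) (W i k).
    by apply: (art (W^~ k)).
  exists (maxn I J) => n; rewrite ltnS leq_eqVlt => /orP[/eqP->|nk] i.
    rewrite geq_max => /andP[_ Ji] u /(Wlei _ _ _ (leq_maxr I J)); exact: hJ.
  rewrite geq_max => /andP[Ii _] u /(Wlei _ _ _ (leq_maxl I J)); exact: hI.
have [I hI] := small k0.
exists (maxn I k0) => i; rewrite geq_max => /andP[Ii ki].
have stab n : incl (W (maxn I k0) n) (W i n).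
  move=> u; case: (ltnP n k0) => [nk|kn].
    by move=> /(Wlei _ _ _ (leq_maxl I k0)); apply: hI.
  move=> /(Wlei _ _ _ (leq_maxr I k0)) /(Wlen _ _ _ kn).
  move=> /(hk0 (maxn i n)); rewrite leq_max ki => /(_ isT).
  by move=> /(Wlei _ _ _ (leq_maxl i n)) /(Wlen _ _ _ (leq_maxr i n)).
suff key n u : M (maxn I k0) u -> B (x ^+ n *: u) -> M i u.
  by move=> u Mu; have [n hn] := tor u (MZ _ _ Mu); apply: key hn.
elim: n u => [|n IH] u Mu Bu; first by rewrite expr0 scale1r in Bu; apply: BM.
have /stab[u' [Mu' Bu' hu']] : W (maxn I k0) n (x ^+ n *: u).
  by exists u; split=> //; rewrite subrr; apply: submod0.
apply: (submod_subr (sM i) _ Mu'); apply: IH; last by rewrite scalerBr.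
apply: submodB => //; have := chain_le (M := M) Mdec (i := maxn I k0) (j := i).
by rewrite geq_max Ii ki => /(_ isT); apply.
Qed.

Definition killed_by (bs : seq R) B u := forall b, b \in bs -> B (b *: u).

(* Vanishing of [(0 : bs)] up to powers of [a] passes to quotients of artinian
   modules because [b ^+ n *: A'] stabilises on the submodule [A'] of the
   elements which [b] sends to zero in the quotient. *)
Lemma artin_colon_quo (bs : seq R) a : forall B Z B', submod B -> submod Z -> submod B' ->
  incl B B' -> incl B' Z -> artin B Z ->
  (exists N, forall u, Z u -> killed_by bs B u -> B (a ^+ N *: u)) ->
  exists N, forall u, Z u -> killed_by bs B' u -> B' (a ^+ N *: u).
Proof.
elim: bs => [|b bs IH] B Z B' sB sZ sB' BB' B'Z art [N0 hN0].
  by exists N0 => u Zu _; apply: BB'; apply: hN0.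
pose A' := tcolon b B' Z.
have sA : submod A' by apply: submod_tcolon.
have BA : incl B A'.
  by move=> u Bu; split; [exact/B'Z/BB'|apply: submodZ => //; apply: BB'].
have [n hn] : exists n, forall i, (n <= i)%N -> incl (scaled (b ^+ n) A' B) (scaled (b ^+ i) A' B).
  apply: art => i; first exact: submod_scaled.
  - exact: incl_scaled.
  - move=> u [v [[Zv _] h]]; apply: (submod_subr sZ (B'Z _ (BB' _ h))); exact: submodZ.
  - move=> u [v [Av h]]; exists (b *: v); split; first exact: submodZ.
    by rewrite scalerA -exprSr.
(* On the part of [A'] killed by [b ^ k] modulo [B], the hypothesis for [b :: bs] yields one for
   [bs] alone, one power of [b] at a time. *)
pose Y k := tcolon (b ^+ k) B A'.
have sY k : submod (Y k) by apply: submod_tcolon.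
have BY k : incl B (Y k) by move=> u Bu; split; [apply: BA|apply: submodZ].
have YZ k : incl (Y k) Z by move=> u [[]].
have killY k : exists N, forall u, Y k u -> killed_by bs B u -> B (a ^+ N *: u).
  elim: k => [|k [N hN]].
    by exists 0%N => u [_]; rewrite !expr0.
  exists (N0 + N)%N => u [Au Bu] ku; rewrite exprD -scalerA; apply: hN0.
    by apply: submodZ => //; case: Au.
  move=> c; rewrite in_cons => /orP[/eqP->|cb]; rewrite scalerA mulrC -scalerA.
    apply: hN => [|e eb]; first by split; [exact: submodZ|rewrite scalerA -exprSr].
    rewrite scalerA mulrC -scalerA; apply: submodZ => //.
    exact: ku.
  by apply: submodZ => //; apply: ku.
have [N hN] := IH B (Y n) (meet (Y n) B') sB (sY n) (submod_meet (sY n) sB')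
  (fun u Bu => conj (BY n u Bu) (BB' u Bu)) (fun u => @proj1 _ _) (artin_sub art (@YZ n)) (killY n).
exists N => u Zu ku.
have Au : A' u by split=> //; apply: ku; rewrite mem_head.
(* Stability gives [b ^ n u = b ^ n.+1 v] modulo [B] with [v] in [A']. So [u - b v] lies in [Y n],
   where the induction hypothesis applies, and the correction [b v] already lies in [B']. *)
have [v [Av hv]] : scaled (b ^+ n.+1) A' B (b ^+ n *: u).
  by apply: (hn n.+1) => //; exists u; rewrite subrr; split=> //; apply: submod0.
have B'bv : B' (b *: v) by case: Av.
have Yy : Y n (u - b *: v).
  by split; [apply: submodB => //; apply: submodZ|rewrite scalerBr scalerA -exprSr].
have [|_ h] := hN _ Yy.
  move=> c cb; rewrite scalerBr; split.
    by rewrite -scalerBr; apply: submodZ.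
  apply: submodB => //; first by apply: ku; rewrite in_cons cb orbT.
  exact: submodZ.
by apply: (submod_subr sB' (v := a ^+ N *: (b *: v))); [rewrite -scalerBr|apply: submodZ].
Qed.

End Submodules.

#[global] Hint Resolve incl_refl : core.

(** * Modules over a local ring *)

Section LocalRing.
Variables (R : comNzRingType) (m : R -> Prop) (xs : seq R).
Hypotheses (hloc : is_local_max m) (hxs : same_set m (ideal_of_seq xs)).

Lemma local_unit r : ~ m r -> exists r', r' * r = 1.
Proof.
move=> nmr; apply: contrapT => /forallNP h; apply: nmr.
case: hloc => _ [_ /(_ (fun s => exists c, s = c * r))]; apply; last by exists 1; rewrite mul1r.
  split; first by exists 0; rewrite mul0r.
  split=> [a b [c ->] [c' ->]|s a [c ->]]; first by exists (c + c'); rewrite mulrDl.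
  by exists (s * c); rewrite mulrA.
by case=> c /esym; apply: h.
Qed.

Lemma mem_gen x : x \in xs -> m x.
Proof.
move=> xin; apply/hxs; exists 1%N, (fun _ => 1), (fun _ => x).
by rewrite big_ord1 mul1r.
Qed.

Section Module.
Variable V : lmodType R.
Implicit Types (X Y Z B K A : V -> Prop) (u v w : V).

Definition in_socle B u := forall x, x \in xs -> B (x *: u).

Lemma max_socle B u a : submod B -> in_socle B u -> m a -> B (a *: u).
Proof.
move=> sB h /hxs[n [c [g [hg ->]]]]; rewrite scaler_suml; apply: submod_sum => // i _.
by rewrite -scalerA; apply: submodZ => //; apply/h/hg.
Qed.

Definition torsion B u := exists n, forall x, x \in xs -> B (x ^+ n *: u).

(** Generators are treated one at a time: the current multiple of [u] is multiplied by the last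
    power of [x] that keeps it outside [B]. *)
Lemma torsion_socle B u : submod B -> torsion B u -> ~ B u ->
  exists a, ~ B (a *: u) /\ in_socle B (a *: u).
Proof.
move=> sB [n hn] nBu; have : {subset xs <= xs} by [].
rewrite /in_socle; elim: {-2}xs => [|x l IH] lxs; first by exists 1; rewrite scale1r.
have [|a [na ha]] := IH; first by move=> y yl; apply: lxs; rewrite in_cons yl orbT.
have last_nz k v : B (x ^+ k *: v) -> ~ B v -> exists j, ~ B (x ^+ j *: v) /\ B (x ^+ j.+1 *: v).
  elim: k => [|k IHk] h nv; first by case: nv; rewrite expr0 scale1r in h.
  by have [/IHk|hk] := pselect (B (x ^+ k *: v)); [apply|exists k].
have [|j [hj1 hj2]] := last_nz n (a *: u) _ na.
  rewrite scalerA mulrC -scalerA; apply: submodZ => //; apply: hn; apply: lxs.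
  exact: mem_head.
exists (x ^+ j * a); split=> [|y]; first by rewrite -scalerA.
rewrite -[_ *: u]scalerA in_cons => /orP[/eqP->|yl]; first by rewrite [x *: _]scalerA -exprS.
by rewrite [y *: _]scalerA mulrC -scalerA; apply: submodZ => //; apply: ha.
Qed.

(** [X1 / X] is zero or simple. Zero is allowed so that intersecting or joining a filtration with a
    fixed submodule keeps its number of steps. *)
Definition atom X X1 := incl X X1 /\ exists u, in_socle X u /\ incl X1 (addgen X u).

Fixpoint filtered n X Y := if n is k.+1 then
  exists X1, submod X1 /\ atom X X1 /\ filtered k X1 Y else X = Y.

Fixpoint comp_series n X Y := if n is k.+1 then
  exists X1, submod X1 /\ atom X X1 /\ ~ incl X1 X /\ comp_series k X1 Y else X = Y.

Fixpoint strict_chain n X Y := if n is k.+1 then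
  exists X1, submod X1 /\ incl X X1 /\ ~ incl X1 X /\ strict_chain k X1 Y else incl X Y.

Lemma filtered_incl n X Y : filtered n X Y -> incl X Y.
Proof. by elim: n X => [X ->|n IH X [X1 [_ [[h _] /IH h']]]] // u /h/h'. Qed.

Lemma strict_chain_incl n X Y : strict_chain n X Y -> incl X Y.
Proof. by elim: n X => [X |n IH X [X1 [_ [h [_ /IH h']]]]] // u /h/h'. Qed.

Lemma comp_chain n X Y : comp_series n X Y -> strict_chain n X Y.
Proof.
elim: n X => [X ->|n IH X [X1 [s1 [[h1 _] [h2 /IH h3]]]]] //.
by exists X1.
Qed.

Lemma filtered_comp n X Y : submod X -> filtered n X Y -> exists k, comp_series k X Y.
Proof.
elim: n X => [X _ ->|n IH X sX [X1 [s1 [a1 f1]]]]; first by exists 0%N.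
have [k hk] := IH _ s1 f1.
have [h|h] := pselect (incl X1 X); last by exists k.+1, X1.
by exists k; rewrite (predext a1.1 h).
Qed.

Lemma filtered_submod n X Y : submod X -> filtered n X Y -> submod Y.
Proof. by elim: n X => [X ? <-|n IH X _ [X1 [s1 [_ /(IH _ s1)]]]]. Qed.

Lemma filtered_cat n k X Y Z : filtered n X Y -> filtered k Y Z -> filtered (n + k) X Z.
Proof.
by elim: n X => [X ->|n IH X [X1 [s1 [a1 f1]]] h] //; exists X1; split=> //; split=> //; apply: IH.
Qed.

(** A layer that stays nonzero after intersection contains some [d = v + r w] outside [X]. Then [r]
    is a unit, since [m w] lies in [X], and [d] generates the layer in place of [w]. *)
Lemma filtered_meet A n X Y : submod A -> submod X -> filtered n X Y -> filtered n (meet X A) (meet Y A).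
Proof.
move=> sA; elim: n X => [X _ ->|n IH X sX [X1 [s1 [a1 f1]]]] //.
exists (meet X1 A); split; first exact: submod_meet.
split; last exact: IH.
split; first by move=> u [/a1.1].
have [h|] := pselect (incl (meet X1 A) X).
  exists 0; split; first by move=> x _; rewrite scaler0; apply: submod0; apply: submod_meet.
  by move=> u hu; apply: incl_addgen; split; [apply: h|case: hu].
move=> /existsNP[d /not_implyP[[X1d Ad] nXd]]; exists d.
case: a1 => XX1 [w [sw X1w]].
have [r [v [Xv dE]]] := X1w _ X1d.
have [mr|/local_unit[r' r'r]] := pselect (m r).
  by case: nXd; rewrite dE; apply: submodD => //; apply: max_socle mr.
split.
  move=> x xin; split; last exact: submodZ.
  rewrite dE scalerDr; apply: submodD => //; first exact: submodZ.
  by rewrite scalerA mulrC -scalerA; apply: submodZ => //; apply: sw.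
move=> u [X1u Au]; have [s [v' [Xv' uE]]] := X1w _ X1u.
exists (s * r'), (u - (s * r') *: d); rewrite subrK; split=> //; split.
  rewrite uE dE scalerDr scalerA -mulrA r'r mulr1 opprD addrACA subrr addr0.
  by apply: submodB => //; apply: submodZ.
by apply: submodB => //; apply: submodZ.
Qed.

Lemma filtered_join A n X Y : submod A -> submod X -> filtered n X Y -> filtered n (join X A) (join Y A).
Proof.
move=> sA; elim: n X => [X _ ->|n IH X sX [X1 [s1 [a1 f1]]]] //.
exists (join X1 A); split; first exact: submod_join.
split; last exact: IH.
case: a1 => XX1 [w [sw X1w]]; split.
  by move=> u [v [v' [/XX1 ? [? ->]]]]; exists v, v'.
exists w; split; first by move=> x /sw h; apply: incl_joinl.
move=> u [v [v' [/X1w[r [v0 [Xv0 ->]]] [Av' ->]]]]; exists r, (v0 + v').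
by rewrite addrAC; split=> //; exists v0, v'.
Qed.

Lemma comp_filtered n X Y : comp_series n X Y -> filtered n X Y.
Proof. by elim: n X => [|n IH] X //= [X1 [? [? [_ /IH ?]]]]; exists X1. Qed.

Lemma strict_chain_mono n X X' Y Y' : incl X' X -> incl Y Y' ->
  strict_chain n X Y -> strict_chain n X' Y'.
Proof.
elim: n X X' => [|n IH] X X' hX hY /=; first by move=> h u /hX/h/hY.
move=> [X1 [s1 [h1 [h2 h3]]]]; exists X1; split=> //; split; first by move=> u /hX/h1.
split; first by move=> h; apply: h2 => u /h/hX.
exact: IH h3.
Qed.

Lemma strict_chain_cat n k X Y Y' Z : strict_chain n X Y -> submod Y' ->
  incl Y Y' -> ~ incl Y' Y -> strict_chain k Y' Z -> strict_chain (n + k.+1) X Z.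
Proof.
elim: n X => [|n IH] X /= h sY' YY' nY'Y hk.
  exists Y'; split=> //; split; first by move=> u /h/YY'.
  by split=> // h'; apply: nY'Y => u /h'/h.
by case: h => [X1 [s1 [h1 [h2 h3]]]]; exists X1; split=> //; split=> //; split=> //; apply: IH.
Qed.

(** Only one step can collapse: once the chain contains [X1] the join changes nothing, and before
    that a collapse would put a unit multiple of the generator [w] into [X2], hence all of [X1]. *)
Lemma strict_chain_join h X X1 X' Y' : submod X -> submod X1 -> atom X X1 -> submod X' ->
  incl X X' -> strict_chain h X' Y' ->
  exists h', (h <= h'.+1)%N /\ strict_chain h' (join X' X1) (join Y' X1).
Proof.
move=> sX s1 a1; elim: h X' => [|h IH] X' sX' XX' /=.
  by move=> X'Y'; exists 0%N; split=> // u [v [w [/X'Y' ? [? ->]]]]; exists v, w.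
move=> [X2 [s2 [h1 [h2 h3]]]].
have [X1X2|nX1X2] := pselect (incl X1 X2).
  exists h; split=> //; apply: strict_chain_mono h3; last exact: incl_joinl.
  by move=> u [v [w [/h1 ? [/X1X2 ? ->]]]]; apply: submodD.
have [|h' [hh' hc]] := IH _ s2 _ h3; first by move=> u /XX'/h1.
exists h'.+1; split=> //; exists (join X2 X1); split; first exact: submod_join.
split; first by move=> u [v [w [/h1 ? [? ->]]]]; exists v, w.
split=> // hinc; apply: h2 => d X2d.
have /hinc[x' [y [X'x' [X1y dE]]]] : join X2 X1 d by apply: incl_joinl.
case: a1 => XX1 [w [sw X1w]]; have [r [x0 [Xx0 yE]]] := X1w _ X1y.
have X2x0 : X2 x0 by apply/h1/XX'.
have X2rw : X2 (r *: w).
  apply: (submod_subr s2 (v := d)) => //; rewrite dE yE.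
  rewrite -opprB; apply: submodN => //; rewrite -addrA -addrA subrr addr0.
  by apply: submodD => //; apply: h1.
have [mr|/local_unit[r' r'r]] := pselect (m r).
  rewrite dE yE; apply: submodD => //; apply: submodD => //; first exact: XX'.
  by apply: XX'; apply: max_socle mr.
case: nX1X2; move=> u /X1w; apply: addgen_min => //; first by move=> v /XX'/h1.
by rewrite -(scale1r w) -r'r -scalerA; apply: submodZ.
Qed.

(* Jordan-Hoelder in the form needed here: a filtration with [n] simple or zero
   factors bounds the length of strict chains. *)
Lemma filtered_chain_bound n h X Y X' Y' : submod X -> filtered n X Y -> submod X' ->
  incl X X' -> incl Y' Y -> strict_chain h X' Y' -> (h <= n)%N.
Proof.
elim: n h X X' Y' => [|n IH] h X X' Y' sX /= => [<-|[X1 [s1 [a1 f1]]]] sX' XX' Y'Y.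
  case: h => // h [X1 [s1 [h1 [h2 h3]]]]; case: h2 => u hu; apply/XX'/Y'Y.
  exact: strict_chain_incl h3 _ hu.
move=> hc; have [h' [hh' hc']] := strict_chain_join sX s1 a1 sX' XX' hc.
apply: leq_trans hh' _; rewrite ltnS; apply: (IH _ _ _ _ s1 f1 _ _ _ hc') => //.
- exact: submod_join.
- exact: incl_joinr.
- move=> u [v [w [/Y'Y Yv [X1w ->]]]]; apply: submodD (filtered_submod s1 f1) Yv _.
  exact: filtered_incl f1 _ X1w.
Qed.

Lemma filtered_snoc n X Y Z : submod Z -> filtered n X Y -> atom Y Z -> filtered n.+1 X Z.
Proof. by move=> sZ h a; rewrite -addn1; apply: filtered_cat h _; exists Z. Qed.

Lemma filtered_artin n B Z : submod B -> filtered n B Z -> artin B Z.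
Proof.
move=> sB f M sM BM MZ Mdec; apply: contrapT => /forallNP hno.
have long h : exists i, strict_chain h (M i) (M 0%N).
  elim: h => [|h [i hi]]; first by exists 0%N.
  have /existsNP[j /not_implyP[ij nij]] := hno i.
  exists j, (M i); split=> //; split; first exact: (chain_le Mdec ij).
  by split.
have [i hi] := long n.+1.
by have := filtered_chain_bound sB f (sM i) (BM i) (MZ 0%N) hi; rewrite ltnn.
Qed.

End Module.

Definition ideal (J : R -> Prop) := submod (V := R^o) J.

Lemma ideal0 J : ideal J -> J 0. Proof. exact: submod0. Qed.
Lemma idealD J a b : ideal J -> J a -> J b -> J (a + b).
Proof. exact: submodD. Qed.
Lemma idealM J r a : ideal J -> J a -> J (r * a).
Proof. move=> iJ; exact: (submodZ (V := R^o) r iJ). Qed.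
Lemma idealB J a b : ideal J -> J a -> J b -> J (a - b).
Proof. exact: submodB. Qed.
Lemma ideal_sum J (I : Type) (s : seq I) (P : pred I) (f : I -> R) : ideal J ->
  (forall i, P i -> J (f i)) -> J (\sum_(i <- s | P i) f i).
Proof. exact: (submod_sum (V := R^o)). Qed.

(** * Chain conditions on ideals *)

Section Noetherian.
Hypothesis noeth : noetherian R.

Lemma noeth_chain (M : nat -> R -> Prop) : (forall i, ideal (M i)) ->
  (forall i, incl (V := R^o) (M i) (M i.+1)) ->
  exists n, forall i, incl (V := R^o) (M i) (M n).
Proof.
move=> iM Minc.
have Mle i j : (i <= j)%N -> incl (V := R^o) (M i) (M j).
  move=> /subnKC <-; elim: (j - i)%N => [|k IH]; rewrite ?addn0 // addnS.
  by move=> u /IH/Minc.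
have [|l hl] := noeth (I := fun r => exists i, M i r).
  split; first by exists 0%N; case: (iM 0%N).
  split=> [a b [i Ma] [j Mb]|r a [i Ma]]; last by exists i; apply: idealM.
  exists (maxn i j); apply: idealD => //.
    exact: Mle (leq_maxl _ _) _ Ma.
  exact: Mle (leq_maxr _ _) _ Mb.
have [n hn] : exists n, forall x, x \in l -> M n x.
  have : forall x, x \in l -> exists i, M i x.
    move=> x xl; apply/hl; exists 1%N, (fun _ => 1), (fun _ => x).
    by rewrite big_ord1 mul1r.
  elim: l {hl} => [|x l IH] h; first by exists 0%N.
  have [|n hn] := IH; first by move=> y yl; apply: h; rewrite in_cons yl orbT.
  have [i Mi] := h x (mem_head _ _).
  exists (maxn i n) => y; rewrite in_cons => /orP[/eqP->|/hn].
    exact: Mle (leq_maxl _ _) _ Mi.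
  exact: Mle (leq_maxr _ _) _.
exists n => i r Mir; have /hl[k [c [g [hg ->]]]] : exists i, M i r by exists i.
by apply: ideal_sum => // j _; apply: idealM => //; apply/hn/hg.
Qed.

Lemma noeth_max (P : (R -> Prop) -> Prop) J0 : (forall J, P J -> ideal J) -> P J0 ->
  exists J, P J /\ forall J', P J' -> incl (V := R^o) J J' -> incl (V := R^o) J' J.
Proof.
move=> hP PJ0; apply: contrapT => /forallNP hno.
pose T := {J | P J}.
have step (t : T) : exists t' : T,
    incl (V := R^o) (sval t) (sval t') /\ ~ incl (V := R^o) (sval t') (sval t).
  case: t => X PX /=; have := hno X => /not_andP[//|/existsNP[Y]].
  by move=> /not_implyP[PY /not_implyP[YX nXY]]; exists (exist _ Y PY).
have [f hf] := choice step.
pose M := fix M n := if n is k.+1 then f (M k) else exist P J0 PJ0.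
have [n hn] : exists n, forall i, incl (V := R^o) (sval (M i)) (sval (M n)).
  by apply: noeth_chain => i; [apply/hP/svalP|apply: (hf _).1].
by case: (hf (M n)) => _; apply; apply: (hn n.+1).
Qed.

(** Among the ideals reached from [J] by a filtration inside [J'], a maximal one must be [J']:
    otherwise torsion provides a socle element of [J'] modulo it, which adds a layer. *)
Lemma noeth_filtered J J' : ideal J -> ideal J' -> incl (V := R^o) J J' ->
  (forall u, J' u -> torsion (V := R^o) J u) -> exists n, filtered (V := R^o) n J J'.
Proof.
move=> iJ iJ' JJ' tor.
have [||b [[ib bJ' [n fb]] bmax]] := @noeth_max
    (fun b => [/\ ideal b, incl (V := R^o) b J' & exists n, filtered (V := R^o) n J b]) J.
- by move=> b [].
- by split=> //; exists 0%N.
exists n; suff <- : b = J' by [].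
apply: (predext (V := R^o)) => // u J'u; apply: contrapT => nbu.
have Jb := filtered_incl fb.
have [|a [na sa]] := torsion_socle (V := R^o) ib _ nbu.
  by have [k hk] := tor u J'u; exists k => x /hk/Jb.
apply: na; apply: (bmax (addgen (V := R^o) b (a *: (u : R^o)))).
- split; first exact: submod_addgen.
    by apply: (addgen_min (V := R^o)) => //; apply: (submodZ (V := R^o) _ iJ').
  exists n.+1; apply: (filtered_snoc _ fb); first exact: submod_addgen.
  by split; [exact: incl_addgen|exists (a *: (u : R^o)); split=> // v].
- exact: incl_addgen.
- exact: mem_addgen.
Qed.

End Noetherian.
End LocalRing.

(** * Duality over artinian quotients *)

Section Duality.
Variables (R : comNzRingType) (m : R -> Prop) (xs : seq R).
Hypotheses (hloc : is_local_max m) (hxs : same_set m (ideal_of_seq xs)).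
Hypothesis noeth : noetherian R.

(** The ideal generated by the [n]-th powers of the generators, as an intersection, so that [pw n r]
    can be instantiated at any ideal. These ideals are cofinal with the powers of [m]. *)
Definition pw n (r : R) := forall J, ideal J -> (forall x, x \in xs -> J (x ^+ n)) -> J r.

Lemma ideal_pw n : ideal (pw n).
Proof.
split; first by move=> J iJ _; apply: ideal0.
split=> [a b ha hb J iJ h|r a ha J iJ h]; first by apply: idealD; [|apply: ha|apply: hb].
by apply: (idealM r iJ); apply: ha.
Qed.

Lemma pw_gen n x : x \in xs -> pw n (x ^+ n).
Proof. by move=> xin J _; apply. Qed.

Lemma pw_le n k r : (n <= k)%N -> pw k r -> pw n r.
Proof.
move=> nk; apply; first exact: ideal_pw.
by move=> x xin; rewrite -(subnK nk) exprD; exact: (idealM _ (ideal_pw n) (pw_gen xin)).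
Qed.

Lemma pw_kill (V : lmodType R) (B : V -> Prop) u n a : submod B ->
  (forall x, x \in xs -> B (x ^+ n *: u)) -> pw n a -> B (a *: u).
Proof.
move=> sB h /(_ (fun a => B (a *: u))); apply => // {a}.
split; first by rewrite scale0r; apply: submod0.
split=> [r s hr hs|r s hs]; first by rewrite scalerDl; apply: submodD.
by rewrite -[r *: s]/(r * s) -scalerA; apply: submodZ.
Qed.

Lemma filtered_pw n : exists k, filtered xs (V := R^o) k (pw n) (fun _ => True).
Proof.
apply: (noeth_filtered noeth) => //; first exact: ideal_pw.
move=> u _; exists n => x xin; rewrite -[_ *: (u : R^o)]/(x ^+ n * u) mulrC.
exact: (idealM _ (ideal_pw n) (pw_gen xin)).
Qed.

Variable V : lmodType R.
Implicit Types (X Y Z B K A W : V -> Prop) (u v w : V) (J : R -> Prop).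

(** [W / K] is an essential extension of the residue field generated by [s0]. It embeds in the
    injective hull of that field, so annihilators behave as in Matlis duality although the hull is
    never constructed. *)
Definition simple_socle K W s0 := [/\ W s0, ~ K s0, in_socle xs K s0 &
  forall X, submod X -> incl K X -> incl X W -> ~ incl X K -> X s0].

(** * Annihilators in an essential extension of the residue field *)

Section Annihilators.
Variables (K W : V -> Prop) (s0 : V).
Hypotheses (sK : submod K) (sW : submod W) (KW : incl K W) (ss : simple_socle K W s0).

Definition lann X (b : R) := forall u, X u -> K (b *: u).
Definition rann J u := W u /\ forall b, J b -> K (b *: u).

Lemma ideal_lann X : ideal (lann X).
Proof.
split; first by move=> u _; rewrite scale0r; apply: submod0.
split=> [a b ha hb u Xu|r a ha u Xu].
  by rewrite scalerDl; apply: submodD; [|apply: ha|apply: hb].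
by rewrite -[r *: a]/(r * a) -scalerA; apply: submodZ => //; apply: ha.
Qed.

Lemma submod_rann J : submod (rann J).
Proof.
split; first by split=> [|b _]; rewrite ?scaler0; apply: submod0.
split=> [u v [Wu hu] [Wv hv]|r u [Wu hu]]; split=> [|b Jb].
- exact: submodD.
- by rewrite scalerDr; apply: submodD; [|apply: hu|apply: hv].
- exact: submodZ.
- by rewrite scalerA mulrC -scalerA; apply: submodZ => //; apply: hu.
Qed.

Lemma incl_rann J : incl K (rann J).
Proof. by move=> u Ku; split=> [|b _]; [apply: KW|apply: submodZ]. Qed.

Lemma simple_socle_gen u : W u -> ~ K u -> exists r, K (s0 - r *: u).
Proof.
move=> Wu nKu; case: ss => _ _ _ h; have [|||h'|r [v [Kv s0E]]] := h (addgen K u).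
- exact: submod_addgen.
- exact: incl_addgen.
- exact: addgen_min.
- by apply: nKu; apply: h'; apply: mem_addgen.
- by exists r; rewrite s0E addrK.
Qed.

Lemma socle_line u : W u -> in_socle xs K u -> exists r, K (u - r *: s0).
Proof.
move=> Wu su; have [Ku|nKu] := pselect (K u); first by exists 0; rewrite scale0r subr0.
have [r hr] := simple_socle_gen Wu nKu.
have [mr|/(local_unit hloc)[r' r'r]] := pselect (m r).
  case: ss => _ nK _ _; case: nK; apply: (submod_subr sK hr).
  exact: (max_socle hxs sK su mr).
exists r'; have := submodZ (- r') sK hr.
by rewrite scalerBr scalerA mulNr r'r scaleN1r opprK scaleNr addrC.
Qed.

(** A multiplier [b] annihilating [X] sends a fixed [w] of [X1] into the socle, a line over the
    residue field, and [w] generates [X1] modulo [X]. So [b] is determined modulo [lann X1] by one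
    coefficient. *)
Lemma atom_lann X X1 : submod X -> submod X1 -> incl X1 W -> atom xs X X1 ->
  atom xs (V := R^o) (lann X1) (lann X).
Proof.
move=> sX s1 X1W [XX1 [u [su X1u]]]; split; first by move=> b h v /XX1/h.
have [h|] := pselect (incl (V := R^o) (lann X) (lann X1)).
  exists 0; split; first by move=> x _; rewrite scaler0; apply: (ideal0 (ideal_lann _)).
  by move=> b /h; apply: (incl_addgen (V := R^o)).
move=> /existsNP[b0 /not_implyP[Xb0 /existsNP[w /not_implyP[X1w nK]]]].
have socX b v : lann X b -> X1 v -> in_socle xs K (b *: v).
  move=> hb /X1u[r [v' [Xv' ->]]] x xin.
  rewrite scalerA mulrC -scalerA; apply: hb; rewrite scalerDr.
  apply: submodD => //; first exact: submodZ.
  by rewrite scalerA mulrC -scalerA; apply: submodZ => //; apply: su.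
exists (b0 : R^o); split.
  move=> x xin v X1v; rewrite -[x *: b0]/(x * b0) -scalerA.
  exact: socX.
have [r hr] := simple_socle_gen (submodZ b0 sW (X1W _ X1w)) nK.
move=> b Xb; have [t ht] := socle_line (submodZ b sW (X1W _ X1w)) (socX _ _ Xb X1w).
exists (t * r), (b - (t * r) * b0); split; last by rewrite subrK.
have [r0 [v0 [Xv0 wE]]] := X1u _ X1w.
have [mr0|/(local_unit hloc)[r' r'r]] := pselect (m r0).
  case: nK; apply: Xb0; rewrite wE; apply: submodD => //.
  exact: (max_socle hxs sX su mr0).
have hXb : lann X (b - (t * r) * b0).
  by apply: (idealB (ideal_lann X)) => //; apply: (idealM _ (ideal_lann X)).
have Kw : K ((b - (t * r) * b0) *: w).
  rewrite scalerBl -!scalerA -[_ - _](subrKA (t *: s0)) -scalerBr.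
  by apply: submodD => //; apply: submodZ.
move=> v /X1u[a [v1 [Xv1 ->]]]; rewrite scalerDr; apply: submodD => //; first exact: hXb.
have -> : a *: u = (a * r') *: w - (a * r') *: v0.
  by rewrite wE scalerDr addrC addKr scalerA -mulrA r'r mulr1.
rewrite scalerBr; apply: submodB => //; last by apply: hXb; apply: submodZ.
by rewrite scalerA mulrC -scalerA; apply: submodZ.
Qed.

(** Dual to [atom_lann]: an element [u] of [rann J] is determined modulo [rann J1] by [b0 u], which
    lies on the socle line. *)
Lemma atom_rann J J1 : ideal J -> ideal J1 -> atom xs (V := R^o) J J1 ->
  atom xs (rann J1) (rann J).
Proof.
move=> iJ i1 [JJ1 [b0 [sb J1b]]]; split; first by move=> u [Wu h]; split=> // b /JJ1/h.
have [h|] := pselect (incl (rann J) (rann J1)).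
  exists 0; split; first by move=> x _; rewrite scaler0; apply: (submod0 (submod_rann _)).
  by move=> u /h; apply: incl_addgen.
move=> /existsNP[w /not_implyP[Jw nJ1w]].
have Ww : W w by case: Jw.
have nK : ~ K (b0 *: w).
  move=> h; apply: nJ1w; split=> // b /J1b[r [b' [Jb' ->]]].
  rewrite scalerDl; apply: submodD => //; first by apply: Jw.2.
  by rewrite -[r *: b0]/(r * b0) -scalerA; apply: submodZ.
have socJ v : rann J v -> in_socle xs K (b0 *: v).
  by move=> [_ hv] x xin; rewrite scalerA; apply: hv; apply: sb.
have [r hr] := simple_socle_gen (submodZ b0 sW Ww) nK.
exists w; split.
  move=> x xin; split; first exact: submodZ.
  move=> b /J1b[c [b' [Jb' ->]]]; rewrite scalerDl; apply: submodD => //.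
    by rewrite scalerA mulrC -scalerA; apply: submodZ => //; apply: Jw.2.
  by rewrite -[c *: b0]/(c * b0) scalerA -mulrA (mulrC b0) -!scalerA; apply: submodZ => //; apply: socJ.
move=> u Ju; have Wu : W u by case: Ju.
have [t ht] := socle_line (submodZ b0 sW Wu) (socJ _ Ju).
exists (t * r), (u - (t * r) *: w); split; last by rewrite subrK.
have Jd : rann J (u - (t * r) *: w).
  by apply: (submodB (submod_rann J)) => //; apply: (submodZ _ (submod_rann J)).
split; first by case: Jd.
move=> b /J1b[c [b' [Jb' ->]]]; rewrite scalerDl; apply: submodD => //; first by apply: Jd.2.
rewrite -[c *: b0]/(c * b0) -scalerA; apply: submodZ => //.
rewrite scalerBr scalerA mulrC -!scalerA -[_ - _](subrKA (t *: s0)) -scalerBr.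
by apply: submodD => //; apply: submodZ.
Qed.

Lemma filtered_rann n J J1 : ideal J -> ideal J1 -> filtered xs (V := R^o) n J J1 ->
  filtered xs n (rann J1) (rann J).
Proof.
elim: n J => [J _ _ -> //|n IH J iJ i1 [J2 [i2 [a2 f2]]]].
apply: filtered_snoc (IH _ i2 i1 f2) _; first exact: submod_rann.
exact: atom_rann.
Qed.

Lemma filtered_closure n X X1 : submod X -> incl X1 W -> filtered xs n X X1 ->
  filtered xs n (rann (lann X)) (rann (lann X1)).
Proof.
elim: n X => [X _ _ -> //|n IH X sX X1W [X2 [s2 [a2 f2]]]].
exists (rann (lann X2)); split; first exact: submod_rann.
split; last exact: IH.
apply: atom_rann; try exact: ideal_lann.
by apply: atom_lann => // u /(filtered_incl f2)/X1W.
Qed.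

Lemma rann_lannK : rann (lann K) = K.
Proof.
apply: predext => u; last exact: incl_rann.
by case=> _ h; rewrite -(scale1r u); apply: h => v Kv; rewrite scale1r.
Qed.

End Annihilators.

(* Counting argument: if [lann A] killed [v], then [A] and [A + R v] would have
   the same double annihilator, and composing the annihilator filtrations would
   give a filtration of [W / K] shorter than one of its strict chains. *)
Lemma separate_filtered K W s0 A v h : submod K -> submod W -> submod A ->
  incl K A -> incl A W -> simple_socle K W s0 -> filtered xs h K W ->
  (forall u, W u -> torsion xs K u) -> W v -> ~ A v ->
  exists b, lann K A b /\ ~ K (b *: v).
Proof.
move=> sK sW sA KA AW ss f tor Wv nAv; apply: contrapT => /forallNP hno.
have KW : incl K W by move=> u /KA/AW.
have kill b : lann K A b -> K (b *: v).
  by move=> hb; apply: contrapT => nK; apply: (hno b).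
have [|a [na sa]] := torsion_socle (xs := xs) sA _ nAv.
  by have [n hn] := tor _ Wv; exists n => x /hn/KA.
pose A1 := addgen A (a *: v).
have sA1 : submod A1 by apply: submod_addgen.
have AA1 : incl A A1 by apply: incl_addgen.
have A1W : incl A1 W by apply: addgen_min => //; apply: submodZ.
have E : lann K A = lann K A1.
  apply: (predext (V := R^o)) => b hb u; last by move=> /AA1; apply: hb.
  move=> [r [w [Aw ->]]]; rewrite scalerDr; apply: submodD => //; first exact: hb.
  have -> : b *: (r *: (a *: v)) = (r * a) *: (b *: v) by rewrite !scalerA -mulrA mulrC.
  by apply: submodZ => //; apply: kill.
have [k hk] : exists k, comp_series xs k K A.
  have := filtered_meet hloc hxs sA sK f; rewrite (predext (X := meet K A) (Y := K)).
  - rewrite (predext (X := meet W A) (Y := A)); first exact: (filtered_comp sK).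
      by move=> u [].
    by move=> u Au; split=> //; apply: AW.
  - by move=> u [].
  - by move=> u Ku; split=> //; apply: KA.
have [n hn] : exists n, comp_series xs n A1 W.
  have := filtered_join sA1 sK f; rewrite (predext (X := join K A1) (Y := A1)).
  - rewrite (predext (X := join W A1) (Y := W)); first exact: (filtered_comp sA1).
      by move=> u [w [w' [Ww [/A1W Ww' ->]]]]; apply: submodD.
    exact: incl_joinl.
  - by move=> u [w [w' [/KA/AA1 Ww [Ww' ->]]]]; apply: submodD.
  - exact: incl_joinr.
have f1 := filtered_closure sK sW KW ss sK AW (comp_filtered hk).
have f2 := filtered_closure sK sW KW ss sA1 (fun u => id) (comp_filtered hn).
rewrite rann_lannK // in f1.
have := filtered_cat f1 (Y := rann K W (lann K A)); rewrite E => /(_ _ _ f2) f3.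
rewrite (predext (X := rann K W (lann K W)) (Y := W)) in f3; first last.
- by move=> u Wu; split=> // b; apply.
- by move=> u [].
have ch : strict_chain (k + n.+1) K W.
  apply: strict_chain_cat (comp_chain hk) sA1 AA1 _ (comp_chain hn).
  by move=> /(_ (a *: v)) hA; apply: na; apply: hA; apply: mem_addgen.
have := filtered_chain_bound hloc hxs sK f3 sK (fun u => id) (fun u => id) ch.
by rewrite addnS ltnn.
Qed.

End Duality.

(** * Separation by elements of the completion *)

Section Cauchy.
Variables (R : comNzRingType) (m : R -> Prop) (xs : seq R).
Hypotheses (hloc : is_local_max m) (hxs : same_set m (ideal_of_seq xs)).
Hypothesis noeth : noetherian R.
Variable V : lmodType R.
Implicit Types (X Y Z B K A W : V -> Prop) (u v w : V) (J : R -> Prop).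
Local Notation pw := (pw xs).

(* Elements of the completion of [R], which acts on every torsion module. *)
Definition cauchy (s : nat -> R) := forall n, pw n (s n.+1 - s n).

Lemma cauchy_le s n k : cauchy s -> (n <= k)%N -> pw n (s k - s n).
Proof.
move=> cs /subnKC <-; elim: (k - n)%N => [|i IH].
  by rewrite addn0 subrr; apply: (ideal0 (ideal_pw _ _)).
rewrite addnS -(subrKA (s (n + i)%N)); apply: (idealD (ideal_pw _ _)) => //.
exact: pw_le (leq_addr _ _) (cs _).
Qed.

Definition level n B u := forall x, x \in xs -> B (x ^+ n *: u).

Lemma level_le n k B u : submod B -> (n <= k)%N -> level n B u -> level k B u.
Proof.
by move=> sB nk h x xin; rewrite -(subnK nk) exprD -scalerA; apply: submodZ => //; apply: h.
Qed.

(** The part of [W] killed by [pw n] has finite length, because annihilation turns a filtration of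
    [R / pw n] into one of it; the counting argument applies there. The scaling [b v = s0] makes the
    solutions a coset, as the passage to the limit requires. *)
Lemma separate_level K W s0 A v n : submod K -> submod W -> submod A ->
  incl K A -> incl A W -> simple_socle xs K W s0 ->
  (forall u, W u -> torsion xs K u) -> W v -> ~ A v -> level n K v ->
  exists b, (forall u, A u -> level n K u -> K (b *: u)) /\ K (b *: v - s0).
Proof.
move=> sK sW sA KA AW ss tor Wv nAv vn.
have KW : incl K W by move=> u /KA/AW.
pose Y := rann K W (pw n).
have sY : submod Y by apply: submod_rann.
have YE u : Y u <-> W u /\ level n K u.
  split=> [[Wu hu]|[Wu hu]]; split=> //.
    by move=> x xin; apply: hu; apply: pw_gen.
  by move=> b; apply: pw_kill.
have KY : incl K Y by apply: incl_rann.
have [k fk] := filtered_pw xs noeth n.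
have fY : filtered xs k K Y.
  have := filtered_rann hloc hxs sK sW KW ss (ideal_pw xs n) _ fk.
  rewrite (predext (X := rann K W (fun _ => True)) (Y := K)).
  - by apply; split=> //; split.
  - by move=> u [_ /(_ 1 I)]; rewrite scale1r.
  - exact: incl_rann.
have ssY : simple_socle xs K Y s0.
  case: ss => Ws ns socs es; split=> //.
    apply/YE; split=> // x xin; case: (n) vn => [|j] vn.
      by case: nAv; apply: KA; have := vn _ xin; rewrite expr0 scale1r.
    by rewrite exprSr -scalerA; apply: submodZ => //; apply: socs.
  by move=> X sX KX XY; apply: es => // u /XY/YE[].
have Yv : Y v by apply/YE.
have nAYv : ~ meet A Y v by case.
have [|||b [bA nbv]] := separate_filtered hloc hxs sK sY (submod_meet sA sY) _ _ ssY fY _ Yv nAYv.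
- by move=> u Ku; split; [apply: KA|apply: KY].
- by move=> u [].
- by move=> u /YE[/tor].
have Wbv : W (b *: v) by apply: submodZ.
have [r hr] := simple_socle_gen sK sW KW ss Wbv nbv.
exists (r * b); split; last by rewrite -scalerA -opprB; apply: submodN.
move=> u Au un; rewrite -scalerA; apply: submodZ => //; apply: bA; split=> //.
by apply/YE; split=> //; apply: AW.
Qed.

(* Mittag-Leffler: the solutions at finite levels form cosets whose images
   modulo each [pw k] stabilise, so they can be chosen coherently. *)
Lemma separate_cauchy K W s0 A : submod K -> submod W -> submod A ->
  incl K A -> incl A W -> simple_socle xs K W s0 ->
  (forall u, W u -> torsion xs K u) -> ~ incl W A ->
  exists s v, [/\ cauchy s, W v,
    forall u, A u -> exists N, forall n, (N <= n)%N -> K (s n *: u) &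
    exists N, forall n, (N <= n)%N -> ~ K (s n *: v)].
Proof.
move=> sK sW sA KA AW ss tor /existsNP[v /not_implyP[Wv nAv]].
have [n0 vn0] := tor _ Wv.
pose T n b := (forall u, A u -> level (n + n0) K u -> K (b *: u)) /\ K (b *: v - s0).
have T_ne n : exists b, T n b.
  apply: (separate_level sK sW) => //; exact: level_le (leq_addl _ _) vn0.
have T_le n k b : (n <= k)%N -> T k b -> T n b.
  move=> nk [h1 h2]; split=> // u Au un; apply: h1 => //.
  by apply: level_le un => //; rewrite leq_add2r.
(* Residues modulo [pw k] that lift to solutions at every level; by [core], all solutions at one
   large level have this property. *)
pose Tinf k r := forall n, exists b, T n b /\ pw k (r - b).
have core k : exists n1, forall b, T n1 b -> Tinf k b.
  (* The homogeneous system of which [T n] is a coset. Its images [D n] in [R / pw k], a module of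
     finite length, stabilise. *)
  pose H n b := (forall u, A u -> level (n + n0) K u -> K (b *: u)) /\ K (b *: v).
  have iH n : ideal (H n).
    split; first by split=> [u _ _|]; rewrite scale0r; apply: submod0.
    split=> [a b [ha ha'] [hb hb']|r a [ha ha']]; split.
    - by move=> u Au un; rewrite scalerDl; apply: submodD; [|apply: ha|apply: hb].
    - by rewrite scalerDl; apply: submodD.
    - by move=> u Au un; rewrite -[r *: a]/(r * a) -scalerA; apply: submodZ => //; apply: ha.
    - by rewrite -[r *: a]/(r * a) -scalerA; apply: submodZ.
  have H_le n j b : (n <= j)%N -> H j b -> H n b.
    move=> nk [h1 h2]; split=> // u Au un; apply: h1 => //.
    by apply: level_le un => //; rewrite leq_add2r.
  pose D n (c : R) := exists b, H n b /\ pw k (c - b).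
  have [j fj] := filtered_pw xs noeth k.
  have [n1 hn1] : exists n, forall i, (n <= i)%N -> incl (V := R^o) (D n) (D i).
    apply: (filtered_artin hloc hxs (ideal_pw xs k) fj) => // i.
    - split; first by exists 0; rewrite subrr; split; apply: ideal0 => //; apply: ideal_pw.
      split=> [a a' [b [Hb h]] [b' [Hb' h']]|r a [b [Hb h]]].
        exists (b + b'); split; first exact: idealD.
        by rewrite opprD addrACA; apply: (idealD (ideal_pw _ _)).
      exists (r * b); split; first exact: idealM.
      by rewrite -[r *: a]/(r * a) -mulrBr; apply: (idealM _ (ideal_pw _ _)).
    - move=> a ha; exists 0; rewrite subr0; split=> //; exact: ideal0.
    - by move=> a [b [Hb h]]; exists b; split=> //; apply: H_le Hb.
  exists n1 => b Tb n; case: (leqP n n1) => [nn1|/ltnW n1n].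
    by exists b; split; [apply: T_le Tb|rewrite subrr; apply: (ideal0 (ideal_pw _ _))].
  have [c Tc] := T_ne n.
  have /(hn1 _ n1n)[h [[Hh1 Hh2] ph]] : D n1 (b - c).
    exists (b - c); split; last by rewrite subrr; apply: (ideal0 (ideal_pw _ _)).
    case: (T_le _ _ _ n1n Tc) (Tb) => c1 c2 [b1 b2]; split.
      by move=> u Au un; rewrite scalerBl; apply: submodB; [|apply: b1|apply: c1].
    by rewrite scalerBl -(subrKA s0) -[s0 - _]opprB; apply: submodB.
  exists (c + h); split; last by rewrite opprD addrA.
  case: Tc => c1 c2; split=> [u Au un|].
    by rewrite scalerDl; apply: submodD => //; [apply: c1|apply: Hh1].
  by rewrite scalerDl addrAC; apply: submodD.
have step (kr : nat * R) : exists r', Tinf kr.1 kr.2 -> Tinf kr.1.+1 r' /\ pw kr.1 (r' - kr.2).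
  case: kr => k r /=; have [n1 hn1] := core k.+1.
  have [h|nh] := pselect (Tinf k r); last by exists 0.
  have [b [Tb hb]] := h n1; exists b => _; split; first exact: hn1.
  by have := idealM (-1) (ideal_pw xs k) hb; rewrite mulN1r opprB.
have [f hf] := choice step.
have [n1 hn1] := core 0%N; have [r0 /hn1 Tr0] := T_ne n1.
pose s := fix s k := if k is j.+1 then f (j, s j) else r0.
have Ts k : Tinf k (s k) by elim: k => //= k /(hf (k, _))[].
exists s, v; split=> //.
- by move=> k; have /(hf (k, _))[] := Ts k.
- move=> u Au; have [N uN] := tor _ (AW _ Au); exists N => n Nn.
  have [b [[b1 _] pb]] := Ts n n.
  rewrite -(subrK b (s n)) scalerDl; apply: submodD => //.
    by apply: pw_kill pb => //; apply: level_le uN.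
  by apply: b1 => //; apply: level_le uN => //; apply: leq_trans Nn (leq_addr _ _).
- exists n0 => n n0n Ksv; have [b [[_ b2] pb]] := Ts n n.
  case: ss => _ + _ _; apply; rewrite -(subrK (b *: v) s0).
  apply: submodD => //; first by rewrite -opprB; apply: submodN.
  apply: (submod_subl sK (u := s n *: v)) => //; rewrite -scalerBl.
  by apply: pw_kill pb => //; apply: level_le vn0.
Qed.

End Cauchy.

(** * The Hartshorne-Speiser-Lyubeznik theorem *)

Section HSL.
Variables (R : comNzRingType) (m : R -> Prop) (xs : seq R).
Hypotheses (hloc : is_local_max m) (hxs : same_set m (ideal_of_seq xs)).
Hypothesis noeth : noetherian R.
Variables (p : nat) (V : lmodType R).
Hypothesis charp : p \in [pchar R].
Implicit Types (X Y K A W : V -> Prop) (u v w : V) (s t : nat -> R).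
Local Notation pw := (pw xs).

(** Zorn's lemma provides [K] maximal among the submodules between [B] and [W] that avoid a socle
    element [w0]; a strictly larger one then contains [w0]. *)
Lemma simple_socle_exists B W : submod B -> submod W -> incl B W -> ~ incl W B ->
  (forall u, W u -> torsion xs B u) ->
  exists K w0, [/\ submod K, incl B K, incl K W & simple_socle xs K W w0].
Proof.
move=> sB sW BW /existsNP[u0 /not_implyP[Wu0 nB0]] tor.
have [a [na sa]] := torsion_socle sB (tor _ Wu0) nB0.
set w0 := a *: u0 in na sa.
have Ws0 : W w0 by apply: submodZ.
pose T := {X | [/\ submod X, incl B X, incl X W & ~ X w0]}.
have T0 : T by exists B; split=> // u.
pose le (X Y : T) := `[< incl (sval X) (sval Y) >].
have [|||[K [sK BK KW nK]] Kmax] := @classical_sets.ZL_preorder T T0 le.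
- by move=> X; apply/asboolP => u.
- by move=> X Y Z /asboolP h1 /asboolP h2; apply/asboolP => u /h1/h2.
- move=> C tot; have [[X0 CX0]|noC] := pselect (exists X : T, C X); last first.
    by exists T0 => X CX; case: noC; exists X.
  pose U u := exists X : T, C X /\ sval X u.
  suff PU : [/\ submod U, incl B U, incl U W & ~ U w0].
    by exists (exist _ U PU) => X CX; apply/asboolP => u Xu; exists X.
  split.
  + split; first by exists X0; split=> //; case: X0 {CX0} => X [sX /= _ _ _]; apply: (submod0 sX).
    split=> [u v [X [CX Xu]] [Y [CY Yv]]|r u [X [CX Xu]]].
      case: (tot _ _ CX CY) => /asboolP h.
        by exists Y; split=> //; case: Y h Yv {CY} => Y [sY /= _ _ _] h Yv; apply: (submodD sY); first exact: h.
      by exists X; split=> //; case: X h Xu {CX} => X [sX /= _ _ _] h Xu; apply: (submodD sX); last exact: h.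
    by exists X; split=> //; case: X Xu {CX} => X [sX /= _ _ _] Xu; apply: (submodZ _ sX).
  + by move=> u Bu; exists X0; split=> //; case: X0 {CX0} => X [sX BX /= _ _]; apply: BX.
  + by move=> u [[X [sX BX XW nX]] [_ /= /XW]].
  + by move=> [[X [sX BX XW nX]] [_ /= /nX]].
exists K, w0; split=> //; split=> //; first by move=> x /sa/BK.
move=> X sX KX XW nXK; apply: contrapT => nX.
have PX : [/\ submod X, incl B X, incl X W & ~ X w0] by split=> // u /BK/KX.
have := Kmax (exist _ X PX); rewrite /le /= => h.
by apply: nXK; apply/asboolP/h/asboolP.
Qed.

Variables (B Z : V -> Prop) (F : V -> V).
Hypotheses (sB : submod B) (sZ : submod Z) (BZ : incl B Z) (art : artin B Z).
Hypothesis tor : forall u, Z u -> torsion xs B u.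
Hypothesis FD : forall u v, F (u + v) = F u + F v.
Hypothesis FZ : forall r u, F (r *: u) = r ^+ p *: F u.
Hypotheses (FB : forall u, B u -> B (F u)) (FsZ : forall u, Z u -> Z (F u)).

Lemma charp_pos : (0 < p)%N.
Proof. by apply: prime_gt0; apply: (pcharf_prime charp). Qed.

Lemma F0 : F 0 = 0.
Proof. by have := FZ 0 0; rewrite scale0r expr0n gtn_eqF ?charp_pos // scale0r. Qed.

Lemma FN u : F (- u) = - F u.
Proof. by apply: (addrI (F u)); rewrite -FD !subrr F0. Qed.

Lemma FBr u v : F (u - v) = F u - F v. Proof. by rewrite FD FN. Qed.

Lemma iterFD j u v : iter j F (u + v) = iter j F u + iter j F v.
Proof. by elim: j => //= j ->. Qed.

Lemma iterF0 j : iter j F 0 = 0. Proof. by elim: j => //= j ->; apply: F0. Qed.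

Lemma iterFZ j r u : iter j F (r *: u) = r ^+ (p ^ j) *: iter j F u.
Proof. by elim: j => [|j /= ->]; rewrite ?expr1 // FZ -exprM expnSr. Qed.

(** * Action of the completion on a torsion module *)

Section Action.
Variable nu : V -> nat.
Hypothesis hnu : forall u, Z u -> level xs (nu u) B u.

(** The limit of [s] acts on [Z / B] through any term [s n] with [n >= nu u]. Since [nu] is an
    arbitrary choice, all identities about [act] hold modulo [B] only. *)
Definition act s u := s (nu u) *: u.

Lemma act_stable s u n : cauchy xs s -> Z u -> (nu u <= n)%N -> B (act s u - s n *: u).
Proof.
move=> cs Zu h; rewrite -opprB; apply: submodN => //; rewrite -scalerBl.
by apply: pw_kill (cauchy_le cs h) => //; apply: hnu.
Qed.

Lemma act_mem s X u : submod X -> X u -> X (act s u).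
Proof. by move=> sX; apply: submodZ. Qed.

Lemma cauchyM s t : cauchy xs s -> cauchy xs t -> cauchy xs (fun n => s n * t n).
Proof.
move=> cs ct n; rewrite -(subrKA (s n.+1 * t n)) -mulrBr -mulrBl.
apply: (idealD (ideal_pw _ _)); first exact: (idealM _ (ideal_pw _ _)).
by rewrite mulrC; apply: (idealM _ (ideal_pw _ _)).
Qed.

Lemma cauchy1 : cauchy xs (fun _ => 1).
Proof. by move=> n; rewrite subrr; apply: (ideal0 (ideal_pw _ _)). Qed.

Lemma cauchyX s k : cauchy xs s -> cauchy xs (fun n => s n ^+ k).
Proof.
move=> cs; elim: k => [|k IH]; first exact: cauchy1.
by move=> n; rewrite !exprS; apply: (cauchyM cs IH).
Qed.

Lemma actD s u v : cauchy xs s -> Z u -> Z v -> B (act s (u + v) - (act s u + act s v)).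
Proof.
move=> cs Zu Zv; pose n := maxn (nu (u + v)) (maxn (nu u) (nu v)).
have h1 : B (act s (u + v) - s n *: (u + v)).
  by apply: act_stable => //; [apply: submodD|apply: leq_maxl].
have h2 : B (act s u - s n *: u).
  by apply: act_stable => //; rewrite !leq_max leqnn orbT.
have h3 : B (act s v - s n *: v).
  by apply: act_stable => //; rewrite !leq_max leqnn !orbT.
rewrite -[_ - _](subrKA (s n *: (u + v))); apply: submodD => //.
by rewrite -opprB; apply: submodN => //; rewrite scalerDr opprD addrACA; apply: submodD.
Qed.

Lemma actZ s r u : cauchy xs s -> Z u -> B (act s (r *: u) - r *: act s u).
Proof.
move=> cs Zu; pose n := maxn (nu (r *: u)) (nu u).
have h1 : B (act s (r *: u) - s n *: (r *: u)).
  by apply: act_stable => //; [apply: submodZ|apply: leq_maxl].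
have h2 : B (act s u - s n *: u) by apply: act_stable => //; apply: leq_maxr.
rewrite -[_ - _](subrKA (s n *: (r *: u))); apply: submodD => //.
rewrite -opprB; apply: submodN => //.
by rewrite [s n *: (r *: u)]scalerA (mulrC (s n)) -scalerA -scalerBr; apply: submodZ.
Qed.

Lemma act_B s u : B u -> B (act s u). Proof. exact: act_mem. Qed.

Lemma act_congr s u v : cauchy xs s -> Z v -> B (u - v) -> B (act s u - act s v).
Proof.
move=> cs Zv h; have := actD cs (BZ h) Zv; rewrite subrK => h'.
have -> : act s u - act s v = act s u - (act s (u - v) + act s v) + act s (u - v).
  by rewrite opprD addrA addrAC subrK.
by apply: submodD => //; apply: act_B.
Qed.

Lemma actM s t u : cauchy xs s -> cauchy xs t -> Z u ->
  B (act (fun n => s n * t n) u - act s (act t u)).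
Proof.
move=> cs ct Zu; pose n := maxn (nu u) (nu (act t u)).
have h1 := act_stable (cauchyM cs ct) Zu (leq_maxl _ _ : (nu u <= n)%N).
have h2 := act_stable cs (act_mem t sZ Zu) (leq_maxr _ _ : (_ <= n)%N).
have h3 := submodZ (s n) sB (act_stable ct Zu (leq_maxl _ _ : (nu u <= n)%N)).
rewrite /= -scalerA in h1; rewrite scalerBr in h3.
rewrite -[_ - _](subrKA (s n *: (t n *: u))); apply: submodD => //.
rewrite -opprB; apply: submodN => //; rewrite -(subrKA (s n *: act t u)).
exact: submodD.
Qed.

Lemma actF s u : cauchy xs s -> Z u -> B (F (act s u) - act (fun n => s n ^+ p) (F u)).
Proof.
move=> cs Zu; pose n := maxn (nu u) (nu (F u)).
have h1 := FB (act_stable cs Zu (leq_maxl _ _ : (nu u <= n)%N)).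
have h2 := act_stable (cauchyX p cs) (FsZ Zu) (leq_maxr _ _ : (_ <= n)%N).
rewrite FBr [F (s n *: _)]FZ in h1; cbv beta in h2.
rewrite -[_ - _](subrKA (s n ^+ p *: F u)); apply: submodD => //.
by rewrite -opprB; apply: submodN.
Qed.

Definition im s X w := exists u, X u /\ B (w - act s u).

Lemma submod_im s X : cauchy xs s -> submod X -> incl X Z -> submod (im s X).
Proof.
move=> cs sX XZ; split; first by exists 0; rewrite /act scaler0 subr0; split; apply: submod0.
split=> [w w' [u [Xu h]] [u' [Xu' h']]|r w [u [Xu h]]].
  exists (u + u'); split; first exact: submodD.
  rewrite -(subrKA (act s u + act s u')); apply: submodD => //.
    by rewrite opprD addrACA; apply: submodD.
  by rewrite -opprB; apply: submodN => //; apply: actD; rewrite //; apply: XZ.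
exists (r *: u); split; first exact: submodZ.
rewrite -(subrKA (r *: act s u)); apply: submodD => //.
  by rewrite -scalerBr; apply: submodZ.
by rewrite -opprB; apply: submodN => //; apply: actZ; rewrite //; apply: XZ.
Qed.

Lemma incl_im s X : submod X -> incl B (im s X).
Proof. by move=> sX w Bw; exists 0; rewrite /act scaler0 subr0; split=> //; apply: submod0. Qed.

Lemma im_act s X u : X u -> im s X (act s u).
Proof. by move=> Xu; exists u; rewrite subrr; split=> //; apply: submod0. Qed.

Lemma im_sub s X Y : submod Y -> incl B Y -> (forall u, X u -> Y (act s u)) -> incl (im s X) Y.
Proof. by move=> sY BY h w [u [Xu /BY hw]]; apply: (submod_subr sY hw); apply: h. Qed.

Lemma im_self s X : submod X -> incl B X -> incl (im s X) X.
Proof. by move=> sX BX; apply: im_sub => // u; apply: act_mem. Qed.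

Lemma im_mono s X Y : incl X Y -> incl (im s X) (im s Y).
Proof. by move=> h w [u [/h]]; exists u. Qed.

Lemma im_im s t X : cauchy xs s -> cauchy xs t -> submod X -> incl X Z ->
  im s (im t X) = im (fun n => s n * t n) X.
Proof.
move=> cs ct sX XZ; apply: predext.
  move=> w [v [[u [Xu hv]] hw]]; exists u; split=> //.
  rewrite -(subrKA (act s v)); apply: submodD => //.
  rewrite -(subrKA (act s (act t u))); apply: submodD => //.
    by apply: act_congr => //; apply: act_mem => //; apply: XZ.
  by rewrite -opprB; apply: submodN => //; apply: actM => //; apply: XZ.
move=> w [u [Xu hw]]; exists (act t u); split; first exact: im_act.
rewrite -(subrKA (act (fun n => s n * t n) u)); apply: submodD => //.
by apply: actM => //; apply: XZ.
Qed.

Lemma im1 X : submod X -> incl B X -> im (fun _ => 1) X = X.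
Proof.
move=> sX BX; apply: predext; first exact: im_self.
by move=> u Xu; exists u; rewrite /act scale1r subrr; split=> //; apply: submod0.
Qed.

(** The submodule [R F(X) + B]; as [F] is only [p]-linear, [F(X)] itself need not be a submodule. *)
Definition spanF X w := forall Y, submod Y -> incl B Y -> (forall u, X u -> Y (F u)) -> Y w.

Lemma submod_spanF X : submod (spanF X).
Proof.
split; first by move=> Y sY _ _; apply: submod0.
split=> [u v hu hv Y sY BY h|r u hu Y sY BY h].
  by apply: submodD => //; [apply: hu|apply: hv].
by apply: submodZ => //; apply: hu.
Qed.

Lemma incl_spanF X : incl B (spanF X).
Proof. by move=> u Bu Y _ BY _; apply: BY. Qed.

Lemma spanF_mem X u : X u -> spanF X (F u).
Proof. by move=> Xu Y _ _; apply. Qed.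

Lemma spanF_sub X Y : submod Y -> incl B Y -> (forall u, X u -> Y (F u)) -> incl (spanF X) Y.
Proof. by move=> sY BY h w; apply. Qed.

Lemma spanF_Z X : incl X Z -> incl (spanF X) Z.
Proof. by move=> XZ; apply: spanF_sub => // u /XZ; apply: FsZ. Qed.

Lemma spanF_mono X Y : incl X Y -> incl (spanF X) (spanF Y).
Proof.
move=> h; apply: spanF_sub; [exact: submod_spanF|exact: incl_spanF|].
by move=> u /h; apply: spanF_mem.
Qed.

Lemma spanF_im s X : cauchy xs s -> submod X -> incl B X -> incl X Z ->
  spanF (im s X) = im (fun n => s n ^+ p) (spanF X).
Proof.
move=> cs sX BX XZ; have csp := cauchyX p cs.
have sXZ := spanF_Z XZ; have sS := submod_spanF X.
apply: predext.
  apply: spanF_sub; [exact: submod_im|exact: incl_im|].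
  move=> u [v [Xv h]]; exists (F v); split; first exact: spanF_mem.
  rewrite -(subrKA (F (act s v))); apply: submodD => //; first by rewrite -FBr; apply: FB.
  by apply: actF => //; apply: XZ.
apply: im_sub; [exact: submod_spanF|exact: incl_spanF|].
(* A span is entered only through submodules containing its generators, so the claim about [s ^ p y]
   is packaged as a submodule, inside [Z] where the action is additive modulo [B]. *)
pose Y y := Z y /\ spanF (im s X) (act (fun n => s n ^+ p) y).
have sT := submod_spanF (im s X).
have BT (a : V) b : B (a - b) -> spanF (im s X) b -> spanF (im s X) a.
  by move=> /(@incl_spanF (im s X)); apply: submod_subr.
suff : incl (spanF X) Y by move=> h u /h[].
apply: spanF_sub.
- split; first by split; rewrite /act ?scaler0; apply: submod0.
  split=> [u v [Zu hu] [Zv hv]|r u [Zu hu]]; split.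
  + exact: submodD.
  + exact: (BT _ _ (actD csp Zu Zv) (submodD sT hu hv)).
  + exact: submodZ.
  + exact: (BT _ _ (actZ r csp Zu) (submodZ r sT hu)).
- by move=> u Bu; split; [exact: BZ|exact: (@incl_spanF _ _ (act_B _ Bu))].
- move=> u Xu; have Zu := XZ _ Xu; split; first exact: FsZ.
  apply: (BT _ (F (act s u))); last by exact: (spanF_mem (im_act _ Xu)).
  by rewrite -opprB; apply: submodN => //; apply: actF.
Qed.

Lemma submod_iterF j X : submod X -> submod (fun w => X (iter j F w)).
Proof.
move=> sX; split; first by rewrite iterF0; apply: submod0.
split=> [u v hu hv|r u hu]; first by rewrite iterFD; apply: submodD.
by rewrite iterFZ; apply: submodZ.
Qed.

Lemma iter_stable j X u : (forall u, X u -> X (F u)) -> X u -> X (iter j F u).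
Proof. by move=> h Xu; elim: j => //= j /h. Qed.

(** The preimage of [Y] under an iterate of [F] is a submodule by semilinearity, so it contains the
    span as soon as it contains the generators [F u]. *)
Lemma iter_spanF_nil j X Y : submod Y -> incl B Y -> (forall u, Y u -> Y (F u)) ->
  (forall u, X u -> Y (iter j F u)) -> incl (iter j spanF X) Y.
Proof.
move=> sY BY YF; elim: j X => [|j IH] X h //.
rewrite iterSr; apply: IH => u.
apply: (spanF_sub (submod_iterF j sY)).
  by move=> v Bv; apply: iter_stable => //; apply: BY.
by move=> v /h; rewrite iterSr.
Qed.

Lemma iter_spanF_mem j X u : X u -> iter j spanF X (iter j F u).
Proof. by move=> Xu; elim: j => //= j; apply: spanF_mem. Qed.

Lemma iter_spanF_props j X : submod X -> incl B X -> incl X Z ->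
  [/\ submod (iter j spanF X), incl B (iter j spanF X) & incl (iter j spanF X) Z].
Proof.
move=> sX BX XZ; elim: j => //= j [_ _ h]; split.
- exact: submod_spanF. - exact: incl_spanF. - exact: spanF_Z.
Qed.

Lemma iter_spanF_im s j X : cauchy xs s -> submod X -> incl B X -> incl X Z ->
  iter j spanF (im s X) = im (fun n => s n ^+ (p ^ j)) (iter j spanF X).
Proof.
move=> cs sX BX XZ; elim: j => [|j /= ->].
  by rewrite /= expn0; congr (im _ X); apply/funext => n; rewrite expr1.
have [s1 B1 Z1] := iter_spanF_props j sX BX XZ.
rewrite spanF_im //; last exact: cauchyX.
by congr (im _ _); apply/funext => n; rewrite -exprM expnSr.
Qed.

(** * Chains in modules with finitely many simple-socle layers *)

Section Corank.
Variables (G B1 : V -> Prop) (NN : (nat -> R) -> Prop).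
Hypotheses (sG : submod G) (GZ : incl G Z) (s1 : submod B1) (BB1 : incl B B1).
Hypothesis NN1 : NN (fun _ => 1).
Hypothesis NNM : forall s t, cauchy xs s -> cauchy xs t -> NN s -> NN t ->
  NN (fun n => s n * t n).
Hypothesis NN_nz : forall s v, cauchy xs s -> G v -> ~ B1 (act s v) -> NN s.

(** [r] layers with simple socle, built upwards from [B1]. [NN] plays the part of the nonzero
    elements of a domain: it is closed under products and contains every multiplier that is nonzero
    on [G / B1]. *)
Inductive filt : nat -> (V -> Prop) -> Prop :=
| filt0 : filt 0 B1
| filtS r K W w0 : filt r K -> submod K -> submod W -> incl B1 K -> incl K W -> incl W G ->
    simple_socle xs K W w0 -> filt r.+1 W.

(** A minimal submodule without such a filtration has a quotient [X / K] with simple socle, and the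
    strictly smaller [K] has a filtration. *)
Lemma filt_exists W : submod W -> incl B1 W -> incl W G -> exists r, filt r W.
Proof.
move=> sW B1W WG; apply: contrapT => nW.
pose P X := [/\ submod X, incl B1 X, incl X G & ~ exists r, filt r X].
have [||X [[sX B1X XG nX] Xmin]] := @artin_min _ V B Z P W art.
- move=> X [sX B1X XG _]; split=> //; first by move=> u /BB1/B1X.
  by move=> u /XG/GZ.
- by [].
have [XB1|nXB1] := pselect (incl X B1).
  by apply: nX; exists 0%N; rewrite (predext XB1 B1X); apply: filt0.
have [|K [w0 [sK B1K KX ss]]] := simple_socle_exists s1 sX B1X nXB1.
  by move=> u /XG/GZ/tor[n hn]; exists n => x /hn/BB1.
have [[r fr]|nK] := pselect (exists r, filt r K).
  by apply: nX; exists r.+1; apply: (filtS fr) ss.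
have KG : incl K G by move=> u /KX/XG.
have XK : incl X K by apply: Xmin.
by case: ss => Xw nKw _ _; apply: nKw; apply: XK.
Qed.

(* A module with [r] simple-socle layers has "rank" at most [r]: the annihilator
   of some step of a longer chain contains a multiplier from [NN]. *)
Lemma corank r W : filt r W -> forall C : nat -> V -> Prop, (forall i, submod (C i)) ->
  (forall i, incl (C i) (C i.+1)) -> (forall i, incl B1 (C i)) -> (forall i, incl (C i) W) ->
  exists i s, [/\ cauchy xs s, NN s & forall u, C i.+1 u -> C i (act s u)].
Proof.
elim=> [|{}r K {}W w0 frK IH sK sW B1K KW WG ss] C sC Cinc B1C CW.
  exists 0%N, (fun _ => 1); split=> //; first exact: cauchy1.
  by move=> u /CW ?; rewrite /act scale1r; apply: B1C.
have BK : incl B K by move=> u /BB1/B1K.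
pose full i := incl W (join (C i) K).
have sJ i : submod (join (C i) K) by apply: submod_join.
(* If [C i + K] is not [W], some multiplier annihilates [C i] but not [W] modulo [K]; the latter
   puts it in [NN]. *)
have not_full i : ~ full i -> exists t, [/\ cauchy xs t, NN t & forall u, C i u -> K (act t u)].
  move=> nf; have [|||t [v [ct Wv tA [N tv]]]] := separate_cauchy hloc hxs noeth sK sW (sJ i) _ _ ss _ nf.
  - exact: incl_joinr.
  - by move=> u [a [b [/CW Wa [/KW Wb ->]]]]; apply: submodD.
  - by move=> u /WG/GZ/tor[n hn]; exists n => x /hn/BK.
  have stab u n : Z u -> (nu u <= n)%N -> K (act t u - t n *: u).
    by move=> Zu h; apply: BK; apply: act_stable.
  exists t; split=> //.
    apply: (NN_nz ct (WG _ Wv)) => /B1K Ktv.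
    apply: (tv _ (leq_maxl N (nu v))); apply: (submod_subl sK _ Ktv).
    by apply: stab (leq_maxr _ _); apply/GZ/WG.
  move=> u Cu; have [N' hN'] : exists N, forall n, (N <= n)%N -> K (t n *: u).
    by apply: tA; apply: incl_joinl.
  apply: (submod_subr sK _ (hN' _ (leq_maxl N' (nu u)))).
  by apply: stab (leq_maxr _ _); apply/GZ/WG/(CW i).
have [k [kmin kfull]] : exists k : option nat,
    (forall i, ~~ oapp (leq^~ i) false k -> ~ full i) /\ (forall j, k = Some j -> full j).
  have [ex|nex] := pselect (exists j, `[< full j >]); last first.
    by exists None; split=> // i _ fi; apply: nex; exists i; apply/asboolP.
  case: (ex_minnP ex) => j /asboolP fj jmin; exists (Some j); split=> [i /=|_ [<-] //].
  by move=> nji fi; case/negP: nji; apply: jmin; apply/asboolP.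
pose before i := ~~ oapp (leq^~ i) false k.
have after_step i u : ~~ before i -> C i.+1 u -> exists a b, [/\ C i a, meet (C i.+1) K b & u = a + b].
  rewrite /before negbK; case: (k) kfull => //= j /(_ _ erefl) fj ji Cu.
  have [a [b [Ca [Kb uE]]]] := fj _ (CW _ _ Cu).
  have Ci : forall n, (j <= n)%N -> C n a.
    by elim=> [|n IHn]; [rewrite leqn0 => /eqP <-|rewrite leq_eqVlt => /orP[/eqP <-|/IHn/Cinc]].
  exists a, b; split=> //; first exact: Ci.
  split=> //; have -> : b = u - a by rewrite uE addrC addKr.
  by apply: submodB => //; apply/Cinc/Ci.
(* The first full term is left out of the chain in [K]: the step that reaches it is neither pushed
   into [K] by a multiplier nor generated over the previous term by elements of [K]. *)
pose C' i := meet (C (if before i then i else i.+1)) K.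
have before_le i : before i.+1 -> before i.
  by rewrite /before; apply: contra; case: (k) => //= j /leqW.
have [||||i [s [cs NNs hs]]] := IH C'.
- by move=> i; apply: submod_meet.
- move=> i u [Cu Ku]; split=> //; move: Cu.
  case bi1: (before i.+1); first by rewrite before_le // => /Cinc.
  by case: (before i) => /Cinc => [/Cinc|].
- by move=> i u B1u; split; [apply: B1C|apply: B1K].
- by move=> i u [].
rewrite /C' in hs.
have shift j : ~~ before j -> (forall u, meet (C j.+1) K u -> C j (act s u)) ->
    exists i s, [/\ cauchy xs s, NN s & forall u, C i.+1 u -> C i (act s u)].
  move=> nbj h; exists j, s; split=> // u Cu.
  have [a [b [Ca mb ->]]] := after_step _ _ nbj Cu.
  have Za : Z a by apply/GZ/WG/(CW j).
  have Zb : Z b by apply/GZ/WG/KW; case: mb.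
  apply: (submod_subr (sC j) (B1C _ _ (BB1 (actD cs Za Zb)))).
  by apply: submodD => //; [apply: act_mem|apply: h].
case bi1: (before i.+1) hs => hs.
  rewrite before_le // in hs; have [t [ct NNt ht]] := not_full _ (kmin _ bi1).
  exists i, (fun n => s n * t n); split; [exact: cauchyM|exact: NNM|].
  move=> u Cu; have Zu : Z u by apply/GZ/WG/(CW i.+1).
  apply: (submod_subr (sC i) (B1C _ _ (BB1 (actM cs ct Zu)))).
  by case: (hs (act t u)) => //; split; [apply: act_mem|apply: ht].
apply: (shift i.+1); first by rewrite bi1.
move=> u /hs[+ _]; case: (before i) => //; exact: Cinc.
Qed.

End Corank.

(** * From elementwise to uniform nilpotency *)

Hypothesis nil : forall u, Z u -> exists e, B (iter e F u).

Definition nonnil X := forall j, exists u, X u /\ ~ B (iter j F u).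

Lemma nonnil_mono X Y : incl X Y -> nonnil X -> nonnil Y.
Proof. by move=> h nX j; have [u [/h Xu nB]] := nX j; exists u. Qed.

Lemma nonnilPn X : ~ nonnil X -> exists j, forall u, X u -> B (iter j F u).
Proof.
move=> /existsNP[j /forallNP h]; exists j => u Xu; apply: contrapT => nB.
by apply: (h u).
Qed.

Lemma im_exp_sub s k X : cauchy xs s -> submod X -> incl B X -> incl X Z -> (0 < k)%N ->
  incl (im (fun n => s n ^+ k) X) (im s X).
Proof.
case: k => // k cs sX BX XZ _; have ck := cauchyX k cs.
have -> : (fun n => s n ^+ k.+1) = (fun n => s n * s n ^+ k).
  by apply/funext => n; rewrite exprS.
by rewrite -(im_im cs ck sX XZ); apply: im_mono; apply: im_self.
Qed.

Section Stable.
Variable L : V -> Prop.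
Hypotheses (sL : submod L) (BL : incl B L) (LZ : incl L Z) (spanL : spanF L = L).

Lemma iter_spanL j : iter j spanF L = L. Proof. by elim: j => //= j ->. Qed.

Lemma nonnil_stable : ~ incl L B -> nonnil L.
Proof.
move=> nLB j; apply: contrapT => h; apply: nLB; rewrite -(iter_spanL j).
by apply: iter_spanF_nil => // u Lu; apply: contrapT => nB; apply: h; exists u.
Qed.

Lemma spanF_im_stable s : cauchy xs s -> spanF (im s L) = im (fun n => s n ^+ p) L.
Proof. by move=> cs; rewrite spanF_im // spanL. Qed.

Lemma nonnil_spanF X : nonnil X -> nonnil (spanF X).
Proof.
move=> nX j; have [u [Xu nB]] := nX j.+1; exists (F u); split; first exact: spanF_mem.
by rewrite -iterSr.
Qed.

End Stable.

(** [G] is a minimal non-nilpotent image [g L]. Its span [R F(G) = g ^ p L] is again such an image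
    and lies in [G], so equals it; likewise [s G = s g L] is all of [G] unless it is uniformly
    nilpotent. *)
Lemma minimal_nonnil L : submod L -> incl B L -> incl L Z -> spanF L = L -> ~ incl L B ->
  exists G, [/\ submod G, incl B G & incl G Z] /\
    [/\ spanF G = G, nonnil G &
        forall s, cauchy xs s -> nonnil (im s G) -> im s G = G].
Proof.
move=> sL BL LZ spanL nLB.
pose P X := exists g, [/\ cauchy xs g, X = im g L & nonnil X].
have propP X : P X -> [/\ submod X, incl B X & incl X Z].
  move=> [g [cg -> _]]; split; [exact: submod_im|exact: incl_im|].
  by move=> u /(im_self sL BL)/LZ.
have PL : P L.
  exists (fun _ => 1); rewrite im1 //; split=> //; first exact: cauchy1.
  exact: nonnil_stable.
have [G [PG Gmin]] := artin_min art propP PL.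
have [sG BG GZ] := propP _ PG.
have [g [cg GE nG]] := PG; exists G; split=> //; split=> //.
  have nS : nonnil (spanF G) by apply: nonnil_spanF.
  have sub : incl (spanF G) G.
    by rewrite {1}GE spanF_im_stable // GE; apply: im_exp_sub => //; apply: charp_pos.
  apply: predext => //; apply: Gmin => //; exists (fun n => g n ^+ p); split=> //.
    exact: cauchyX.
  by rewrite GE spanF_im_stable.
move=> s cs nis; have sub := im_self (s := s) sG BG.
apply: predext => //; apply: Gmin => //; exists (fun n => s n * g n); split=> //.
  exact: cauchyM.
by rewrite GE im_im.
Qed.

Lemma stable_trivial L : submod L -> incl B L -> incl L Z -> spanF L = L -> incl L B.
Proof.
move=> sL BL LZ spanL; apply: contrapT => nLB.
have [G [[sG BG GZ] [spanG nG dich]]] := minimal_nonnil sL BL LZ spanL nLB.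
pose NN s := nonnil (im s G).
have NNM s t : cauchy xs s -> cauchy xs t -> NN s -> NN t -> NN (fun n => s n * t n).
  by move=> cs ct hs ht; rewrite /NN -im_im // (dich t ct ht) (dich s cs hs).
have NN1 : NN (fun _ => 1) by rewrite /NN im1.
(* As [G] equals its [j]-th iterated span, a power [F ^ j] that kills [s G] makes [s ^ (p ^ j)] kill
   [G]. *)
have nilpotent s : cauchy xs s -> ~ NN s -> exists j, incl (im (fun n => s n ^+ (p ^ j)) G) B.
  move=> cs /nonnilPn[j hj]; exists j; rewrite -{1}(iter_spanL spanG j) -iter_spanF_im //.
  exact: iter_spanF_nil.
have nGB : ~ incl G B by move=> GB; have [u [/GB Bu]] := nG 0%N.
pose P X := exists s, [/\ cauchy xs s, X = im s G & ~ incl X B].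
have [||X [[t [ct XE nX]] Xmin]] := @artin_min _ V B Z P G art.
- move=> X [s [cs -> _]]; split; [exact: submod_im|exact: incl_im|].
  by move=> u /(im_self sG BG)/GZ.
- by exists (fun _ => 1); rewrite im1 //; split=> //; apply: cauchy1.
(* Generated by the images of the multipliers outside [NN]: modulo [B1] these act as zero, while
   those in [NN] act surjectively. *)
pose B1 w := forall Y, submod Y -> incl B Y ->
  (forall s u, cauchy xs s -> ~ NN s -> G u -> Y (act s u)) -> Y w.
have sB1 : submod B1.
  split; first by move=> Y sY _ _; apply: submod0.
  split=> [u v hu hv Y sY BY h|r u hu Y sY BY h].
    by apply: submodD => //; [apply: hu|apply: hv].
  by apply: submodZ => //; apply: hu.
have BB1 : incl B B1 by move=> u Bu Y _ BY _; apply: BY.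
have B1act s u : cauchy xs s -> ~ NN s -> G u -> B1 (act s u).
  by move=> cs ns Gu Y _ _; apply.
have B1G : incl B1 G by move=> w; apply=> // s u _ _; apply: act_mem.
(* [t G] is minimal among nonzero images, and [t] annihilates [B1]: otherwise some [s] outside [NN]
   maps [t G] onto itself, and so do its powers, although [s ^ (p ^ j)] kills [G]. *)
have nGB1 : ~ incl G B1.
  move=> GB1; apply: (nX) => w; rewrite XE => -[u [Gu hw]].
  suff Q : G u /\ B (act t u) by apply: (submod_subr sB hw); case: Q.
  apply: (GB1 u Gu (fun u => G u /\ B (act t u))).
  - split; first by split; rewrite /act ?scaler0; apply: submod0.
    split=> [a b [Ga ha] [Gb hb]|r a [Ga ha]]; split.
    + exact: submodD.
    + by apply: (submod_subr sB (actD ct (GZ _ Ga) (GZ _ Gb))); apply: submodD.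
    + exact: submodZ.
    + by apply: (submod_subr sB (actZ r ct (GZ _ Ga))); apply: submodZ.
  - by move=> a Ba; split; [apply: BG|apply: act_B].
  move=> s a cs ns Ga; split; first exact: act_mem.
  have Ist : im (fun n => s n * t n) G = im s X by rewrite XE im_im.
  have Its : im (fun n => s n * t n) G = im t (im s G).
    by rewrite im_im //; congr (im _ G); apply/funext => n; rewrite mulrC.
  suff IB : incl (im s X) B.
    by apply: IB; rewrite -Ist Its; apply/im_act/im_act.
  apply: contrapT => nIB.
  have sX : submod X by rewrite XE; apply: submod_im.
  have BX : incl B X by rewrite XE; apply: incl_im.
  have XG : incl X G by rewrite XE; apply: im_self.
  have XZ : incl X Z by move=> v /XG/GZ.
  have Xs : im s X = X.
    apply: predext; first exact: im_self.
    apply: Xmin; last exact: im_self.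
    by exists (fun n => s n * t n); split=> //; exact: cauchyM.
  have [j hj] := nilpotent s cs ns.
  have Xpow k : im (fun n => s n ^+ k) X = X.
    elim: k => [|k IHk]; first exact: im1.
    have -> : (fun n => s n ^+ k.+1) = (fun n => s n * s n ^+ k).
      by apply/funext => n; rewrite exprS.
    by rewrite -im_im ?IHk //; apply: cauchyX.
  by apply: nX; rewrite -(Xpow (p ^ j)%N) => v /(im_mono XG)/hj.
have FB1 u : B1 u -> B1 (F u).
  move=> hu; suff [] : G u /\ B1 (F u) by [].
  apply: (hu (fun u => G u /\ B1 (F u))).
  - split; first by rewrite F0; split; apply: submod0.
    split=> [a b [Ga ha] [Gb hb]|r a [Ga ha]]; split.
    + exact: submodD.
    + by rewrite FD; exact: (submodD sB1 ha hb).
    + exact: submodZ.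
    + by rewrite FZ; exact: (submodZ _ sB1 ha).
  - move=> a Ba; split; [exact: BG|exact: (BB1 _ (FB Ba))].
  - move=> s a cs ns Ga; split; first exact: act_mem.
    apply: (submod_subr sB1 (BB1 _ (actF cs (GZ _ Ga)))).
    apply: B1act; first exact: cauchyX.
      move=> nsp; apply: ns; apply: nonnil_mono nsp.
      by apply: im_exp_sub => //; apply: charp_pos.
    by rewrite -spanG; apply: spanF_mem.
have NN_nz s v : cauchy xs s -> G v -> ~ B1 (act s v) -> NN s.
  by move=> cs Gv h; apply: contrapT => ns; apply: h; apply: B1act.
have [r fr] := filt_exists GZ sB1 BB1 sG B1G (fun u => id).
pose N j u := G u /\ B1 (iter j F u).
have sN j : submod (N j).
  exact: (submod_meet sG (submod_iterF j sB1)).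
have GF u : G u -> G (F u) by move=> Gu; rewrite -spanG; apply: spanF_mem.
have [||||i [s [cs NNs hs]]] := corank GZ BB1 NN1 NNM NN_nz fr (C := N).
- by [].
- by move=> i u [Gu hu]; split=> //=; apply: FB1.
- by move=> i u B1u; split; [exact: B1G|exact: (iter_stable _ FB1 B1u)].
- by move=> i u [].
have BN : incl B (N i).
  by move=> u /BB1 B1u; split; [exact: B1G|exact: (iter_stable _ FB1 B1u)].
(* if [s] maps [N i.+1] into [N i] then [s ^ 2] maps every [N j] into [N i]:
   [s ^ p] is a multiple of [s ^ 2] and [F (s u) = s ^ p F u] *)
have trick j u : N (i + j)%N u -> N i (act s (act s u)).
  elim: j u => [|j IHj] u; first by rewrite addn0 => Nu; do 2 apply: act_mem => //.
  rewrite addnS => -[Gu hu]; apply: hs; split; first exact: act_mem.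
  have Zu := GZ _ Gu; rewrite iterSr.
  have NFu : N (i + j)%N (F u) by split; [apply: GF|rewrite -iterSr].
  have [_] := IHj _ NFu.
  move=> h; have cp := cauchyX p cs; have cp2 := cauchyX p.-2 cs.
  have p2 : p = p.-2.+2 by case: (p) (prime_gt1 (pcharf_prime charp)) => [|[|]].
  suff [] : N i (F (act s u)) by [].
  apply: (submod_subr (sN i) (BN _ (actF cs Zu))).
  have -> : (fun n => s n ^+ p) = (fun n => s n ^+ p.-2 * (s n * s n)).
    by apply/funext => n; rewrite {1}p2 !exprSr mulrA.
  apply: (submod_subr (sN i) (BN _ (actM cp2 (cauchyM cs cs) (GZ _ (GF _ Gu))))).
  apply: act_mem => //.
  apply: (submod_subr (sN i) (BN _ (actM cs cs (GZ _ (GF _ Gu))))).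
  exact: IHj.
(* Every element of [G] is [s (s u)] with [u] killed by some [F ^ e]. The exponent [e] depends on
   [u], but [trick] lands in the same [N i] for all of them. *)
have GN : incl G (N i).
  have E : im s (im s G) = G by rewrite !(dich s cs NNs).
  move=> w; rewrite -E => -[v [[u [Gu hv]] hw]].
  have Zu := GZ _ Gu; have [e he] := nil Zu.
  apply: (submod_subr (sN i) (BN _ hw)).
  apply: (submod_subr (sN i) (BN _ (act_congr cs (act_mem s sZ Zu) hv))).
  apply: (trick e); split=> //.
  by rewrite iterD; exact: (iter_stable _ FB1 (BB1 _ he)).
apply: nGB1; rewrite -(iter_spanL spanG i).
by apply: iter_spanF_nil => // u /GN[].
Qed.

(** The iterated spans of [Z] decrease to a submodule equal to its own span, which [stable_trivial]
    makes zero; the index of stability is the exponent. *)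
Lemma hsl_act : exists e, forall u, Z u -> B (iter e F u).
Proof.
have props j := iter_spanF_props j sZ BZ (fun u => id).
have dec j : incl (iter j.+1 spanF Z) (iter j spanF Z).
  by elim: j => [|j IH] /=; [apply: spanF_Z|apply: spanF_mono].
have [e he] : exists n, forall i, (n <= i)%N -> incl (iter n spanF Z) (iter i spanF Z).
  by apply: art => // i; case: (props i).
exists e => u Zu; have [sL BL LZ] := props e.
apply: (stable_trivial sL BL LZ); last exact: iter_spanF_mem.
by apply: predext; [apply: (dec e)|apply: (he e.+1)].
Qed.

End Action.

Theorem hartshorne_speiser_lyubeznik : (forall u, Z u -> exists e, B (iter e F u)) ->
  exists e, forall u, Z u -> B (iter e F u).
Proof.
move=> nil.
have step u : exists n, Z u -> level xs n B u.
  by have [/tor[n hn]|nZ] := pselect (Z u); [exists n|exists 0%N].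
have [nu hnu] := choice step.
exact: (hsl_act hnu nil).
Qed.

End HSL.

(** * Koszul and Cech complexes *)

Section Koszul.
Variables (R : comNzRingType) (xs : seq R).
Local Notation I := 'I_(size xs).
Implicit Types (S T : {set I}) (c e : {set I} -> R) (i k l : I) (n : nat).

Definition sgn k T : R := (-1) ^+ #|[set i in T | (val i < val k)%N]|.

Lemma sgn_sq k T : sgn k T * sgn k T = 1.
Proof. by rewrite /sgn -exprMn mulrNN mul1r expr1n. Qed.

Lemma sgn_D1 k l T : l \in T -> sgn k (T :\ l) = sgn k T * (if (val l < val k)%N then -1 else 1).
Proof.
move=> lT; rewrite /sgn; case: ifP => lk.
  have -> : [set i in T :\ l | (val i < val k)%N] = [set i in T | (val i < val k)%N] :\ l.
    by apply/setP => i; rewrite !inE andbA.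
  rewrite [in RHS](cardsD1 l) !inE lT /= lk exprD expr1.
  by rewrite mulrAC mulrNN mul1r mul1r.
have -> : [set i in T :\ l | (val i < val k)%N] = [set i in T | (val i < val k)%N].
  apply/setP => i; rewrite !inE; case: eqP => //= ->; by rewrite lk andbF.
by rewrite mulr1.
Qed.

(** For a fixed denominator exponent [n], the Cech differential acts on numerators as the Koszul
    differential of the [n]-th powers of [xs]. *)
Definition koszul n c T := \sum_(k in T) sgn k T * c (T :\ k) * xs`_k ^+ n.

Definition contract i c S := if i \in S then 0 else sgn i S * c (i |: S).

(** For [i] in [T] only the term [k = i] survives; otherwise the terms [k != i] cancel by sign. This
    null-homotopy yields both [d ^ 2 = 0] and the torsion of cohomology. *)
Lemma homotopy i n c T :
  koszul n (contract i c) T + contract i (koszul n c) T = xs`_i ^+ n * c T.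
Proof.
rewrite /contract; case: ifP => [iT|/negbT niT].
  rewrite addr0 /koszul (bigD1 i) //= big1 ?addr0 => [|k /andP[kT ki]]; last first.
    by rewrite !inE eq_sym ki iT mulr0 mul0r.
  rewrite !inE eqxx /= setD1K // (sgn_D1 _ iT) ltnn mulr1 mulrA sgn_sq mul1r.
  by rewrite mulrC.
have iTi : i \in i |: T by rewrite !inE eqxx.
have TiE : (i |: T) :\ i = T by rewrite setU1K.
have sgnT k : k != i -> sgn k (i |: T) = sgn k T * (if (val i < val k)%N then -1 else 1).
  move=> ki; have := sgn_D1 k iTi; rewrite TiE => ->; rewrite -mulrA.
  by case: ifP => _; rewrite ?mulrNN !mulr1.
have sgni : sgn i (i |: T) = sgn i T.
  by have := sgn_D1 i iTi; rewrite TiE ltnn mulr1.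
rewrite /koszul (bigD1 i iTi) /= TiE sgni mulrDr !mulrA sgn_sq mul1r addrCA.
rewrite [c T * _]mulrC -[RHS]addr0; congr (_ + _).
rewrite mulr_sumr [X in _ + X](eq_bigl (mem T)); last first.
  move=> k; rewrite -[LHS]/((k \in i |: T) && (k != i)) -[RHS]/(k \in T) !inE.
  by have [->|] := eqVneq k i; rewrite ?(negbTE niT) ?andbT.
rewrite -big_split /=; apply: big1 => k kT.
have ki : k != i by apply: contraNneq niT => <-.
rewrite !inE (negbTE niT) andbF.
have -> : (i |: T) :\ k = i |: (T :\ k).
  by apply/setP => l; rewrite !inE; have [->|] := eqVneq l k; rewrite ?(negbTE ki) ?orbF.
rewrite (sgn_D1 _ kT) (sgnT _ ki) !mulrA -!mulrDl.
rewrite (_ : _ + _ = 0) ?mul0r //.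
have [ki'|ik|E] := ltngtP (val k) (val i).
- ring.
- ring.
- by case/eqP: ki; apply: val_inj.
Qed.

Lemma koszulD n c e T : koszul n (fun S => c S + e S) T = koszul n c T + koszul n e T.
Proof. by rewrite /koszul -big_split; apply: eq_bigr => k _; rewrite mulrDr mulrDl. Qed.

Lemma koszulZ n r c T : koszul n (fun S => r * c S) T = r * koszul n c T.
Proof. by rewrite /koszul mulr_sumr; apply: eq_bigr => k _; rewrite mulrCA !mulrA. Qed.

(* The differential squares to zero: by the homotopy formula its square commutes
   with every contraction, which reduces the claim to smaller sets. *)
Lemma koszul_koszul n c T : koszul n (koszul n c) T = 0.
Proof.
elim: {T}#|T| {-2}T (erefl #|T|) c => [|j IH] T cT c.
  by rewrite /koszul (cards0_eq cT) big_set0.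
have /card_gt0P[i iT] : (0 < #|T|)%N by rewrite cT.
have comm S : koszul n (koszul n (contract i c)) S = contract i (koszul n (koszul n c)) S.
  have h1 e U : koszul n (contract i e) U = xs`_i ^+ n * e U - contract i (koszul n e) U.
    by rewrite -(homotopy i n e U) addrK.
  have -> : koszul n (contract i c) = fun U => xs`_i ^+ n * c U + (-1) * contract i (koszul n c) U.
    by apply/funext => U; rewrite h1 mulN1r.
  by rewrite koszulD !koszulZ h1 mulN1r opprB addrC subrK.
have := comm (T :\ i); rewrite IH; last by have := cardsD1 i T; rewrite iT cT => -[].
rewrite /contract !inE eqxx /= setD1K // => h.
by rewrite -[LHS]mul1r -(sgn_sq i (T :\ i)) -[LHS]mulrA -h mulr0.
Qed.

Lemma xS_D1 k T : k \in T -> xS T = xs`_k * xS (T :\ k) :> R.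
Proof. by move=> kT; rewrite /xS (big_setD1 k). Qed.

Lemma koszul_lift n a c T : koszul (n + a) (fun S => xS S ^+ a * c S) T = xS T ^+ a * koszul n c T.
Proof.
rewrite /koszul mulr_sumr; apply: eq_bigr => k kT.
rewrite (xS_D1 kT) exprMn exprD; ring.
Qed.

End Koszul.

(** * Cech cohomology of the quotients of [R] *)

Section Cech.
Variables (R : comNzRingType) (xs : seq R).
Local Notation I := 'I_(size xs).

(* A cochain of the Cech complex is represented by the sequence of its numerators
   over the denominators [xS S ^+ n]; only large [n] matter. *)
Definition germ := nat -> {set I} -> R^o.
HB.instance Definition _ := GRing.Lmodule.copy germ (nat -> {set I} -> R^o).

Implicit Types (S T : {set I}) (g h b c w u : germ) (J : R -> Prop) (i j n N : nat).

Lemma germD g h n S : (g + h) n S = g n S + h n S. Proof. by []. Qed.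
Lemma germN g n S : (- g) n S = - g n S. Proof. by []. Qed.
Lemma germZ r g n S : (r *: g) n S = r * g n S. Proof. by []. Qed.
Lemma germP g h : (forall n S, g n S = h n S) -> g = h.
Proof. by move=> e; apply/funext => n; apply/funext => S; apply: e. Qed.

Definition null_germ j J g := forall S, #|S| = j -> exists N, forall n, (N <= n)%N -> J (g n S).

(** The numerators of a single fraction satisfy [g n.+1 S = xS S * g n S]. Asking this only modulo
    [J] and for large [n] lets the same germs serve all quotients [R / J]. *)
Definition shift g : germ := fun n S => g n.+1 S - xS S * g n S.
Definition compat_germ j J g := null_germ j J (shift g).
Definition diff g : germ := fun n T => koszul n (g n) T.
Definition lift N (e : {set I} -> R) : germ := fun n S => xS S ^+ (n - N) * e S.

Lemma nul_unif j J g : null_germ j J g ->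
  exists N, forall n S, (N <= n)%N -> #|S| = j -> J (g n S).
Proof.
move=> h; have h' S : exists N, #|S| = j -> forall n, (N <= n)%N -> J (g n S).
  by have [/h[N hN]|nS] := pselect (#|S| = j); [exists N|exists 0%N].
have [f hf] := choice h'; exists (\max_S f S) => n S Nn Sj; apply: hf => //.
by apply: leq_trans Nn; apply: leq_bigmax.
Qed.

Lemma nul_of_unif j J g N : (forall n S, (N <= n)%N -> #|S| = j -> J (g n S)) -> null_germ j J g.
Proof. by move=> h S Sj; exists N => n Nn; apply: h. Qed.

Lemma submod_nul j J : ideal J -> submod (null_germ j J).
Proof.
move=> iJ; split; first by move=> S _; exists 0%N => n _; apply: ideal0.
split=> [g h hg hh|r g hg].
  have [N hN] := nul_unif hg; have [M hM] := nul_unif hh.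
  apply: (nul_of_unif (N := maxn N M)) => n S; rewrite geq_max => /andP[h1 h2] Sj.
  by rewrite germD; apply: idealD => //; [apply: hN|apply: hM].
have [N hN] := nul_unif hg; apply: (nul_of_unif (N := N)) => n S h1 Sj.
by rewrite germZ; apply: idealM => //; apply: hN.
Qed.

Lemma nul_sub j J J' g : (forall r, J r -> J' r) -> null_germ j J g -> null_germ j J' g.
Proof. by move=> JJ' h S /h[N hN]; exists N => n /hN/JJ'. Qed.

Lemma shiftD g h : shift (g + h) = shift g + shift h.
Proof. by apply: germP => n S; rewrite germD /shift !germD; ring. Qed.
Lemma shiftZ r g : shift (r *: g) = r *: shift g.
Proof. by apply: germP => n S; rewrite germZ /shift !germZ; ring. Qed.

Lemma submod_good j J : ideal J -> submod (compat_germ j J).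
Proof.
move=> iJ; have sN := submod_nul j iJ; split.
  by rewrite /compat_germ -[0](scale0r 0) shiftZ scale0r; exact: (submod0 sN).
split=> [g h hg hh|r g hg]; rewrite /compat_germ ?shiftD ?shiftZ; first exact: (submodD sN hg hh).
exact: (submodZ r sN hg).
Qed.

Lemma diffD g h : diff (g + h) = diff g + diff h.
Proof. by apply: germP => n S; rewrite germD /diff -koszulD. Qed.
Lemma diffZ r g : diff (r *: g) = r *: diff g.
Proof. by apply: germP => n S; rewrite germZ /diff -koszulZ. Qed.
Lemma diff0 : diff 0 = 0.
Proof. by rewrite -[0](scale0r 0) diffZ !scale0r. Qed.
Lemma diffN g : diff (- g) = - diff g.
Proof. by rewrite -scaleN1r diffZ scaleN1r. Qed.
Lemma diffB g h : diff (g - h) = diff g - diff h.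
Proof. by rewrite diffD diffN. Qed.

Lemma diff_diff g : diff (diff g) = 0.
Proof. by apply: germP => n S; rewrite /diff koszul_koszul. Qed.

Lemma koszul_mem n e T J j : ideal J -> #|T| = j.+1 -> (forall S, #|S| = j -> J (e S)) ->
  J (koszul n e T).
Proof.
move=> iJ Tj h; apply: ideal_sum => // k kT; rewrite mulrC mulrA; apply: idealM => //.
by apply: h; have := cardsD1 k T; rewrite kT Tj => -[].
Qed.

Lemma diff_nul j J g : ideal J -> null_germ j J g -> null_germ j.+1 J (diff g).
Proof.
move=> iJ /nul_unif[N hN]; apply: (nul_of_unif (N := N)) => n T Nn Tj.
by apply: (koszul_mem n iJ Tj) => S Sj; apply: hN.
Qed.

Lemma shift_diff g n T : shift (diff g) n T = koszul n.+1 (shift g n) T.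
Proof.
rewrite /shift /diff.
have -> : xS T * koszul n (g n) T = koszul n.+1 (fun S => xS S * g n S) T.
  rewrite -[xS T]expr1 -koszul_lift addn1; congr (koszul _ _ T).
have -> : (fun S => g n.+1 S - xS S * g n S) = (fun S => g n.+1 S + (-1) * (xS S * g n S)).
  by apply/funext => S; rewrite mulN1r.
by rewrite koszulD koszulZ mulN1r.
Qed.

Lemma diff_good j J g : ideal J -> compat_germ j J g -> compat_germ j.+1 J (diff g).
Proof.
move=> iJ /nul_unif[N hN]; apply: (nul_of_unif (N := N)) => n T Nn Tj.
by rewrite shift_diff; apply: (koszul_mem _ iJ Tj) => S Sj; apply: hN.
Qed.

Lemma nul_good j J g : ideal J -> null_germ j J g -> compat_germ j J g.
Proof.
move=> iJ /nul_unif[N hN]; apply: (nul_of_unif (N := N)) => n S Nn Sj.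
by apply: idealB => //; [|apply: idealM => //]; apply: hN; rewrite // ltnW.
Qed.

Lemma lift_good j J N e : ideal J -> compat_germ j J (lift N e).
Proof.
move=> iJ; apply: (nul_of_unif (N := N)) => n S Nn Sj.
by rewrite /shift /lift subSn // exprS mulrA subrr; apply: ideal0.
Qed.

Lemma good_lift j J g : ideal J -> compat_germ j J g ->
  exists N0, forall N, (N0 <= N)%N -> null_germ j J (g - lift N (g N)).
Proof.
move=> iJ /nul_unif[N0 hN]; exists N0 => N h.
apply: (nul_of_unif (N := N)) => n S /subnK <- Sj; rewrite germD germN /lift addnK.
elim: (n - N)%N => [|k IH]; first by rewrite expr0 mul1r subrr; apply: ideal0.
have h1 : J (shift g (k + N)%N S) by apply: hN => //; apply: leq_trans h (leq_addl _ _).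
have -> : g (k.+1 + N)%N S - xS S ^+ k.+1 * g N S =
   shift g (k + N)%N S + xS S * (g (k + N)%N S - xS S ^+ k * g N S).
  by rewrite /shift addSn exprS; ring.
by apply: idealD => //; apply: idealM.
Qed.

Lemma diff_lift N e n T : (N <= n)%N -> diff (lift N e) n T = lift N (koszul N e) n T.
Proof. by move=> /subnKC Nn; rewrite /diff /lift -koszul_lift Nn. Qed.

Definition sat J (r : R) := exists k, forall x, x \in xs -> J (x ^+ k * r).

(** A nonempty [S] inverts some generator of [m], and a power of that generator carries an element
    of [sat J] into [J]. *)
Lemma nul_sat j J g : ideal J -> compat_germ j.+1 J g -> null_germ j.+1 (sat J) g -> null_germ j.+1 J g.
Proof.
move=> iJ gg h.
have [N0 hN0] := good_lift iJ gg.
move=> S Sj; have [N1 hN1] := h S Sj.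
pose N := maxn N0 N1.
have [k hk] := hN1 N (leq_maxr _ _).
have [l iS] : exists l : I, l \in S by apply/card_gt0P; rewrite Sj.
have [M hM] := hN0 N (leq_maxl _ _) S Sj.
exists (maxn M (N + k)) => n; rewrite geq_max => /andP[Mn kn].
have := hM n Mn; rewrite germD germN => h1.
rewrite -(subrK (lift N (g N) n S) (g n S)); apply: idealD => //.
rewrite /lift; have -> : (n - N = k + (n - N - k))%N.
  by rewrite subnKC // leq_subRL ?(leq_trans (leq_addr k N)).
rewrite exprD mulrAC mulrC; apply: idealM => //.
rewrite (xS_D1 iS) exprMn mulrAC mulrC; apply: idealM => //; apply: hk.
exact: mem_nth.
Qed.

Definition exact_boundary j J g := if j is i.+1 then exists b, compat_germ i J b /\ g = diff b else g = 0.
Definition cech_cocycle j J g := compat_germ j J g /\ null_germ j.+1 J (diff g).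
Definition cech_boundary j J g := exists h, exact_boundary j J h /\ null_germ j J (g - h).

Lemma bd_good j J g : ideal J -> exact_boundary j J g -> compat_germ j J g.
Proof.
move=> iJ; case: j => [->|j [b [gb ->]]]; first exact: (submod0 (submod_good _ iJ)).
exact: diff_good.
Qed.

Lemma bd_diff j J g : exact_boundary j J g -> diff g = 0.
Proof. by case: j => [->|j [b [gb ->]]]; rewrite ?diff0 ?diff_diff. Qed.

Lemma submod_bd j J : ideal J -> submod (exact_boundary j J).
Proof.
move=> iJ; case: j => [|j].
  by split=> //; split=> [g h -> ->|r g ->]; rewrite ?addr0 ?scaler0.
have sg := submod_good j iJ; split; first by exists 0; rewrite diff0; split=> //; exact: (submod0 sg).
split=> [g h [b [gb ->]] [b' [gb' ->]]|r g [b [gb ->]]].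
  by exists (b + b'); rewrite diffD; split=> //; exact: (submodD sg gb gb').
by exists (r *: b); rewrite diffZ; split=> //; exact: (submodZ r sg gb).
Qed.

Lemma bd_sub j J J' g : (forall r, J r -> J' r) -> exact_boundary j J g -> exact_boundary j J' g.
Proof. by move=> JJ'; case: j => // j [b [gb ->]]; exists b; split=> //; apply: nul_sub gb. Qed.

(** Replacing [b] by the germ of its [N]-th numerator makes it compatible modulo every ideal, at the
    cost of a germ null modulo [J']. *)
Lemma bd_strict j J J' g : ideal J -> ideal J' -> exact_boundary j J' g ->
  exists g', exact_boundary j J g' /\ null_germ j J' (g - g').
Proof.
move=> iJ iJ'; case: j => [->|j [b [gb ->]]].
  by exists 0; rewrite subrr; split=> //; apply: (submod0 (submod_nul _ iJ')).
have [N hN] := good_lift iJ' gb.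
exists (diff (lift N (b N))); split; first by exists (lift N (b N)); split=> //; apply: lift_good.
by rewrite -diffB; apply: diff_nul => //; apply: hN.
Qed.

Lemma submod_coc j J : ideal J -> submod (cech_cocycle j J).
Proof.
move=> iJ; have sg := submod_good j iJ; have sn := submod_nul j.+1 iJ.
split; first by rewrite /cech_cocycle diff0; split; [exact: (submod0 sg)|exact: (submod0 sn)].
split=> [g h [g1 g2] [h1 h2]|r g [g1 g2]].
  by rewrite /cech_cocycle diffD; split; [exact: (submodD sg g1 h1)|exact: (submodD sn g2 h2)].
by rewrite /cech_cocycle diffZ; split; [exact: (submodZ r sg g1)|exact: (submodZ r sn g2)].
Qed.

Lemma submod_cob j J : ideal J -> submod (cech_boundary j J).
Proof.
move=> iJ; have sb := submod_bd j iJ; have sn := submod_nul j iJ.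
split; first by exists 0; rewrite subrr; split; [exact: (submod0 sb)|exact: (submod0 sn)].
split=> [g h [b [h1 h2]] [b' [h1' h2']]|r g [b [h1 h2]]].
  exists (b + b'); rewrite opprD addrACA.
  by split; [exact: (submodD sb h1 h1')|exact: (submodD sn h2 h2')].
by exists (r *: b); rewrite -scalerBr; split; [exact: (submodZ r sb h1)|exact: (submodZ r sn h2)].
Qed.

Lemma nul_cob j J g : ideal J -> null_germ j J g -> cech_boundary j J g.
Proof. by move=> iJ h; exists 0; rewrite subr0; split=> //; apply: (submod0 (submod_bd _ iJ)). Qed.

Lemma cob_coc j J g : ideal J -> cech_boundary j J g -> cech_cocycle j J g.
Proof.
move=> iJ [h [bh nh]]; rewrite -(subrK h g); apply: (submodD (submod_coc j iJ)).
  by split; [apply: nul_good|apply: diff_nul].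
split; first exact: bd_good bh.
by rewrite (bd_diff bh); apply: (submod0 (submod_nul _ iJ)).
Qed.

Lemma cob_sub j J J' g : (forall r, J r -> J' r) -> cech_boundary j J g -> cech_boundary j J' g.
Proof.
by move=> h [b [h1 h2]]; exists b; split; [apply: bd_sub h _|apply: nul_sub h _].
Qed.

(** The homotopy writes [x ^ N g] as a boundary plus the contraction of [diff g]. [N] is large
    enough for the latter to be null and for [g] to be determined by its [N]-th numerator. *)
Lemma coc_torsion j J g : ideal J -> cech_cocycle j J g -> torsion xs (cech_boundary j J) g.
Proof.
move=> iJ [gg dg]; have [N0 hN0] := good_lift iJ gg; have [N1 hN1] := nul_unif dg.
pose N := maxn N0 N1; exists N => x xin.
have [k xE] : exists k : I, xs`_k = x.
  have kx : (index x xs < size xs)%N by rewrite index_mem.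
  by exists (Ordinal kx); rewrite /= nth_index.
have nl := submodZ (x ^+ N) (submod_nul j iJ) (hN0 N (leq_maxl _ _)).
rewrite -(subrK (x ^+ N *: lift N (g N)) (x ^+ N *: g)) -scalerBr.
have sc := submod_cob j iJ; apply: submodD => //; first exact: nul_cob.
have hc : null_germ j J (lift N (contract k (koszul N (g N)))).
  apply: (nul_of_unif (N := N)) => n S _ Sj; apply: idealM => //.
  rewrite /contract; case: ifP => [_|/negbT kS]; first exact: ideal0.
  apply: idealM => //; apply: (hN1 N (k |: S)); first exact: leq_maxr.
  by rewrite cardsU1 kS Sj.
have E : x ^+ N *: lift N (g N) =
  lift N (koszul N (contract k (g N))) + lift N (contract k (koszul N (g N))).
  apply: germP => n S; rewrite germZ germD /lift -mulrDr homotopy xE; ring.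
rewrite E; apply: submodD => //; last exact: nul_cob.
case: j {hN0 gg dg hN1 nl sc hc E} N => [|j] N.
  apply: nul_cob => //; apply: (nul_of_unif (N := N)) => n S _ /cards0_eq ->.
  by rewrite /lift /koszul big_set0 mulr0; apply: ideal0.
exists (diff (lift N (contract k (g N)))); split.
  by exists (lift N (contract k (g N))); split=> //; apply: lift_good.
apply: (nul_of_unif (N := N)) => n S Nn _; rewrite germD germN diff_lift // subrr.
exact: ideal0.
Qed.

End Cech.

(** * Connecting homomorphisms and Frobenius *)

Section Connecting.
Variables (R : comNzRingType) (xs : seq R).
Local Notation germ := (germ xs).
Implicit Types (g h b c w u : germ) (J : R -> Prop) (i j n N : nat).

Definition addp J (x r : R) := exists a s, J a /\ r = a + s * x.

Lemma ideal_addp J x : ideal J -> ideal (addp J x).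
Proof.
move=> iJ; split; first by exists 0, 0; rewrite mul0r addr0; split=> //; apply: ideal0.
split=> [r s [a [c [Ja ->]]] [a' [c' [Ja' ->]]]|r s [a [c [Ja ->]]]].
  by exists (a + a'), (c + c'); rewrite mulrDl addrACA; split=> //; apply: idealD.
exists (r * a), (r * c); split; first exact: idealM.
by rewrite -[r *: _]/(r * _) mulrDr mulrA.
Qed.

Lemma incl_addp J x r : J r -> addp J x r.
Proof. by move=> Jr; exists r, 0; rewrite mul0r addr0. Qed.

Lemma mem_addp J x r : ideal J -> addp J x (x * r).
Proof. by move=> iJ; exists 0, r; rewrite add0r mulrC; split=> //; apply: ideal0. Qed.

Section Sequence.
Variables (J : R -> Prop) (x : R).
Hypotheses (iJ : ideal J) (Jx : forall r, J (x * r) -> sat xs J r).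
Local Notation J' := (addp J x).
Let iJ' : ideal J' := ideal_addp x iJ.
Let JJ' : forall r, J r -> J' r := @incl_addp J x.

(** In positive degree a generator of [m] is inverted, so the torsion that filter regularity leaves
    in the kernel of [x] disappears. *)
Lemma nul_div j g : compat_germ j.+1 J g -> null_germ j.+1 J (x *: g) -> null_germ j.+1 J g.
Proof.
move=> gg h; apply: nul_sat => // S Sj; have [N hN] := h S Sj.
by exists N => n /hN; rewrite germZ => /Jx.
Qed.

Lemma nul_split j g : compat_germ j J g -> null_germ j J' g ->
  exists w, compat_germ j J w /\ null_germ j J (g - x *: w).
Proof.
move=> gg h; have [N0 hN0] := good_lift iJ gg; have [N1 hN1] := nul_unif h.
pose N := maxn N0 N1.
have ex (S : {set 'I_(size xs)}) : exists a, #|S| = j -> J (g N S - x * a).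
  have [Sj|nS] := pselect (#|S| = j); last by exists 0.
  have [a [c [Ja ->]]] := hN1 N S (leq_maxr _ _) Sj.
  by exists c => _; rewrite [x * c]mulrC addrK.
have [a ha] := choice ex.
exists (lift N a); split; first exact: lift_good.
have sn := @submod_nul R xs j J iJ.
rewrite -(subrKA (lift N (g N))); apply: (submodD sn); first by apply: hN0; apply: leq_maxl.
apply: (nul_of_unif (N := N)) => n S Nn Sj; rewrite germD germN germZ /lift.
rewrite mulrCA -mulrBr; apply: idealM => //; exact: ha.
Qed.

(** The connecting map for multiplication by [x] on [R / J], which is injective on cochains of
    positive degree. It is a relation because it involves a lift [c'] and a division by [x];
    [delta_uniq] removes the ambiguity. *)
Definition delta j c w := exists c', [/\ compat_germ j J c', cech_boundary j J' (c - c'),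
  null_germ j.+1 J (diff c' - x *: w) & compat_germ j.+1 J w].

Lemma delta_cocr j c w : delta j c w -> cech_cocycle j.+1 J w.
Proof.
move=> [c' [gc' _ hn gw]]; split=> //; apply: nul_div; first exact: diff_good.
have := diff_nul iJ hn; rewrite diffB diff_diff sub0r diffZ.
by move=> /(submodN (submod_nul _ _ iJ)); rewrite opprK.
Qed.

Lemma nul_x j g : null_germ j J' (x *: g).
Proof. by move=> S _; exists 0%N => n _; rewrite germZ; apply: mem_addp. Qed.

Lemma delta_cocl j c w : delta j c w -> cech_cocycle j J' c.
Proof.
move=> [c' [gc' hc hn gw]]; rewrite -(subrK c' c); apply: (submodD (submod_coc _ _ iJ')).
  exact: cob_coc.
split; first exact: nul_sub gc'.
rewrite -(subrK (x *: w) (diff c')); apply: (submodD (submod_nul _ _ iJ')); last exact: nul_x.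
exact: nul_sub hn.
Qed.

Lemma delta_total j c : cech_cocycle j J' c -> exists w, delta j c w.
Proof.
move=> [gc dc]; have [N0 hN0] := good_lift iJ' gc; have hN := hN0 N0 (leqnn _).
pose c' := lift N0 (c N0); have gc' : compat_germ j J c' by apply: lift_good.
have dc' : null_germ j.+1 J' (diff c').
  have := submodB (submod_nul _ _ iJ') dc (diff_nul iJ' hN).
  by rewrite diffB opprB addrC subrK.
have [w [gw hw]] := nul_split (diff_good iJ gc') dc'.
by exists w, c'; split=> //; apply: nul_cob.
Qed.

Lemma deltaD j c w c2 w2 : delta j c w -> delta j c2 w2 -> delta j (c + c2) (w + w2).
Proof.
move=> [c' [h1 h2 h3 h4]] [c2' [h1' h2' h3' h4']]; exists (c' + c2'); split.
- exact: (submodD (submod_good _ _ iJ) h1 h1').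
- by rewrite opprD addrACA; exact: (submodD (submod_cob _ _ iJ') h2 h2').
- by rewrite diffD scalerDr opprD addrACA; exact: (submodD (submod_nul _ _ iJ) h3 h3').
- exact: (submodD (submod_good _ _ iJ) h4 h4').
Qed.

Lemma deltaZ j r c w : delta j c w -> delta j (r *: c) (r *: w).
Proof.
move=> [c' [h1 h2 h3 h4]]; exists (r *: c'); split.
- exact: (submodZ r (submod_good _ _ iJ) h1).
- by rewrite -scalerBr; exact: (submodZ r (submod_cob _ _ iJ') h2).
- rewrite diffZ scalerA mulrC -scalerA -scalerBr; exact: (submodZ r (submod_nul _ _ iJ) h3).
- exact: (submodZ r (submod_good _ _ iJ) h4).
Qed.

Lemma deltaB j c w c2 w2 : delta j c w -> delta j c2 w2 -> delta j (c - c2) (w - w2).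
Proof.
by move=> h1 h2; rewrite -[- c2]scaleN1r -[- w2]scaleN1r; apply: deltaD => //; apply: deltaZ.
Qed.

(** If [w] is the boundary of [b], subtracting [x b] from the lift makes it a cocycle over [J]
    without changing its class modulo [x]. *)
Lemma delta_ker j c w : delta j c w -> cech_boundary j.+1 J w ->
  exists u, cech_cocycle j J u /\ cech_boundary j J' (c - u).
Proof.
move=> [c' [h1 h2 h3 h4]] [h [[b [gb ->]] nw]]; exists (c' - x *: b); split.
  split; first by apply: (submodB (submod_good _ _ iJ)) => //; apply: (submodZ x (submod_good _ _ iJ)).
  rewrite diffB diffZ -(subrKA (x *: w)) -scalerBr.
  exact: (submodD (submod_nul _ _ iJ) h3 (submodZ x (submod_nul _ _ iJ) nw)).
rewrite opprB addrCA addrC; apply: (submodD (submod_cob _ _ iJ')) => //.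
by apply: nul_cob => //; apply: nul_x.
Qed.

Lemma delta_cob j c w : delta j c w -> cech_boundary j J' c -> cech_boundary j.+1 J w.
Proof.
move=> [c' [h1 h2 h3 h4]] hc.
have : cech_boundary j J' c' by have := submodB (submod_cob _ _ iJ') hc h2; rewrite opprB addrC subrK.
move=> [h [bh nh]]; have [h' [bh' nh']] := bd_strict iJ iJ' bh.
have n1 : null_germ j J' (c' - h').
  by rewrite -(subrKA h); exact: (submodD (submod_nul _ _ iJ') nh nh').
have g1 : compat_germ j J (c' - h').
  by apply: (submodB (submod_good _ _ iJ)) => //; apply: bd_good bh'.
have [b [gb nb]] := nul_split g1 n1.
exists (diff b); split; first by exists b.
apply: nul_div; first by apply: (submodB (submod_good _ _ iJ)) => //; apply: diff_good.
have := submodB (submod_nul _ _ iJ) (diff_nul iJ nb) h3.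
by rewrite !diffB (bd_diff bh') subr0 diffZ opprB addrC addrA subrK scalerBr.
Qed.

Lemma delta_uniq j c w w' : delta j c w -> delta j c w' -> cech_boundary j.+1 J (w - w').
Proof.
move=> h h'; apply: (delta_cob (deltaB h h')); rewrite subrr.
exact: (submod0 (submod_cob _ _ iJ')).
Qed.

Lemma delta_im j w : cech_cocycle j.+1 J w -> cech_boundary j.+1 J (x *: w) -> exists c, delta j c w.
Proof.
move=> [gw dw] [h [[b [gb ->]] nb]]; exists b, b; split=> //.
  by rewrite subrr; exact: (submod0 (submod_cob _ _ iJ')).
by have := submodN (submod_nul _ _ iJ) nb; rewrite opprB.
Qed.

Lemma coc_ker j u : cech_cocycle j J u -> cech_boundary j J' u ->
  exists w, cech_cocycle j J w /\ cech_boundary j J (u - x *: w).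
Proof.
move=> [gu du] [h [bh nh]]; have [h' [bh' nh']] := bd_strict iJ iJ' bh.
have n1 : null_germ j J' (u - h').
  by rewrite -(subrKA h); exact: (submodD (submod_nul _ _ iJ') nh nh').
have g1 : compat_germ j J (u - h').
  by apply: (submodB (submod_good _ _ iJ)) => //; apply: bd_good bh'.
have [w [gw nw]] := nul_split g1 n1.
exists w; split; last first.
  exists h'; split=> //; by rewrite addrAC.
split=> //; apply: nul_div; first exact: diff_good.
have := submodB (submod_nul _ _ iJ) du (diff_nul iJ nw).
by rewrite !diffB (bd_diff bh') subr0 diffZ subKr.
Qed.

Lemma cob_x j c : cech_boundary j J' (x *: c).
Proof. by apply: nul_cob => //; apply: nul_x. Qed.

End Sequence.

(** * Frobenius on germs *)

Section Frobenius.
Variable p : nat.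
Hypothesis charp : p \in [pchar R].

(** The [p]-th power of a fraction with denominator exponent [n %/ p] has exponent [n - n %% p]; the
    last factor brings it to [n]. *)
Definition frob g : germ := fun n S => g (n %/ p)%N S ^+ p * xS S ^+ (n %% p)%N.

Lemma exprp_morph (a b : R) : (a + b) ^+ p = a ^+ p + b ^+ p.
Proof. by have := pFrobenius_autD_comm charp (mulrC a b); rewrite !pFrobenius_autE. Qed.

Lemma exprpB (a b : R) : (a - b) ^+ p = a ^+ p - b ^+ p.
Proof. by have := pFrobenius_autB_comm charp (mulrC a b); rewrite !pFrobenius_autE. Qed.

Lemma p_gt0 : (0 < p)%N. Proof. exact: prime_gt0 (pcharf_prime charp). Qed.

Lemma frobD g h : frob (g + h) = frob g + frob h.
Proof. by apply: germP => n S; rewrite germD /frob germD exprp_morph mulrDl. Qed.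

Lemma frobZ r g : frob (r *: g) = r ^+ p *: frob g.
Proof. by apply: germP => n S; rewrite germZ /frob germZ exprMn mulrA. Qed.

Lemma sgn_p k (T : {set 'I_(size xs)}) : sgn k T ^+ p = sgn k T :> R.
Proof.
rewrite /sgn exprAC; congr (_ ^+ _).
by rewrite -[-1]sub0r exprpB expr1n expr0n gtn_eqF ?p_gt0.
Qed.

Lemma frob_diff g : frob (diff g) = diff (frob g).
Proof.
apply: germP => n T; rewrite /frob /diff /koszul.
rewrite (big_morph (fun a : R => a ^+ p) exprp_morph (_ : 0 ^+ p = 0)); last first.
  by rewrite expr0n gtn_eqF ?p_gt0.
rewrite mulr_suml; apply: eq_bigr => k kT; rewrite !exprMn sgn_p (xS_D1 kT).
have -> : xs`_k ^+ n = (xs`_k ^+ (n %/ p)%N) ^+ p * xs`_k ^+ (n %% p)%N.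
  by rewrite -exprM -exprD -divn_eq.
rewrite exprMn; ring.
Qed.

Variables (J Jp : R -> Prop).
Hypotheses (iJ : ideal J) (iJp : ideal Jp) (JJp : forall r, J r -> Jp (r ^+ p)).

Lemma frob_nul j g : null_germ j J g -> null_germ j Jp (frob g).
Proof.
move=> /nul_unif[N hN]; apply: (nul_of_unif (N := (N * p)%N)) => n S Nn Sj.
rewrite /frob mulrC; apply: idealM => //; apply/JJp/hN => //.
by rewrite leq_divRL // p_gt0.
Qed.

Lemma frob_good j g : compat_germ j J g -> compat_germ j Jp (frob g).
Proof.
move=> /nul_unif[N hN]; apply: (nul_of_unif (N := (N * p)%N)) => n S Nn Sj.
rewrite /shift /frob; have p0 := p_gt0.
have Nd : (N <= n %/ p)%N by rewrite leq_divRL.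
have [E|E] := eqVneq (n %% p).+1%N p; last first.
  have lt : ((n %% p).+1 < p)%N by rewrite ltn_neqAle E ltn_mod.
  have e : n.+1 = (n %/ p * p + (n %% p).+1)%N. by rewrite addnS -divn_eq.
  have -> : (n.+1 %/ p = n %/ p)%N by rewrite e divnMDl // (divn_small lt) addn0.
  have -> : (n.+1 %% p = (n %% p).+1)%N by rewrite e modnMDl modn_small.
  rewrite (_ : _ - _ = 0); first exact: ideal0.
  by rewrite exprS; ring.
have e : n.+1 = ((n %/ p).+1 * p)%N by rewrite mulSn addnC -{3}E addnS -divn_eq.
have -> : (n.+1 %/ p = (n %/ p).+1)%N by rewrite e mulnK.
have -> : (n.+1 %% p = 0)%N by rewrite e modnMl.
rewrite (_ : _ - _ = shift g (n %/ p)%N S ^+ p); first by apply: JJp; apply: hN.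
by rewrite /shift exprpB expr0 mulr1 mulrCA -exprS E exprMn mulrC.
Qed.

Lemma frob_bd j g : exact_boundary j J g -> exact_boundary j Jp (frob g).
Proof.
case: j => [->|j [b [gb ->]]]; last by exists (frob b); rewrite frob_diff; split=> //; apply: frob_good.
by rewrite /exact_boundary -[0](scale0r 0) frobZ expr0n gtn_eqF ?p_gt0 // !scale0r.
Qed.

Lemma frobB g h : frob (g - h) = frob g - frob h.
Proof. by apply: germP => n S; rewrite germD germN /frob germD germN exprpB mulrBl. Qed.

Lemma frob_coc j g : cech_cocycle j J g -> cech_cocycle j Jp (frob g).
Proof.
by move=> [gg dg]; split; [apply: frob_good|rewrite -frob_diff; apply: frob_nul].
Qed.

Lemma frob_cob j g : cech_boundary j J g -> cech_boundary j Jp (frob g).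
Proof.
move=> [h [bh nh]]; exists (frob h); split; first exact: frob_bd.
by rewrite -frobB; apply: frob_nul.
Qed.

End Frobenius.

Lemma addp_frob p (charp : p \in [pchar R]) J Jp x : (forall r, J r -> Jp (r ^+ p)) ->
  forall r, addp J x r -> addp Jp (x ^+ p) (r ^+ p).
Proof.
move=> h r [a [c [Ja ->]]]; exists (a ^+ p), (c ^+ p); split; first exact: h.
by rewrite (exprp_morph charp) exprMn.
Qed.

(** Frobenius turns [d c' = x w] into [d F(c') = x ^ p F(w)], so the connecting map of [x] becomes
    that of [x ^ p]. *)
Lemma frob_delta p (charp : p \in [pchar R]) J Jp x j c w : ideal J -> ideal Jp ->
  (forall r, J r -> Jp (r ^+ p)) ->
  delta J x j c w -> delta Jp (x ^+ p) j (frob p c) (frob p w).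
Proof.
move=> iJ iJp h [c' [h1 h2 h3 h4]]; exists (frob p c'); split.
- exact: frob_good h1.
- rewrite -frobB //; apply: (frob_cob charp _ (addp_frob charp h)) h2.
  exact: ideal_addp.
- by rewrite -(frob_diff charp) -frobZ -frobB //; apply: frob_nul h3.
- exact: frob_good h4.
Qed.

End Connecting.

(** * Filter regular elements *)

Section Avoidance.
Variables (R : comNzRingType) (m : R -> Prop) (xs : seq R).
Hypotheses (hloc : is_local_max m) (hxs : same_set m (ideal_of_seq xs)).
Hypothesis noeth : noetherian R.
Implicit Types (J K P Q : R -> Prop).

Lemma ideal_colon J a : ideal J -> ideal (colon J a).
Proof.
move=> iJ; split; first by rewrite /colon mul0r; apply: ideal0.
split=> [r s hr hs|r s hs]; first by rewrite /colon mulrDl; apply: idealD.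
by rewrite /colon -[r *: s]/(r * s) -mulrA; apply: idealM.
Qed.

Lemma sat_incl J r : ideal J -> J r -> sat xs J r.
Proof. by move=> iJ Jr; exists 0%N => x _; apply: idealM. Qed.

Lemma sat_le J r k n : ideal J -> (k <= n)%N -> (forall x, x \in xs -> J (x ^+ k * r)) ->
  forall x, x \in xs -> J (x ^+ n * r).
Proof.
move=> iJ kn h x /h hx; rewrite -(subnK kn) exprD -mulrA; exact: idealM.
Qed.

Lemma ideal_sat J : ideal J -> ideal (sat xs J).
Proof.
move=> iJ; split; first by apply: sat_incl => //; apply: ideal0.
split=> [r s [k hk] [n hn]|r s [k hk]].
  exists (maxn k n) => x xin; rewrite mulrDr; apply: idealD => //.
    by apply: (sat_le iJ (leq_maxl k n) hk).
  by apply: (sat_le iJ (leq_maxr k n) hn).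
by exists k => x /hk h; rewrite -[r *: s]/(r * s) mulrCA; apply: idealM.
Qed.

Lemma bound_list (T : eqType) (l : seq T) (A : T -> nat -> Prop) :
  (forall x n k, (n <= k)%N -> A x n -> A x k) ->
  (forall x, x \in l -> exists n, A x n) -> exists n, forall x, x \in l -> A x n.
Proof.
move=> mono; elim: l => [|x l IH] h; first by exists 0%N.
have [|n hn] := IH; first by move=> y yl; apply: h; rewrite in_cons yl orbT.
have [k hk] := h x (mem_head _ _).
exists (maxn n k) => y; rewrite in_cons => /orP[/eqP->|yl].
  exact: mono (leq_maxr _ _) hk.
exact: mono (leq_maxl _ _) (hn _ yl).
Qed.

Lemma sat_idem J r : ideal J -> sat xs (sat xs J) r -> sat xs J r.
Proof.
move=> iJ [k hk].
have [||n hn] := @bound_list _ xs (fun x n => J (x ^+ n * r)).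
- by move=> x n l nl; rewrite -(subnK nl) exprD -mulrA; apply: idealM.
- by move=> x xin; have [n /(_ x xin)] := hk x xin; exists (n + k)%N; rewrite exprD -mulrA.
by exists n.
Qed.

Lemma sat_not J a : ideal J -> ~ sat xs J a ->
  exists2 x, x \in xs & forall n, ~ sat xs J (x ^+ n * a).
Proof.
move=> iJ na; apply: contrapT => h; apply: na; apply: sat_idem => //.
have iS := ideal_sat iJ.
have [||n hn] := @bound_list _ xs (fun x n => sat xs J (x ^+ n * a)).
- by move=> x n l nl; rewrite -(subnK nl) exprD -mulrA; apply: idealM.
- by move=> x xin; apply: contrapT => /forallNP hx; apply: h; exists x.
by exists n.
Qed.

Lemma max_ideal : ideal m. Proof. by case: hloc => -[? []]. Qed.

Lemma prime_max P : is_prime P -> forall r, P r -> m r.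
Proof. by move=> [iP [P1 _]]; case: hloc => _ [_]; apply. Qed.

(* [a] is chosen with [(I : a)] maximal among the [a] outside the saturation. *)
Lemma ass_sat J r : ideal J -> ~ sat xs J r ->
  exists Q, [/\ ass J Q, ~ same_set Q m & forall s, J (s * r) -> Q s].
Proof.
move=> iJ nr; pose P Q := exists c, Q = colon J (c * r) /\ ~ sat xs J (c * r).
have [||Q [[c [QE nc]] Qmax]] := @noeth_max R noeth P (colon J r).
- by move=> _ [c [-> _]]; apply: ideal_colon.
- by exists 1; rewrite mul1r.
pose a := c * r; have qe : forall b, ~ sat xs J (b * a) -> colon J (b * a) = Q.
  move=> b nb; have h : incl (V := R^o) Q (colon J (b * a)).
    by move=> s; rewrite QE /colon => h; rewrite mulrCA; apply: idealM.
  apply: (predext (V := R^o)) => //; apply: Qmax => //.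
  by exists (b * c); rewrite -mulrA.
have [x xin hx] := sat_not iJ nc.
exists Q; split.
- split; last by exists a => s; rewrite QE.
  split; first by rewrite QE; apply: ideal_colon.
  split; first by rewrite QE /colon mul1r => h; apply: nc; apply: sat_incl.
  move=> u v; have [|Qu] := pselect (Q u); [by left|move=> Quv; right].
  have nu : ~ sat xs J (u * a).
    move=> [n hn]; apply: Qu; rewrite -(qe _ (hx n)) /colon.
    by rewrite mulrCA; apply: hn.
  by rewrite -(qe _ nu) /colon mulrA (mulrC v); move: Quv; rewrite QE.
- move=> h; apply: nc; exists 1%N => y /(mem_gen hxs)/h; rewrite QE /colon expr1; exact.
- by move=> s; rewrite QE /colon => h; rewrite mulrCA; apply: idealM.
Qed.

Lemma ass_exists J r : ideal J -> ~ J r ->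
  exists Q, [/\ ass J Q, (forall s, J (s * r) -> Q s) & exists c, same_set Q (colon J (c * r))].
Proof.
move=> iJ nr; pose P Q := exists c, Q = colon J (c * r) /\ ~ J (c * r).
have [||Q [[c [QE nc]] Qmax]] := @noeth_max R noeth P (colon J r).
- by move=> _ [c [-> _]]; apply: ideal_colon.
- by exists 1; rewrite mul1r.
pose a := c * r; have qe : forall b, ~ J (b * a) -> colon J (b * a) = Q.
  move=> b nb; have h : incl (V := R^o) Q (colon J (b * a)).
    by move=> s; rewrite QE /colon => h; rewrite mulrCA; apply: idealM.
  apply: (predext (V := R^o)) => //; apply: Qmax => //.
  by exists (b * c); rewrite -mulrA.
exists Q; split.
- split; last by exists a => s; rewrite QE.
  split; first by rewrite QE; apply: ideal_colon.
  split; first by rewrite QE /colon mul1r.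
  move=> u v; have [|Qu] := pselect (Q u); [by left|move=> Quv; right].
  have nu : ~ J (u * a) by move=> h; apply: Qu; rewrite QE.
  by rewrite -(qe _ nu) /colon mulrA (mulrC v); move: Quv; rewrite QE.
- by move=> s; rewrite QE /colon => h; rewrite mulrCA; apply: idealM.
- by exists c => s; rewrite QE.
Qed.

(** Noetherian induction, with [P0] the annihilator of [a] modulo [K]. If [Q] annihilates [b] and
    some nonzero multiple of [b] is a multiple of [a], then [Q = P0], since nonzero multiples keep a
    prime annihilator; otherwise [Q] is associated to [K + (a)]. *)
Lemma ass_finite J : ideal J -> exists Ps : seq (R -> Prop), forall Q, ass J Q -> Q \in Ps.
Proof.
move=> iJ; apply: contrapT => nJ.
pose P K := ideal K /\ ~ exists Ps : seq (R -> Prop), forall Q, ass K Q -> Q \in Ps.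
have [||K [[iK nK] Kmax]] := @noeth_max R noeth P J; [by move=> K []|by []|].
have [K1|nK1] := pselect (K 1).
  apply: nK; exists [::] => Q [[_ [Q1 _]] [a Qa]]; case: Q1; apply/Qa.
  by rewrite /colon mul1r -[a]mulr1; apply: idealM.
have [P0 [[pP _] _ [a0 Pa0]]] := ass_exists iK nK1.
set a := a0 * 1 in Pa0.
have nKa : ~ K a.
  by move=> Ka; case: pP => _ [+ _]; apply; apply/Pa0; rewrite /colon mul1r.
have iK' : ideal (addp K a) by apply: ideal_addp.
have [Ps hPs] : exists Ps : seq (R -> Prop), forall Q, ass (addp K a) Q -> Q \in Ps.
  apply: contrapT => nPs; apply: nKa; apply: (Kmax (addp K a)) => //.
    by move=> r; apply: incl_addp.
  by have := mem_addp a 1 iK; rewrite mulr1.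
apply: nK; exists (P0 :: Ps) => Q [pQ [b Qb]]; rewrite in_cons; apply/orP.
have [h|h] := pselect (exists r s, ~ K (r * b) /\ K (r * b - s * a)); last first.
  right; apply: hPs; split=> //; exists b => r; split.
    by move=> /Qb h1; exact: (@incl_addp _ K a _ h1).
  move=> [c [s [Kc E]]]; apply/Qb; apply: contrapT => nr; apply: h; exists r, s.
  by split=> //; rewrite E addrK.
left; apply/eqP; case: h => [r [s [nr hrs]]].
have annb t : Q t <-> K (t * (r * b)).
  split=> [/Qb h|h]; first by rewrite mulrCA; apply: idealM.
  case: pQ => _ [_ /(_ t r)]; case; first by apply/Qb; rewrite /colon -mulrA.
    by [].
  by move=> /Qb.
have ns : ~ K (s * a).
  by move=> h; apply: nr; rewrite -(subrK (s * a) (r * b)); apply: idealD.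
have anna t : P0 t <-> K (t * (s * a)).
  split=> [/Pa0 h|h]; first by rewrite mulrCA; apply: idealM.
  case: pP => _ [_ /(_ t s)]; case; first by apply/Pa0; rewrite /colon -mulrA.
    by [].
  by move=> /Pa0.
have E t : K (t * (r * b)) <-> K (t * (s * a)).
  have d : K (t * (r * b) - t * (s * a)) by rewrite -mulrBr; apply: idealM.
  split=> h; first by rewrite -[_ * _](subKr (t * (r * b))); apply: idealB.
  by rewrite -(subrK (t * (s * a)) (t * (r * b))); apply: idealD.
by apply: (predext (V := R^o)) => t; [move=> /annb/E/anna|move=> /anna/E/annb].
Qed.

(** A prime inside [Q] is avoided together with [Q] and can be removed. If there is none, an element
    of all the other primes outside [Q] corrects an element that avoids them but lies in [Q]. *)
Lemma avoid_list (Ps : seq (R -> Prop)) :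
  (forall P, P \in Ps -> is_prime P /\ ~ same_set P m) ->
  exists x, m x /\ forall P, P \in Ps -> ~ P x.
Proof.
have [n] := ubnP (size Ps); elim: n Ps => // n IH [|Q Ps] /= sz hPs.
  by exists 0; split=> //; apply: ideal0 max_ideal.
have hQ := hPs Q (mem_head _ _).
have hPs' P : P \in Ps -> is_prime P /\ ~ same_set P m.
  by move=> h; apply: hPs; rewrite in_cons h orbT.
have [[Q' [Q'in Q'Q]]|anti] := pselect (exists Q', Q' \in Ps /\ incl (V := R^o) Q' Q).
  have sz' : (size (Q :: rem Q' Ps) < n)%N.
    by rewrite /= size_rem // prednK; [rewrite ltnS in sz|case: (Ps) Q'in].
  have [|x [mx hx]] := IH _ sz'.
    by move=> P; rewrite in_cons => /orP[/eqP->//|/mem_rem/hPs'].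
  exists x; split=> // P; rewrite in_cons => /orP[/eqP->|Pin]; first by apply: hx; rewrite mem_head.
  have [->|PQ'] := eqVneq P Q'; first by move=> /Q'Q; apply: hx; rewrite mem_head.
  apply: hx; rewrite in_cons; apply/orP; right.
  by move: Pin; rewrite (perm_mem (perm_to_rem Q'in)) in_cons (negbTE PQ').
have [|x0 [mx0 hx0]] := IH Ps _ hPs'; first by rewrite -ltnS.
have [Qx0|nQx0] := pselect (Q x0); last first.
  by exists x0; split=> // P; rewrite in_cons => /orP[/eqP->|/hx0].
have [z [mz nQz]] : exists z, m z /\ ~ Q z.
  apply: contrapT => /forallNP h; apply: hQ.2 => r; split; first exact: prime_max hQ.1 r.
  by move=> mr; apply: contrapT => nQr; apply: (h r).
have [_ [_ pQ]] := hQ.1.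
have [y [my [nQy hy]]] : exists y, m y /\ ~ Q y /\ forall P, P \in Ps -> P y.
  elim: (Ps) anti hPs' => [|P Qs IHq] an hq; first by exists z.
  have [||y [my [nQy hy]]] := IHq.
  - by move=> [Q' [h1 h2]]; apply: an; exists Q'; rewrite in_cons h1 orbT.
  - by move=> P' h; apply: hq; rewrite in_cons h orbT.
  have [w [Pw nQw]] : exists w, P w /\ ~ Q w.
    apply: contrapT => /forallNP h; apply: an; exists P; rewrite mem_head; split=> // r Pr.
    by apply: contrapT => nQr; apply: (h r).
  exists (w * y); split; first by apply: idealM max_ideal _ => //; apply: my.
  split; first by move=> /pQ[].
  have iP P' : P' \in P :: Qs -> ideal P' by move=> /hq[[]].
  move=> P'; rewrite in_cons => /orP[/eqP->|h].
    by rewrite mulrC; apply: idealM (iP _ (mem_head _ _)) _.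
  by apply: idealM (iP _ _) (hy _ h); rewrite in_cons h orbT.
exists (x0 + y); split; first exact: idealD max_ideal mx0 my.
have iP P : P \in Q :: Ps -> ideal P by move=> /hPs[[]].
move=> P; rewrite in_cons => /orP[/eqP->|Pin] h.
  by apply: nQy; have := idealB (iP _ (mem_head _ _)) h Qx0; rewrite addrC addKr.
apply: (hx0 _ Pin); rewrite -(addrK y x0); apply: idealB => //; last exact: hy.
by apply: iP; rewrite in_cons Pin orbT.
Qed.

Lemma filter_regular_exists J : ideal J ->
  exists x, m x /\ forall r, J (x * r) -> sat xs J r.
Proof.
move=> iJ; have [Ps hPs] := ass_finite iJ.
pose good P := `[< is_prime P /\ ~ same_set P m >].
have [|x [mx hx]] := @avoid_list [seq P <- Ps | good P].
  by move=> P; rewrite mem_filter => /andP[/asboolP].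
exists x; split=> // r Jr; apply: contrapT => nr.
have [Q [aQ nQ hQ]] := ass_sat iJ nr.
apply: (hx Q); last exact: hQ.
by rewrite mem_filter hPs // andbT; apply/asboolP; case: aQ.
Qed.

End Avoidance.

(** * Artinianness of local cohomology *)

Section ArtinCohomology.
Variables (R : comNzRingType) (m : R -> Prop) (xs : seq R) (p : nat).
Hypotheses (hloc : is_local_max m) (hxs : same_set m (ideal_of_seq xs)).
Hypotheses (noeth : noetherian R) (charp : p \in [pchar R]).
Local Notation germ := (germ xs).
Implicit Types (g h c w u : germ) (J : R -> Prop) (i j n N : nat).

Lemma exprpeD e (a b : R) : (a + b) ^+ (p ^ e) = a ^+ (p ^ e) + b ^+ (p ^ e).
Proof. by elim: e => [|e IH]; rewrite ?expr1 // expnSr !exprM IH (exprp_morph charp). Qed.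

Lemma pe_gt e : (e < p ^ e)%N.
Proof. by apply: ltn_expl; apply: prime_gt1 (pcharf_prime charp). Qed.

(** Taking [p ^ e]-th powers is additive, so for an element of [m] only the [p ^ e]-th powers of the
    generators are involved. *)
Lemma max_pw a e : m a -> pw xs (p ^ e) (a ^+ (p ^ e)).
Proof.
move=> /hxs[n [c [g [hg ->]]]]; have iP := ideal_pw xs (p ^ e).
apply: (big_ind (fun r => pw xs (p ^ e) (r ^+ (p ^ e)))).
- by rewrite expr0n gtn_eqF ?(leq_ltn_trans _ (pe_gt e)) //; exact: (ideal0 iP).
- by move=> r s hr hs; rewrite exprpeD; exact: (idealD iP hr hs).
- by move=> i _; rewrite exprMn; exact: (idealM _ iP (pw_gen (hg i (ltn_ord i)))).
Qed.

Lemma max_kill (V : lmodType R) (B : V -> Prop) v a : submod B -> torsion xs B v -> m a ->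
  exists n, B (a ^+ n *: v).
Proof.
move=> sB [N hN] ma; exists (p ^ N)%N; apply: (pw_kill sB _ (@max_pw _ N ma)).
by apply: level_le hN => //; apply/ltnW/pe_gt.
Qed.

Lemma sat_kill J r a : ideal J -> sat xs J r -> m a -> exists n, J (a ^+ n * r).
Proof.
move=> iJ [N hN] ma.
by have := @max_kill R^o J r a iJ; apply=> //; exists N.
Qed.

(** Constant germs represent degree 0, where the only denominator is 1; they identify [H^0] of
    [R / J] with [sat J / J]. *)
Definition cst r : germ := fun _ _ => r.

Lemma cstZ r s : cst (r * s) = r *: cst s. Proof. by []. Qed.

Lemma nul_cst J r : null_germ 0 J (cst r) <-> J r.
Proof.
split=> [/(_ set0 (cards0 _))[N hN]|Jr S _]; first exact: hN (leqnn N).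
by exists 0%N.
Qed.

Lemma cob_cst J r : ideal J -> cech_boundary 0 J (cst r) <-> J r.
Proof.
move=> iJ; split=> [[h [-> ]]|Jr]; first by rewrite subr0 => /nul_cst.
by apply: nul_cob => //; apply/nul_cst.
Qed.

Lemma coc_cst J r : ideal J -> cech_cocycle 0 J (cst r) <-> sat xs J r.
Proof.
move=> iJ; split=> [[_ /nul_unif[N hN]]|[N hN]].
  exists N => x xin; have kx : (index x xs < size xs)%N by rewrite index_mem.
  have := hN N [set Ordinal kx] (leqnn N) (cards1 _).
  rewrite /diff /koszul big_set1 /= nth_index // /sgn.
  rewrite (_ : [set i in _ | _] = set0) ?cards0 ?expr0 ?mul1r; first by rewrite mulrC.
  by apply/setP => i; rewrite !inE; case: eqP => // ->; rewrite ltnn.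
split.
  apply: (nul_of_unif (N := 0%N)) => n S _ /cards0_eq ->.
  by rewrite /shift /xS big_set0 mul1r subrr; apply: ideal0.
apply: (nul_of_unif (N := N)) => n S Nn _; rewrite /diff /koszul.
apply: ideal_sum => // k _; rewrite mulrC mulrCA; apply: idealM => //.
by apply: sat_le Nn hN _ (mem_nth _ _).
Qed.

Lemma coc0_cst J g : ideal J -> cech_cocycle 0 J g -> exists2 r, sat xs J r & null_germ 0 J (g - cst r).
Proof.
move=> iJ cg; have [N hN] := good_lift iJ cg.1.
have hn : null_germ 0 J (g - cst (g N set0)).
  move=> S /cards0_eq ->; have [M hM] := hN N (leqnn N) set0 (cards0 _).
  by exists M => n /hM; rewrite !germD !germN /lift /xS big_set0 expr1n mul1r.
exists (g N set0) => //; apply/coc_cst => //.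
have := submodB (submod_coc _ _ iJ) cg (cob_coc iJ (nul_cob iJ hn)).
by rewrite opprB addrC subrK.
Qed.

Lemma artin_coc0 J : ideal J -> artin (cech_boundary (xs := xs) 0 J) (cech_cocycle 0 J).
Proof.
move=> iJ M sM BM MZ Mdec.
have iS := ideal_sat xs iJ.
have [k fk] : exists n, filtered xs (V := R^o) n J (sat xs J).
  by apply: (noeth_filtered noeth) => // r; apply: sat_incl.
have [n hn] : exists n, forall i, (n <= i)%N ->
    incl (V := R^o) (fun r => M n (cst r)) (fun r => M i (cst r)).
  apply: (filtered_artin hloc hxs iJ fk).
  - move=> i; split; first exact: (submod0 (sM i)).
    split=> [a b ha hb|r a ha]; first exact: (submodD (sM i) ha hb).
    exact: (submodZ r (sM i) ha).
  - by move=> i r Jr; apply: BM; apply/cob_cst.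
  - by move=> i r /MZ/coc_cst; apply.
  - by move=> i r; apply: Mdec.
exists n => i ni g Mg; have [r _ hr] := coc0_cst iJ (MZ _ _ Mg).
have Br : cech_boundary 0 J (g - cst r) by apply: nul_cob.
apply: (submod_subr (sM i) (BM _ _ Br)); apply: hn => //.
exact: (submod_subl (sM n) (BM _ _ Br)).
Qed.

(** By Kirby's criterion the part killed by a filter regular [x] suffices. It is the image of
    [H^j(R/(J, x))] under the connecting map, hence artinian by induction on the degree over all
    ideals. *)
Lemma artin_coc j J : ideal J -> artin (cech_boundary (xs := xs) j J) (cech_cocycle j J).
Proof.
elim: j J => [|j IH] J iJ; first exact: artin_coc0.
have [x [mx hx]] := filter_regular_exists hloc hxs noeth iJ.
have iJ' := ideal_addp x iJ.
have sB := submod_cob xs j.+1 iJ; have sZ := submod_coc xs j.+1 iJ.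
have BZ : incl (cech_boundary (xs := xs) j.+1 J) (cech_cocycle j.+1 J) by move=> u; apply: cob_coc.
apply: (kirby (x := x) sB sZ BZ).
  by move=> u /coc_torsion tu; apply: max_kill mx => //; apply: tu.
move=> M sM BM MZ Mdec.
pose M' i c := exists2 w, M i w & delta J x j c w.
have [n hn] : exists n, forall i, (n <= i)%N -> incl (M' n) (M' i).
  apply: (IH _ iJ').
  - move=> i; split.
      exists 0; first exact: (submod0 (sM i)).
      have [w dw] := delta_total iJ (submod0 (submod_coc xs j iJ')).
      by have := deltaB iJ dw dw; rewrite !subrr.
    split=> [c c' [w Mw dw] [w' Mw' dw']|r c [w Mw dw]].
      by exists (w + w'); [exact: (submodD (sM i) Mw Mw')|exact: deltaD].
    by exists (r *: w); [exact: (submodZ r (sM i) Mw)|exact: deltaZ].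
  - move=> i c hc; have [w dw] := delta_total iJ (cob_coc iJ' hc).
    by exists w => //; apply: BM; apply: (delta_cob iJ hx dw).
  - by move=> i c [w _ /(delta_cocl iJ)].
  - by move=> i c [w Mw dw]; exists w => //; apply: Mdec.
exists n => i ni w Mw; have [cw xw] := MZ _ _ Mw.
have [c dc] := delta_im iJ cw xw.
have [w' Mw' dw'] : M' i c by apply: hn => //; exists w.
have := BM i _ (delta_uniq iJ hx dc dw') => /(submod_subr (sM i)); exact.
Qed.

End ArtinCohomology.

(** * Filter regular sequences *)

Section FilterRegular.
Variables (R : comNzRingType) (m : R -> Prop) (xs : seq R).
Hypotheses (hloc : is_local_max m) (hxs : same_set m (ideal_of_seq xs)).
Hypotheses (noeth : noetherian R).
Implicit Types (J K P Q : R -> Prop) (l : seq R) (n : nat).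
Local Notation sat := (sat xs).

Lemma sat_mono J K r : (forall s, J s -> K s) -> sat J r -> sat K r.
Proof. by move=> h [k hk]; exists k => x /hk/h. Qed.

Lemma sat_of_mul J r k : ideal J -> (forall x, x \in xs -> sat J (x ^+ k * r)) -> sat J r.
Proof. by move=> iJ h; apply: sat_idem => //; exists k. Qed.

(** For [z] regular modulo [K], write [w = f n z ^ n]. Then [f n = z f n.+1] modulo [K], the chain
    [K + (f n)] stops, and [f n.+1 = s z f n.+1] forces [f n.+1] into [K] because [1 - s z] is a
    unit. In general [K] is the stable colon of [J] by powers of [z]. *)
Lemma krull_intersection J z b : ideal J -> m z -> (forall n, addp J (z ^+ n) b) -> J b.
Proof.
move=> iJ mz.
have unit c : exists r', r' * (1 - c * z) = 1.
  apply: (local_unit hloc) => h; case: hloc => im [m1 _]; apply: m1.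
  rewrite -(subrK (c * z) 1); apply: (idealD (max_ideal hloc)) => //.
  exact: (idealM _ (max_ideal hloc)).
have regular K w : ideal K -> (forall r, K (z * r) -> K r) ->
    (forall n, addp K (z ^+ n) w) -> K w.
  move=> iK reg hw.
  have ex n : exists s, K (w - s * z ^+ n).
    by have [a [s [Ka ->]]] := hw n; exists s; rewrite addrK.
  have [f hf] := choice ex.
  have regn k r : K (z ^+ k * r) -> K r.
    by elim: k r => [r|k IH r]; rewrite ?expr0 ?mul1r // exprS -mulrA => /reg/IH.
  have step n : K (f n - z * f n.+1).
    apply: (regn n); rewrite mulrBr mulrA -exprSr.
    have := idealB iK (hf n.+1) (hf n).
    by rewrite opprB addrCA addrAC subrr add0r addrC [f n * _]mulrC [f n.+1 * _]mulrC; rewrite addrC.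
  pose M n := addp K (f n).
  have [||n hn] := @noeth_chain R noeth M.
  - by move=> i; apply: ideal_addp.
  - move=> i r [a [s [Ka ->]]]; exists (a + s * (f i - z * f i.+1)), (s * z).
    split; first by apply: idealD => //; apply: idealM.
    ring.
  have [a [s [Ka fE]]] : M n (f n.+1).
    by apply: (hn n.+1); exists 0, 1; rewrite add0r mul1r; split=> //; apply: ideal0.
  have [r' hr'] := unit s.
  have Kf : K (f n.+1).
    rewrite -[f n.+1]mul1r -hr' -mulrA; apply: idealM => //.
    have -> : (1 - s * z) * f n.+1 = f n.+1 - s * f n + s * (f n - z * f n.+1) by ring.
    apply: idealD => //; last exact: idealM.
    by rewrite {1}fE addrK.
  by rewrite -(subrK (f n.+1 * z ^+ n.+1) w); apply: idealD => //; rewrite mulrC; apply: idealM.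
move=> hb; pose M n := colon J (z ^+ n).
have [||n0 hn0] := @noeth_chain R noeth M.
- by move=> i; apply: ideal_colon.
- by move=> i r; rewrite /M /colon exprS mulrCA => h; apply: idealM.
have [a [w [Ja bE]]] := hb n0.
rewrite bE; apply: idealD => //.
apply: (regular (M n0) w).
- exact: ideal_colon.
- by move=> r h; apply: (hn0 n0.+1); move: h; rewrite /M /colon exprS mulrA (mulrC z r).
move=> n; have [a' [w' [Ja' bE']]] := hb (n0 + n)%N.
exists (w - w' * z ^+ n), w'; split; last by rewrite subrK.
rewrite /M /colon mulrBl -mulrA -exprD addnC.
have -> : w * z ^+ n0 - w' * z ^+ (n0 + n) = a' - a.
  by apply/eqP; rewrite subr_eq addrAC -bE' bE addrC addKr.
exact: idealB.
Qed.

Definition gen J l := foldl (@addp R) J l.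
Definition zid (r : R) := r = 0.

Lemma ideal_zid : ideal zid.
Proof. by split=> //; split=> [a b -> ->|r a ->]; rewrite ?addr0 ?scaler0. Qed.

Lemma ideal_gen_seq J l : ideal J -> ideal (gen J l).
Proof. by elim: l J => //= x l IH J iJ; apply/IH/ideal_addp. Qed.

Lemma gen_rcons J l x : gen J (rcons l x) = addp (gen J l) x.
Proof. by rewrite /gen -cats1 foldl_cat. Qed.

Lemma gen_incl J l r : J r -> gen J l r.
Proof. by elim: l J => //= x l IH J Jr; apply: IH; apply: incl_addp. Qed.

Lemma gen_mem J l x : ideal J -> x \in l -> gen J l x.
Proof.
elim: l J => //= y l IH J iJ; rewrite in_cons => /orP[/eqP->|xl].
  by apply: gen_incl; have := mem_addp y 1 iJ; rewrite mulr1.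
by apply: IH => //; apply: ideal_addp.
Qed.

Lemma gen_min J l K r : ideal K -> (forall s, J s -> K s) -> (forall x, x \in l -> K x) ->
  gen J l r -> K r.
Proof.
move=> iK; elim: l J => [|x l IH] J JK h /=; first exact: JK.
apply: IH; last by move=> y yl; apply: h; rewrite in_cons yl orbT.
move=> s [a [c [Ja ->]]]; apply: idealD => //; first exact: JK.
by apply: idealM => //; apply: h; rewrite mem_head.
Qed.

Lemma ideal_ideal_gen (S : R -> Prop) : ideal (ideal_gen S).
Proof.
split; first by exists 0%N, (fun _ => 0), (fun _ => 0); rewrite big_ord0.
split=> [a b [n [c [g [hg ->]]]] [n' [c' [g' [hg' ->]]]]|r a [n [c [g [hg ->]]]]].
  exists (n + n')%N, (fun i => if (i < n)%N then c i else c' (i - n)%N),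
    (fun i => if (i < n)%N then g i else g' (i - n)%N); split.
    by move=> i hi; case: ifP => [/hg//|/negbT]; rewrite -leqNgt => ni; apply: hg'; rewrite ltn_subLR.
  rewrite big_split_ord /=; congr (_ + _); apply: eq_bigr => i _; first by rewrite ltn_ord.
  by rewrite ltnNge leq_addr /= addKn.
exists n, (fun i => r * c i), g; split=> //.
by rewrite -[r *: _]/(r * _) mulr_sumr; apply: eq_bigr => i _; rewrite mulrA.
Qed.

Lemma ideal_gen_mem (S : R -> Prop) x : S x -> ideal_gen S x.
Proof. by move=> Sx; exists 1%N, (fun _ => 1), (fun _ => x); rewrite big_ord1 mul1r. Qed.

Lemma ideal_gen_min (S K : R -> Prop) r : ideal K -> (forall x, S x -> K x) ->
  ideal_gen S r -> K r.
Proof.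
by move=> iK h [n [c [g [hg ->]]]]; apply: ideal_sum => // i _; apply: idealM => //; apply/h/hg.
Qed.

Lemma genE l : ideal_of_seq l = gen zid l.
Proof.
apply: (predext (V := R^o)) => r.
  apply: ideal_gen_min; first exact/ideal_gen_seq/ideal_zid.
  by move=> x; apply: gen_mem; apply: ideal_zid.
apply: gen_min; first exact: ideal_ideal_gen.
  by move=> s ->; apply: (ideal0 (ideal_ideal_gen _)).
by move=> x xl; apply: ideal_gen_mem.
Qed.

(** Filter regularity in colon form over a base ideal, recursive in the head, so that the connecting
    maps see only a change of base. *)
Fixpoint freg J l := if l is x :: l' then
  m x /\ (forall r, J (x * r) -> sat J r) /\ freg (addp J x) l' else True.

Lemma freg_cat J l l' : freg J (l ++ l') <-> freg J l /\ freg (gen J l) l'.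
Proof.
elim: l J => [|x l IH] J /=; first by split=> [|[]].
split=> [[h1 [h2 /IH[h3 h4]]]//|[[h1 [h2 h3]] h4]]; split=> //; split=> //.
by apply/IH.
Qed.

Lemma freg_rcons J l x : freg J (rcons l x) <->
  [/\ freg J l, m x & forall r, gen J l (x * r) -> sat (gen J l) r].
Proof. by rewrite -cats1 freg_cat /=; split=> [[? [? [? _]]]|[]]. Qed.

Lemma addpC J x y : addp (addp J x) y = addp (addp J y) x.
Proof.
apply: (predext (V := R^o)) => r [a [c [[b [d [Jb ->]]] ->]]].
  by exists (b + c * y), d; rewrite addrAC; split=> //; exists b, c.
by exists (b + c * x), d; rewrite addrAC; split=> //; exists b, c.
Qed.

(** From [x r = a + c w] follows [w c] in [J + (x)], so [y ^ k c = b + s x] and [x (y ^ k r - s w)]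
    lies in [J]. Cancelling [x] puts [y ^ k r] into the saturation of [J + (w)]. *)
Lemma regular_swap J x w : ideal J -> (forall r, J (x * r) -> sat J r) ->
  (forall r, addp J x (w * r) -> sat (addp J x) r) ->
  forall r, addp J w (x * r) -> sat (addp J w) r.
Proof.
move=> iJ hx hw r [a [c [Ja xr]]]; have iw := ideal_addp w iJ.
have [|k hk] := hw c.
  have -> : w * c = - a + r * x by rewrite mulrC -[r * x]mulrC mulrC xr; ring.
  by exists (- a), r; split=> //; rewrite -mulN1r; apply: idealM.
apply: (@sat_of_mul _ _ k) => // y yin; have [b [s [Jb yc]]] := hk y yin.
have : J (x * (y ^+ k * r - s * w)).
  have -> : x * (y ^+ k * r - s * w) = y ^+ k * a + w * b.
    have -> : x * (y ^+ k * r - s * w) = y ^+ k * (x * r) - x * (s * w) by ring.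
    have -> : x * (s * w) = (y ^+ k * c - b) * w by rewrite yc; ring.
    by rewrite xr; ring.
  by apply: idealD => //; apply: idealM.
move=> /hx h; rewrite -(subrK (s * w) (y ^+ k * r)).
apply: (idealD (ideal_sat _ iw)); first by apply: sat_mono h => t; apply: incl_addp.
by apply: sat_incl => //; rewrite mulrC; apply: mem_addp.
Qed.

(** Modulo [x] one has [y ^ k r = a + s x]. Cancelling one [x] from [w s x] leaves [w s] in
    [J + (x ^ n)] up to saturation, where the induction hypothesis applies; multiplying by [x]
    returns to [x ^ n.+1]. *)
Lemma regular_pow J x w n : ideal J -> (forall r, J (x * r) -> sat J r) ->
  (forall r, addp J x (w * r) -> sat (addp J x) r) ->
  forall r, addp J (x ^+ n) (w * r) -> sat (addp J (x ^+ n)) r.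
Proof.
move=> iJ hx hw; elim: n => [|n IH] r hr.
  by apply: sat_incl; [apply: ideal_addp|have := mem_addp 1 r iJ; rewrite mul1r].
have in1 := ideal_addp (x ^+ n.+1) iJ; have iS := ideal_sat xs in1.
have up t : addp J (x ^+ n) t -> addp J (x ^+ n.+1) (x * t).
  move=> [a [c [Ja ->]]]; exists (x * a), c; split; first exact: idealM.
  by rewrite exprS; ring.
have [k hk] : sat (addp J x) r.
  apply: hw; case: hr => a [c [Ja ->]]; exists a, (c * x ^+ n); split=> //.
  by rewrite exprSr mulrA.
apply: (@sat_of_mul _ _ k) => // y yin; have [a [s [Ja yr]]] := hk y yin.
rewrite yr; apply: (idealD iS); first by apply/sat_incl/incl_addp.
have [b [c [Jb wsx]]] : addp J (x ^+ n.+1) (w * (s * x)).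
  have -> : w * (s * x) = y ^+ k * (w * r) + (- w) * a.
    have -> : y ^+ k * (w * r) = w * (y ^+ k * r) by ring.
    by rewrite yr; ring.
  by apply: idealD => //; [exact: idealM|exact: (idealM _ in1 (incl_addp _ Ja))].
have [k' hk'] : sat J (w * s - c * x ^+ n).
  apply: hx; have -> : x * (w * s - c * x ^+ n) = w * (s * x) - c * x ^+ n.+1.
    by rewrite exprS; ring.
  by rewrite wsx addrK.
apply: (@sat_of_mul _ _ k') => // z zin.
have : addp J (x ^+ n) (w * (z ^+ k' * s)).
  exists (z ^+ k' * (w * s - c * x ^+ n)), (z ^+ k' * c); split; first exact: hk'.
  by ring.
move=> /IH[k2 hk2]; exists k2 => v vin.
have -> : v ^+ k2 * (z ^+ k' * (s * x)) = x * (v ^+ k2 * (z ^+ k' * s)) by ring.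
exact/up/hk2.
Qed.

Lemma freg_addp_pow J x n l : ideal J -> (forall r, J (x * r) -> sat J r) ->
  freg (addp J x) l -> freg (addp J (x ^+ n)) l.
Proof.
elim: l J => //= w l IH J iJ hx [mw [hw fl]]; split=> //; split.
  exact: regular_pow.
rewrite addpC; apply: IH; first exact: ideal_addp.
  exact: regular_swap.
by rewrite addpC.
Qed.

Lemma regular_exp J x n : ideal J -> (forall r, J (x * r) -> sat J r) ->
  forall r, J (x ^+ n * r) -> sat J r.
Proof.
move=> iJ hx; elim: n => [|n IH] r; first by rewrite expr0 mul1r; apply: sat_incl.
rewrite exprS -mulrA => /hx[k hk]; apply: (@sat_of_mul _ _ k) => // y yin.
by apply: IH; rewrite mulrCA; apply: hk.
Qed.

Lemma max_exp x n : (0 < n)%N -> m x -> m (x ^+ n).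
Proof. by case: n => // n _ mx; rewrite exprSr; apply: (idealM _ (max_ideal hloc)). Qed.

Lemma freg_pow J l n : (0 < n)%N -> ideal J -> freg J l -> freg J [seq x ^+ n | x <- l].
Proof.
move=> n0; elim: l J => //= x l IH J iJ [mx [hx fl]]; split; first exact: max_exp.
split; first exact: regular_exp.
by apply: IH; [apply: ideal_addp|apply: freg_addp_pow].
Qed.

Lemma freg_of_filter_regular l : filter_regular m l -> freg zid l.
Proof.
move=> [hm h]; have iz := ideal_zid.
suff H i : (i <= size l)%N -> freg zid (take i l) by rewrite -[l]take_size; apply: H.
elim: i => [|i IH] il; first by rewrite take0.
rewrite (take_nth 0) //; apply/freg_rcons; split; first by apply: IH; apply: ltnW.
  by apply: hm; rewrite genE; apply: gen_mem => //; apply: mem_nth.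
set I := gen _ _; have iI : ideal I by apply: ideal_gen_seq.
have E : ideal_gen (fun y => exists k, (k < i)%N /\ y = l`_k) = I.
  apply: (predext (V := R^o)) => r.
    apply: ideal_gen_min => // x [k [ki ->]]; apply: gen_mem => //.
    by rewrite -(nth_take 0 ki); apply: mem_nth; rewrite (size_takel (ltnW il)).
  apply: gen_min; first exact: ideal_ideal_gen.
    by move=> s ->; apply: (ideal0 (ideal_ideal_gen _)).
  move=> x /(nthP 0)[k]; rewrite (size_takel (ltnW il)) => ki <-.
  by apply: ideal_gen_mem; exists k; rewrite nth_take.
move=> r Ir; apply: contrapT => nr.
have [Q [aQ nQ hQ]] := ass_sat hxs noeth iI nr.
by have := h i il Q; rewrite E; apply=> //; apply: hQ.
Qed.

(** A maximal colon ideal [J : c] inside [P] is prime, because [J : w c] stays inside [P] for every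
    [w] outside [P]. *)
Lemma ass_below J P : ideal J -> is_prime P -> (forall r, J r -> P r) ->
  exists Q, ass J Q /\ forall r, Q r -> P r.
Proof.
move=> iJ [iP [P1 Pp]] JP.
pose A Q := exists c, Q = colon J c /\ forall r, colon J c r -> P r.
have [||Q [[c [QE hc]] Qmax]] := @noeth_max R noeth A J.
- by move=> _ [c [-> _]]; apply: ideal_colon.
- exists 1; split; last by move=> r; rewrite /colon mulr1; apply: JP.
  by apply: (predext (V := R^o)) => r; rewrite /colon mulr1.
have qe b : (forall r, colon J (b * c) r -> P r) -> colon J (b * c) = Q.
  move=> hb; have h : incl (V := R^o) Q (colon J (b * c)).
    by move=> s; rewrite QE /colon => h; rewrite mulrCA; apply: idealM.
  by apply: (predext (V := R^o)) => //; apply: Qmax => //; exists (b * c).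
exists Q; split; last by rewrite QE.
split; last by exists c => s; rewrite QE.
split; first by rewrite QE; apply: ideal_colon.
split; first by rewrite QE => /hc.
move=> u v Quv; have [|nPu] := pselect (forall r, colon J (u * c) r -> P r).
  by move=> hu; right; rewrite -(qe u) // /colon mulrA (mulrC v); move: Quv; rewrite QE.
move: nPu => /existsNP[w /not_implyP[wu nPw]]; left.
rewrite -(qe w); first by rewrite /colon mulrCA.
move=> r; rewrite /colon mulrA => h; have /Pp[] : P (r * w) by apply: hc.
  by [].
by move/nPw.
Qed.

(** Below [P] lies a prime [Q] associated to the shorter ideal. If [Q] contained the last element
    [x], filter regularity would force [Q = m]; so [Q] is strictly below [P] and the chain grows. *)
Lemma prime_chain_freg l P : freg zid l -> is_prime P -> ~ same_set P m ->
  (forall r, gen zid l r -> P r) ->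
  exists C, prime_chain (size l) C /\ C (size l) = P.
Proof.
elim/last_ind: l P => [|l x IH] P /=.
  by move=> _ pP _ _; exists (fun _ => P); split=> //; split.
move=> /freg_rcons[fl mx hx] pP nP hP; have iI := ideal_gen_seq l ideal_zid.
have [|Q [aQ QP]] := ass_below iI pP.
  by move=> r hr; apply: hP; rewrite gen_rcons; apply: incl_addp.
have pQ : is_prime Q by case: aQ.
have nQ : ~ same_set Q m.
  move=> h; apply: nP => r; split; first exact: prime_max.
  by move=> /h/QP.
have nQx : ~ Q x.
  case: aQ => _ [a Qa] /Qa/hx[k hk]; apply: nQ => r; split; first exact: prime_max.
  case: pQ => iQ [Q1 Qp] mr.
  have xk y : y \in xs -> Q y.
    move=> yin; have : Q (y ^+ k) by apply/Qa/hk.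
    elim: (k) => [|j IHj]; first by rewrite expr0.
    by rewrite exprS => /Qp[].
  have := max_socle hxs (V := R^o) (u := 1) iQ _ mr; rewrite -[r *: 1]/(r * 1) mulr1; apply.
  by move=> y /xk; rewrite -[y *: 1]/(y * 1) mulr1.
have [|C [[C1 C2] CE]] := IH Q fl pQ nQ.
  by move=> r; case: aQ => _ [a Qa] hr; apply/Qa; rewrite /colon mulrC; apply: idealM.
exists (fun i => if (i <= size l)%N then C i else P); rewrite size_rcons ltnn; split=> //.
split=> i; first by case: ifP => [/C1|].
rewrite ltnS => il; rewrite il; case: ifP => [|/negbT]; first by apply: C2.
rewrite -leqNgt => li; have -> : i = size l by apply/eqP; rewrite eqn_leq il.
rewrite CE; split=> //; exists x; split=> //; apply: hP; rewrite gen_rcons.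
by have := mem_addp x 1 iI; rewrite mulr1.
Qed.

(** Otherwise an associated prime other than [m] ends a chain of [size l] steps, and [m] above it
    makes a chain longer than the dimension. *)
Lemma freg_long l d : krull_dim R d -> freg zid l -> (d <= size l)%N -> sat (gen zid l) 1.
Proof.
move=> [_ nch] fl dl; apply: contrapT => n1; apply: nch.
have iI := ideal_gen_seq l ideal_zid.
have [Q [[pQ [a Qa]] nQ _]] := ass_sat hxs noeth iI n1.
have [|C [[C1 C2] CE]] := prime_chain_freg fl pQ nQ.
  by move=> r hr; apply/Qa; rewrite /colon mulrC; apply: idealM.
have pm : is_prime m.
  have im := max_ideal hloc; split=> //; split; first by case: hloc => _ [].
  move=> u v muv; have [mu|/(local_unit hloc)[u' uu']] := pselect (m u); first by left.
  by right; rewrite -[v]mul1r -uu' -mulrA; apply: idealM.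
exists (fun i => if (i <= size l)%N then C i else m); split=> i id.
  by case: ifP => [/C1|].
rewrite ltnS in id; have il := leq_trans id dl; rewrite il; case: ifP => [|/negbT]; first by apply: C2.
rewrite -leqNgt => li; have -> : i = size l by apply/eqP; rewrite eqn_leq il.
rewrite CE; split; first exact: prime_max.
apply: contrapT => h; apply: nQ => r; split; first exact: prime_max.
by move=> mr; apply: contrapT => nr; apply: h; exists r.
Qed.

End FilterRegular.

(** * Uniform exponents *)

Section Exponents.
Variables (R : comNzRingType) (m : R -> Prop) (xs : seq R) (p : nat).
Hypotheses (hloc : is_local_max m) (hxs : same_set m (ideal_of_seq xs)).
Hypotheses (noeth : noetherian R) (charp : p \in [pchar R]).
Local Notation germ := (germ xs).
Implicit Types (g h c w u v : germ) (J : R -> Prop) (i j n N e : nat) (l bs : seq R).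
Local Notation sat := (sat xs).
Local Notation zid := (@zid R).
Local Notation freg := (freg m xs).

Definition powl l e := [seq x ^+ (p ^ e) | x <- l].
Definition Fpow l e := gen zid (powl l e).
Local Notation fe e := (iter e (@frob R xs p)).

Lemma powl0 l : powl l 0 = l.
Proof. by rewrite /powl -[RHS]map_id; apply: eq_map => x; rewrite expr1. Qed.

Lemma powlD l e e' : powl (powl l e) e' = powl l (e + e').
Proof. by rewrite /powl -map_comp; apply: eq_map => x /=; rewrite -exprM expnD. Qed.

Lemma FpowD l e e' : Fpow (powl l e) e' = Fpow l (e + e').
Proof. by rewrite /Fpow powlD. Qed.

Lemma Fpow0 l : Fpow l 0 = gen zid l. Proof. by rewrite /Fpow powl0. Qed.

Lemma ideal_Fpow l e : ideal (Fpow l e). Proof. exact/ideal_gen_seq/ideal_zid. Qed.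
Hint Resolve ideal_Fpow : core.

Lemma ideal_g l : ideal (gen zid l). Proof. exact/ideal_gen_seq/ideal_zid. Qed.
Hint Resolve ideal_g : core.

Lemma Fpow_rcons l x e : Fpow (rcons l x) e = addp (Fpow l e) (x ^+ (p ^ e)).
Proof. by rewrite /Fpow /powl map_rcons gen_rcons. Qed.

Lemma gen_Fpow l r e : gen zid l r -> Fpow l e (r ^+ (p ^ e)).
Proof.
have iF := ideal_Fpow l e; apply: (gen_min (K := fun r => Fpow l e (r ^+ (p ^ e)))).
- split; first by rewrite expr0n gtn_eqF ?(leq_ltn_trans _ (pe_gt charp e)) //; exact: (ideal0 iF).
  split=> [a b ha hb|s a ha]; first by rewrite (exprpeD charp); exact: (idealD iF ha hb).
  by rewrite -[s *: a]/(s * a) exprMn; exact: (idealM _ iF ha).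
- by move=> s ->; rewrite expr0n gtn_eqF ?(leq_ltn_trans _ (pe_gt charp e)) //; exact: (ideal0 iF).
- by move=> x xl; apply: gen_mem; [apply: ideal_zid|apply: map_f].
Qed.

Lemma Fpow_step l e r : Fpow l e r -> Fpow l e.+1 (r ^+ p).
Proof. by move=> /gen_Fpow -/(_ 1%N); rewrite FpowD addn1. Qed.

Lemma fe_coc l e e' j g : cech_cocycle j (Fpow l e) g -> cech_cocycle j (Fpow l (e + e')) (fe e' g).
Proof.
move=> h; elim: e' => [|e' IH]; first by rewrite addn0.
by rewrite addnS /=; apply: (frob_coc charp _ _ IH) => // r; apply: Fpow_step.
Qed.

Lemma fe_cob l e e' j g : cech_boundary j (Fpow l e) g -> cech_boundary j (Fpow l (e + e')) (fe e' g).
Proof.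
move=> h; elim: e' => [|e' IH]; first by rewrite addn0.
by rewrite addnS /=; apply: (frob_cob charp _ _ IH) => // r; apply: Fpow_step.
Qed.

Lemma feD e g h : fe e (g + h) = fe e g + fe e h.
Proof. by elim: e => //= e ->; apply: frobD. Qed.
Lemma feB e g h : fe e (g - h) = fe e g - fe e h.
Proof. by elim: e => //= e ->; apply: frobB. Qed.
Lemma feZ e r g : fe e (r *: g) = r ^+ (p ^ e) *: fe e g.
Proof. by elim: e => [|e IH]; rewrite ?expr1 //= IH frobZ -exprM expnSr. Qed.

Lemma fe_delta l x j c w e : delta (gen zid l) x j c w ->
  delta (Fpow l e) (x ^+ (p ^ e)) j (fe e c) (fe e w).
Proof.
move=> h; elim: e => [|e IH]; first by rewrite Fpow0 expr1.
rewrite expnSr exprM /=; apply: (frob_delta charp _ _ _ IH) => // r; exact: Fpow_step.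
Qed.

(** Nilpotency under the relative Frobenius from [H^j(R/I)] to [H^j(R/I^[p^e])]: the target moves
    with [e]. *)
Definition fnil l j c := exists e, cech_boundary j (Fpow l e) (fe e c).

Lemma fnil_at l j c e e' : cech_boundary j (Fpow l e) (fe e c) -> (e <= e')%N ->
  cech_boundary j (Fpow l e') (fe e' c).
Proof. by move=> h /subnKC <-; rewrite addnC iterD addnC; apply: fe_cob. Qed.

Lemma submod_fnil l j : submod (fnil l j).
Proof.
split; first by exists 0%N; exact: (submod0 (submod_cob _ _ _)).
split=> [g h [e he] [e' he']|r g [e he]].
  exists (maxn e e'); rewrite feD; apply: (submodD (submod_cob _ _ _)) => //.
    by apply: fnil_at he _; apply: leq_maxl.
  by apply: fnil_at he' _; apply: leq_maxr.
by exists e; rewrite feZ; apply: (submodZ _ (submod_cob _ _ _)).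
Qed.

Lemma fnil_pow l e j c : fnil (powl l e) j (fe e c) <-> fnil l j c.
Proof.
split=> [[e' h]|[e' h]].
  by exists (e' + e)%N; rewrite iterD addnC -FpowD.
exists e'; rewrite FpowD -iterD addnC; apply: fnil_at h _; exact: leq_addr.
Qed.

Lemma cob_fnil l j c : cech_boundary j (gen zid l) c -> fnil l j c.
Proof. by move=> h; exists 0%N; rewrite Fpow0. Qed.

Lemma Fpow_sub l x e r : Fpow l e r -> Fpow (rcons l x) e r.
Proof. by rewrite Fpow_rcons; apply: incl_addp. Qed.

Lemma fnil_rcons l x j c : fnil l j c -> fnil (rcons l x) j c.
Proof. by move=> [e h]; exists e; apply: cob_sub h => r; apply: Fpow_sub. Qed.

Lemma freg_powl l e : freg zid l -> freg zid (powl l e).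
Proof.
apply: (freg_pow hloc); last exact: ideal_zid.
exact: leq_ltn_trans (pe_gt charp e).
Qed.

Lemma freg_last l x e : freg zid (rcons l x) ->
  forall r, Fpow l e (x ^+ (p ^ e) * r) -> sat (Fpow l e) r.
Proof. by move=> /(freg_powl e); rewrite /powl map_rcons => /freg_rcons[]. Qed.

Lemma freg_split l x : freg zid (rcons l x) ->
  [/\ freg zid l, m x & forall r, gen zid l (x * r) -> sat (gen zid l) r].
Proof. by move/freg_rcons. Qed.

Definition nil_bounded i j := exists e, forall l, size l = i -> freg zid l ->
  forall c, cech_cocycle j (gen zid l) c -> fnil l j c -> cech_boundary j (Fpow l e) (fe e c).

Definition nil_cofinite i j := exists k, forall l, size l = i -> freg zid l ->
  forall c, cech_cocycle j (gen zid l) c -> forall x, x \in xs -> fnil l j (x ^+ k *: c).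

(** The Frobenius powers of the zero ideal are zero, so Frobenius acts on [H^j_m(R)] itself and the
    Hartshorne-Speiser-Lyubeznik theorem applies to the nilpotent part. *)
Lemma nil_bounded0 j : nil_bounded 0 j.
Proof.
have iz := @ideal_zid R.
pose Z g := cech_cocycle j zid g /\ exists e, cech_boundary j zid (fe e g).
have F0 e : Fpow [::] e = zid by [].
have sZ : submod Z := submod_meet (submod_coc xs j iz) (submod_fnil [::] j).
have sB := submod_cob xs j iz.
have BZ : incl (cech_boundary j zid) Z.
  by move=> g h; split; [apply: cob_coc|exists 0%N].
have art : artin (cech_boundary j zid) Z.
  by apply: (artin_sub (artin_coc hloc hxs noeth charp iz (j := j))) => g [].
have FB g : cech_boundary j zid g -> cech_boundary j zid (frob p g) by apply: (@fe_cob [::] 0 1).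
have FZ g : Z g -> Z (frob p g).
  move=> [cg [e he]]; split; first exact: (@fe_coc [::] 0 1).
  by exists e; rewrite -iterSr; apply: (@fe_cob [::] e 1).
have tor g : Z g -> torsion xs (cech_boundary j zid) g by move=> [cg _]; apply: coc_torsion.
have [|e he] := hartshorne_speiser_lyubeznik hloc hxs noeth charp sB sZ BZ art tor
  (frobD charp (xs := xs)) (@frobZ R xs p) FB FZ.
  by move=> u [].
exists e => l /size0nil -> _ c cc nc; apply: he; split=> //.
Qed.

(** [y ^ k] makes the connecting image nilpotent and [F ^ e] kills it, so [F ^ e (y ^ k c)] comes
    from a class [u] over the powers of [l], which [y ^ k'] makes nilpotent. As [p ^ e >= 1], that
    factor is present in [F ^ e (y ^ (k + k') c)]. *)
Lemma nil_cofiniteS i j : nil_cofinite i j.+1 -> nil_bounded i j.+1 -> nil_cofinite i j ->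
  nil_cofinite i.+1 j.
Proof.
move=> [k hk] [e he] [k' hk']; exists (k + k')%N.
elim/last_ind => [//|l x _]; rewrite size_rcons => -[sl] fr c cc y yin.
have [fl _ Jx] := freg_split fr.
rewrite gen_rcons in cc.
have [w dw] := delta_total (ideal_g l) cc.
have ny : fnil l j.+1 (y ^+ k *: w).
  by apply: (hk l sl fl) => //; apply: (delta_cocr (ideal_g l) Jx dw).
have cy : cech_boundary j.+1 (Fpow l e) (fe e (y ^+ k *: w)).
  apply: (he l sl fl) => //; apply: (delta_cocr (ideal_g l) Jx (deltaZ (ideal_g l) _ dw)).
have [u [cu hu]] := delta_ker (ideal_Fpow l e) (fe_delta e (deltaZ (ideal_g l) (y ^+ k) dw)) cy.
rewrite -Fpow_rcons in hu.
have nu : fnil (powl l e) j (y ^+ k' *: u).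
  by apply: hk' => //; [rewrite size_map|apply: freg_powl].
have sn := submod_fnil (powl (rcons l x) e) j.
have nfe : fnil (powl (rcons l x) e) j (y ^+ k' *: fe e (y ^+ k *: c)).
  rewrite -(subrK (y ^+ k' *: u) (y ^+ k' *: fe e (y ^+ k *: c))) -scalerBr.
  apply: (submodD sn); first by apply: (submodZ _ sn); apply: cob_fnil.
  by rewrite /powl map_rcons; apply: fnil_rcons.
apply/(fnil_pow _ e); rewrite addnC exprD -scalerA feZ.
have -> : (y ^+ k') ^+ (p ^ e) = (y ^+ k') ^+ (p ^ e).-1 * y ^+ k'.
  by rewrite -exprSr prednK // (leq_ltn_trans _ (pe_gt charp e)).
by rewrite -scalerA; apply: (submodZ _ sn).
Qed.

(** After [F ^ e] the class comes from some [u] over the powers of [l], known to be nilpotent only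
    modulo [x]. A further Frobenius makes it a multiple of a high power of [x], hence nilpotent by
    [nil_cofinite]. The bound [e'] then applies to [u] itself, whatever that auxiliary power was. *)
Lemma nil_boundedS i j : nil_bounded i j.+1 -> nil_bounded i j -> nil_cofinite i j ->
  nil_bounded i.+1 j.
Proof.
move=> [e he] [e' he'] [k hk]; exists (e + e')%N.
elim/last_ind => [//|l x _]; rewrite size_rcons => -[sl] fr c cc nc.
have [fl mx Jx] := freg_split fr.
rewrite gen_rcons in cc.
have [w dw] := delta_total (ideal_g l) cc.
have nw : fnil l j.+1 w.
  move: nc => [e0 h0]; exists e0; rewrite Fpow_rcons in h0.
  refine (delta_cob (ideal_Fpow l e0) (freg_last fr) (fe_delta e0 dw) h0).
have cw : cech_boundary j.+1 (Fpow l e) (fe e w).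
  by apply: (he l sl fl) => //; apply: (delta_cocr (ideal_g l) Jx dw).
have [u [cu hu]] := delta_ker (ideal_Fpow l e) (fe_delta e dw) cw.
rewrite -Fpow_rcons in hu.
have frl : freg zid (powl l e) by apply: freg_powl.
have szl : size (powl l e) = i by rewrite size_map.
have nu : fnil (powl l e) j u.
  have [e1 h1] : fnil (powl (rcons l x) e) j u.
    have sn := submod_fnil (powl (rcons l x) e) j.
    apply: (submod_subl sn (cob_fnil hu)); exact/fnil_pow.
  (* The maximum with [k] makes the power of [x] large enough for [nil_cofinite]. *)
  pose e2 := maxn e1 k.
  have h2 := fnil_at h1 (leq_maxl e1 k); rewrite -/e2 FpowD in h2.
  have cu2 : cech_cocycle j (Fpow l (e + e2)) (fe e2 u) by apply: fe_coc.
  rewrite Fpow_rcons in h2.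
  have [v [cv hv]] := coc_ker (ideal_Fpow l _) (freg_last fr) cu2 h2.
  apply/(fnil_pow _ e2); rewrite powlD.
  have sn := submod_fnil (powl l (e + e2)) j.
  apply: (submod_subr sn (cob_fnil hv)).
  apply: (pw_kill sn _ (max_pw hxs charp mx (e := e + e2))) => y yin.
  have ke : (k <= p ^ (e + e2))%N.
    apply: leq_trans (ltnW (pe_gt charp _)); apply: leq_trans (leq_addl _ _); exact: leq_maxr.
  rewrite -(subnK ke) exprD -scalerA; apply: (submodZ _ sn).
  by apply: hk => //; [rewrite size_map|apply: freg_powl].
have h := he' _ szl frl u cu nu; rewrite FpowD in h.
rewrite addnC iterD addnC.
have -> : fe e' (fe e c) = fe e' (fe e c - u) + fe e' u by rewrite feB subrK.
apply: (submodD (submod_cob _ _ (ideal_Fpow _ _))); first exact: fe_cob.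
by apply: cob_sub h => r; apply: Fpow_sub.
Qed.

(** In degree 0, [sat J / J] is finitely generated and torsion. Above it, a class killed by [x] is a
    connecting image of some [c], which the other elements kill only modulo the kernel [B'];
    [artin_colon_quo] absorbs that kernel. *)
Lemma colon_bounded J l a : ideal J -> freg J l -> m a ->
  exists N, forall u, cech_cocycle (xs := xs) (size l) J u -> killed_by l (cech_boundary (size l) J) u ->
    cech_boundary (size l) J (a ^+ N *: u).
Proof.
move=> + + ma; elim: l J => [|x l IH] J iJ /=.
  move=> _; have iS := ideal_sat xs iJ; have [gs hgs] := noeth (I := sat J) iS.
  have [||N hN] := @bound_list _ gs (fun r n => J (a ^+ n * r)).
  - by move=> r n k nk; rewrite -(subnK nk) exprD -mulrA; apply: idealM.
  - move=> r rin; apply: (sat_kill hxs charp iJ _ ma); apply/hgs.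
    exact: ideal_gen_mem.
  exists N => u cu _; have [r hr nr] := coc0_cst iJ cu.
  have Jr : J (a ^+ N * r).
    rewrite mulrC; move/hgs: hr; apply: (@ideal_gen_min _ _ (colon J (a ^+ N))).
      exact: ideal_colon.
    by move=> s /hN; rewrite /colon mulrC.
  have sB := submod_cob xs 0 iJ.
  apply: (@submod_subr _ _ _ _ (a ^+ N *: (cst r : germ)) sB).
    by rewrite -scalerBr; apply: (submodZ _ sB); apply: nul_cob.
  by rewrite -cstZ; apply/cob_cst.
move=> [mx [Jx fl]]; have iJ' := ideal_addp x iJ.
have [N hN] := IH _ iJ' fl; set j := size l in hN *.
pose B' v := cech_cocycle j (addp J x) v /\ exists2 w, delta J x j v w & cech_boundary j.+1 J w.
have sC := submod_cob xs j.+1 iJ.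
have sB' : submod B'.
  split.
    split; first exact: (submod0 (submod_coc _ _ iJ')).
    have [w dw] := delta_total iJ (submod0 (submod_coc xs j iJ')).
    exists w => //; apply: (delta_cob iJ Jx dw); exact: (submod0 (submod_cob _ _ iJ')).
  split=> [v v' [cv [w dw cw]] [cv' [w' dw' cw']]|r v [cv [w dw cw]]]; split.
  - exact: (submodD (submod_coc _ _ iJ') cv cv').
  - by exists (w + w'); [apply: deltaD|exact: (submodD sC cw cw')].
  - exact: (submodZ r (submod_coc _ _ iJ') cv).
  - by exists (r *: w); [apply: deltaZ|exact: (submodZ r sC cw)].
have BB' : incl (cech_boundary (xs := xs) j (addp J x)) B'.
  move=> v hv; have cv := cob_coc iJ' hv; split=> //.
  have [w dw] := delta_total iJ cv; exists w => //; exact: (delta_cob iJ Jx dw).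
have [||N' hN'] := artin_colon_quo (submod_cob xs j iJ') (submod_coc xs j iJ') sB' BB' _
  (artin_coc hloc hxs noeth charp iJ' (j := j)) (bs := l) (a := a).
- by move=> v [].
- by exists N.
exists N' => u cu ku.
have [|c dc] := delta_im iJ cu (x := x); first by apply: ku; rewrite mem_head.
have [|_ [w dw cw]] := hN' c (delta_cocl iJ dc).
  move=> y yl; have dy := deltaZ iJ y dc; split; first exact: (delta_cocl iJ dy).
  by exists (y *: u) => //; apply: ku; rewrite in_cons yl orbT.
exact: (submod_subr sC (delta_uniq iJ Jx (deltaZ iJ (a ^+ N') dc) dw) cw).
Qed.

(** The order of quantifiers matters: [e] is fixed by the two lengths, while [N] may depend on the
    sequences, on [a] and on the family, but not on the index [n]. *)
Definition family_bounded i j := exists e, forall l bs, size l = i -> size bs = j ->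
  freg zid (l ++ bs) -> forall a, m a -> forall w : nat -> germ,
  (forall n, cech_cocycle j.+1 (gen zid l) (w n)) -> (forall n, fnil l j.+1 (w n)) ->
  (forall n, killed_by bs (cech_boundary j.+1 (gen zid l)) (w n)) ->
  exists N, forall n, cech_boundary j.+1 (Fpow l e) (a ^+ N *: fe e (w n)).

(** The connecting map shortens [l], raises the degree and moves [x] into [bs], since [x] kills its
    images. Going back, [a ^ N1 F ^ e (w n)] comes from a class killed by the powers of [x :: bs]
    modulo [B']; their number equals the degree, so [colon_bounded] gives an exponent independent of
    [n]. *)
Lemma family_boundedP i j : family_bounded i j.
Proof.
elim: i j => [|i IH] j.
  have [e he] := nil_bounded0 j.+1; exists e => l bs sl _ _ a _ w cw nw _.
  have l0 := size0nil sl; exists 0%N => n; rewrite expr0 scale1r.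
  by apply: he => //; rewrite l0.
have [e he] := IH j.+1; exists e; elim/last_ind => [//|l x _] bs.
rewrite size_rcons => -[sl] sbs; rewrite -cats1 -catA /= => fr a ma w cw nw kw.
have fr' : freg zid (rcons l x).
  by move: fr; rewrite -cat_rcons => /freg_cat[].
have [fl mx Jx] := freg_split fr'.
rewrite cats1 gen_rcons in cw kw.
have [v dv] := choice (fun n => delta_total (ideal_g l) (cw n)).
have cv n := delta_cocr (ideal_g l) Jx (dv n).
have nv n : fnil l j.+2 (v n).
  rewrite cats1 in nw; have [e0 h0] := nw n; exists e0; rewrite Fpow_rcons in h0.
  exact: (delta_cob (ideal_Fpow l e0) (freg_last fr') (fe_delta e0 (dv n)) h0).
have kv n : killed_by (x :: bs) (cech_boundary j.+2 (gen zid l)) (v n).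
  move=> b; rewrite in_cons => bin.
  apply: (delta_cob (ideal_g l) Jx (deltaZ (ideal_g l) b (dv n))).
  case/orP: bin => [/eqP->|/kw//]; exact: (cob_x _ (ideal_g l)).
have [|N1 hN1] := he l (x :: bs) sl _ fr a ma v cv nv kv; first by rewrite /= sbs.
have iF := ideal_Fpow l e; have iFx := ideal_Fpow (rcons l x) e.
have sF := submod_cob xs j.+1 iF; have sFx := submod_cob xs j.+1 iFx.
have frp : freg (Fpow l e) (powl (x :: bs) e).
  by have := freg_powl e fr; rewrite /powl map_cat => /freg_cat[].
have [N hN] := colon_bounded iF frp ma.
have szp : size (powl (x :: bs) e) = j.+1 by rewrite size_map /= sbs.
rewrite szp in hN.
pose B' u := cech_cocycle j.+1 (Fpow l e) u /\ cech_boundary j.+1 (Fpow (rcons l x) e) u.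
have sB' : submod B' := submod_meet (submod_coc xs j.+1 iF) sFx.
have BB' : incl (cech_boundary j.+1 (Fpow l e)) B'.
  by move=> u hu; split; [apply: cob_coc|apply: cob_sub hu => r; apply: Fpow_sub].
have [||N2 hN2] := artin_colon_quo sF (submod_coc xs j.+1 iF) sB' BB' _
  (artin_coc hloc hxs noeth charp iF (j := j.+1)) (bs := powl (x :: bs) e) (a := a).
- by move=> u [].
- by exists N.
exists (N2 + N1)%N => n; rewrite cats1.
have dn : delta (Fpow l e) (x ^+ (p ^ e)) j.+1 (a ^+ N1 *: fe e (w n)) (a ^+ N1 *: fe e (v n)).
  by apply: deltaZ => //; apply: fe_delta.
have [u [cu hu]] := delta_ker iF dn (hN1 n); rewrite -Fpow_rcons in hu.
have [|_ hu2] := hN2 u cu.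
  move=> b /mapP[y yin ->]; split; first exact: (submodZ _ (submod_coc xs j.+1 iF) cu).
  have : cech_boundary j.+1 (Fpow (rcons l x) e) (y ^+ (p ^ e) *: (a ^+ N1 *: fe e (w n))).
    rewrite scalerA mulrC -scalerA; apply: (submodZ _ sFx).
    move: yin; rewrite in_cons => /orP[/eqP->|yin].
      by rewrite Fpow_rcons; apply: (cob_x _ iF).
    have := @fe_cob (rcons l x) 0 e j.+1 (y *: w n); rewrite Fpow0 add0n feZ; apply.
    by rewrite gen_rcons; apply: kw.
  move=> h; apply: (submod_subl sFx _ h); rewrite -scalerBr; exact: (submodZ _ sFx hu).
rewrite exprD -scalerA; apply: (@submod_subr _ _ _ _ (a ^+ N2 *: u) sFx) => //.
by rewrite -scalerBr; exact: (submodZ _ sFx hu).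
Qed.

Lemma fe_cst e r : null_germ 0 zid (fe e (cst r : germ) - cst (r ^+ (p ^ e))).
Proof.
move=> S /cards0_eq ->; exists 0%N => n _; rewrite germD germN.
have -> : fe e (cst r : germ) n set0 = r ^+ (p ^ e).
  elim: e n => [|e IH] n; first by rewrite expr1.
  by rewrite /= /frob IH /xS big_set0 expr1n mulr1 -exprM expnSr.
by rewrite /cst subrr.
Qed.

Lemma cob_fe_cst J e r : ideal J -> J 0 ->
  cech_boundary 0 J (fe e (cst r : germ)) <-> J (r ^+ (p ^ e)).
Proof.
move=> iJ J0; have hn : cech_boundary 0 J (fe e (cst r : germ) - cst (r ^+ (p ^ e))).
  by apply: nul_cob => //; apply: nul_sub (fe_cst e r) => s ->.
have sB := submod_cob xs 0 iJ.
split=> [h|h]; first by apply/(cob_cst xs _ iJ); apply: (submod_subl sB hn h).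
by apply: (submod_subr sB hn); apply/cob_cst.
Qed.

(* Extending [l] by powers of a filter regular [z] raises the dimension of the
   sequence; letting the power of [z] grow and using Krull's intersection
   theorem returns to [l]. *)
Lemma closure_torsion d k i : krull_dim R d -> (d <= i + k)%N ->
  exists e, forall l, size l = i -> freg zid l ->
  forall y, (exists e', Fpow l e' (y ^+ (p ^ e'))) -> sat (Fpow l e) (y ^+ (p ^ e)).
Proof.
move=> dim; elim: k i => [|k IH] i dk.
  exists 0%N => l sl fl y _; rewrite Fpow0 expr1.
  have h1 : sat (gen zid l) 1 by apply: (freg_long hloc hxs noeth dim) => //; rewrite sl -(addn0 i).
  by rewrite -[y]mulr1; apply: (idealM _ (ideal_sat _ _)).
have [|e1 he1] := IH i.+1; first by rewrite addSnnS.
have [e2 he2] := family_boundedP i 0; exists (e1 + e2)%N => l sl fl y [e' hy].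
have [z [mz hz]] := filter_regular_exists hloc hxs noeth (ideal_g l).
pose q1 := (p ^ e1)%N; pose L := powl l e1; pose Y := y ^+ q1; pose Z := z ^+ q1.
have frz n : freg zid (rcons l (z ^+ n.+1)).
  by apply/freg_rcons; split=> //; [apply: max_exp|apply: regular_exp].
have frL : freg zid L by apply: freg_powl.
have szL : size L = i by rewrite size_map.
(* One exponent [e1] serves all the extensions by [z ^ n.+1], so [Y] is a class in
   [H^0(R/(L, Z ^ n.+1))] for every [n]. *)
have Yn n : sat (addp (gen zid L) (Z ^+ n.+1)) Y.
  have [|//|e0 h0] := he1 (rcons l (z ^+ n.+1)) _ (frz n) y.
  - by rewrite size_rcons sl.
  - by exists e'; apply: Fpow_sub.
  by move: e0 h0; rewrite Fpow_rcons => e0 h0; exists e0; rewrite /Z exprAC.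
pose q2 := (p ^ e2)%N; pose a := z ^+ (p ^ (e1 + e2)).
have aE : a = Z ^+ q2 by rewrite /a /Z -exprM /q1 /q2 expnD.
have ma : m a by apply: max_exp => //; apply: leq_ltn_trans (pe_gt charp _).
have frLn n : freg zid (rcons L (Z ^+ n.+1)).
  by have := freg_powl e1 (frz n); rewrite /powl map_rcons exprAC.
have iL := ideal_g L; pose K := Fpow L e2; have iK : ideal K by apply: ideal_Fpow.
have cY n : cech_cocycle 0 (addp (gen zid L) (Z ^+ n.+1)) (cst Y : germ).
  by apply/coc_cst => //; apply: ideal_addp.
have [w dw] := choice (fun n => delta_total iL (cY n)).
have JxL n := (freg_split (frLn n)).
have cw n : cech_cocycle 1 (gen zid L) (w n) by case: (JxL n) => _ _ h; apply: delta_cocr (dw n).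
have nw n : fnil L 1 (w n).
  exists e'; have iF := ideal_Fpow L e'.
  apply: (delta_cob iF (freg_last (frLn n)) (fe_delta e' (dw n))).
  have iA := ideal_addp ((Z ^+ n.+1) ^+ (p ^ e')) iF.
  apply/cob_fe_cst => //; first exact: (ideal0 iA).
  apply: incl_addp; rewrite /L FpowD addnC -FpowD /Y exprAC; exact: gen_Fpow.
have [||N hN] := he2 L [::] szL erefl _ a ma w cw nw; first by rewrite cats0.
  by move=> n b.
(* As [a ^ N] kills [F ^ e2 (w n)], the class of [a ^ N Y ^ q2] lifts to some [r] in [sat K], up to
   a multiple of [a ^ n.+1]. [N] does not depend on [n], so Krull's theorem applies. *)
have step n : addp (sat K) (a ^+ n.+1) (a ^+ N * Y ^+ q2).
  have dn : delta K (a ^+ n.+1) 0 (a ^+ N *: fe e2 (cst Y : germ)) (a ^+ N *: fe e2 (w n)).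
    by have := deltaZ iK (a ^+ N) (fe_delta e2 (dw n)); rewrite -exprM mulnC exprM -/q2 -aE.
  have [u [cu hu]] := delta_ker iK dn (hN n).
  have [r sr nr] := coc0_cst iK cu.
  have iA := ideal_addp (a ^+ n.+1) iK.
  have sA := submod_cob xs 0 iA.
  have h1 : cech_boundary 0 (addp K (a ^+ n.+1)) (a ^+ N *: (fe e2 (cst Y : germ) - cst (Y ^+ q2))).
    apply: (submodZ _ sA); apply: nul_cob => //; apply: nul_sub (fe_cst e2 Y) => t ->.
    exact: (ideal0 iA).
  have h2 : cech_boundary 0 (addp K (a ^+ n.+1)) (u - cst r).
    by apply: nul_cob => //; apply: nul_sub nr => t; apply: incl_addp.
  have h3 : cech_boundary 0 (addp K (a ^+ n.+1)) (cst (a ^+ N * Y ^+ q2 - r) : germ).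
    have := submodD sA (submodB sA hu h1) h2.
    by rewrite scalerBr opprB [X in X + _]addrC [X in X + _]addrA subrK subrKA.
  have [b [c [Kb E]]] := (cob_cst xs _ iA).1 h3.
  exists (b + r), c; split; last by rewrite addrAC -E subrK.
  by apply: (idealD (ideal_sat xs iK)) => //; apply: sat_incl.
have [k2 hk2] : sat K (a ^+ N * Y ^+ q2).
  apply: (krull_intersection hloc noeth (ideal_sat xs iK) ma) => -[|n]; last exact: step.
  by have := mem_addp (a ^+ 0) (a ^+ N * Y ^+ q2) (ideal_sat xs iK); rewrite {1}expr0 mul1r.
have KE : K = Fpow l (e1 + e2) by rewrite /K /L FpowD.
have YE : Y ^+ q2 = y ^+ (p ^ (e1 + e2)) by rewrite /Y -exprM /q1 /q2 expnD.
rewrite -KE -YE; apply: (sat_of_mul iK (k := k2)) => x xin.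
(* [a] is a power of [z] that is filter regular modulo [K], so [a ^ N] cancels up to saturation. *)
apply: (regular_exp iK _ (n := N)); last by rewrite mulrCA; apply: hk2.
have frlz : freg zid (rcons l z) by apply/freg_rcons.
by rewrite KE; apply: freg_last frlz.
Qed.

End Exponents.

(** * Comparison of germs with cochains *)

Section Link.
Variables (R : comNzRingType) (xs : seq R) (p : nat).
Hypothesis charp : p \in [pchar R].
Local Notation zid := (@zid R).
Local Notation germ := (germ xs).
Local Notation fe e := (iter e (@frob R xs p)).
Implicit Types (c b : cochain xs) (j n e : nat).

Definition to_germ c : germ := lift c.2 c.1.

Lemma nul_to_germ j c : null_germ j zid (to_germ c) <-> zero_loc j c.
Proof.
split=> h S Sj; have [N hN] := h S Sj.
  by exists N; have := hN (N + c.2)%N (leq_addr _ _); rewrite /to_germ /lift addnK.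
exists (N + c.2)%N => n nN; rewrite /to_germ /lift.
have -> : (n - c.2 = n - c.2 - N + N)%N by lia.
by rewrite exprD -mulrA hN mulr0.
Qed.

Lemma to_germ_add j c c' : null_germ j zid (to_germ (add_co c c') - (to_germ c + to_germ c')).
Proof.
apply: (nul_of_unif (N := (c.2 + c'.2)%N)) => n S nN _.
rewrite germD germN germD /to_germ /lift /=.
have -> : (n - c.2 = n - (c.2 + c'.2) + c'.2)%N by lia.
have -> : (n - c'.2 = n - (c.2 + c'.2) + c.2)%N by lia.
by rewrite !exprD /zid; ring.
Qed.

Lemma to_germ_sub j c c' : null_germ j zid (to_germ (sub_co c c') - (to_germ c - to_germ c')).
Proof.
apply: (nul_of_unif (N := (c.2 + c'.2)%N)) => n S nN _.
rewrite germD germN germD germN /to_germ /lift /=.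
have -> : (n - c.2 = n - (c.2 + c'.2) + c'.2)%N by lia.
have -> : (n - c'.2 = n - (c.2 + c'.2) + c.2)%N by lia.
by rewrite !exprD /zid; ring.
Qed.

Lemma to_germ_scale r c : to_germ (scale_co r c) = r *: to_germ c.
Proof. by apply: germP => n S; rewrite germZ /to_germ /lift /= mulrCA. Qed.

Lemma to_germ_diff j c : null_germ j zid (to_germ (dco c) - diff (to_germ c)).
Proof.
apply: (nul_of_unif (N := c.2)) => n S nN _.
by rewrite germD germN /to_germ diff_lift // subrr.
Qed.

Lemma to_germ_frob1 j c : null_germ j zid (frob p (to_germ c) - to_germ (frob_co p c)).
Proof.
have p0 := p_gt0 charp.
apply: (nul_of_unif (N := (p * c.2)%N)) => n S nN _; rewrite germD germN /frob /to_germ /lift /=.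
have cn : (c.2 <= n %/ p)%N by rewrite leq_divRL // mulnC.
have -> : (n - p * c.2 = (n %/ p - c.2) * p + n %% p)%N.
  by rewrite {1}(divn_eq n p) mulnBl (mulnC p) addnBAC // leq_mul2r cn orbT.
by rewrite exprMn -exprM mulrAC -exprD subrr.
Qed.

Lemma to_germ_frob j e c : null_germ j zid (fe e (to_germ c) - to_germ (frob_co (p ^ e) c)).
Proof.
have sN := submod_nul xs j (@ideal_zid R).
elim: e => [|e IH].
  have -> : frob_co (p ^ 0) c = c.
    by case: c => c n; rewrite /frob_co /= mul1n; congr (_, _); apply/funext => S; rewrite expr1.
  by rewrite subrr; exact: (submod0 sN).
have -> : frob_co (p ^ e.+1) c = frob_co p (frob_co (p ^ e) c).
  rewrite /frob_co /= expnS -mulnA; congr (_, _); apply/funext => S.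
  by rewrite mulnC exprM.
rewrite /= -(subrKA (frob p (to_germ (frob_co (p ^ e) c)))); apply: (submodD sN).
  rewrite -(frobB charp); apply: (frob_nul charp _ _ IH); first exact: ideal_zid.
  by move=> r ->; rewrite /zid expr0n gtn_eqF // (p_gt0 charp).
exact: to_germ_frob1.
Qed.

Lemma cocycle_germ j c : cocycle j c <-> cech_cocycle j zid (to_germ c).
Proof.
have sN := submod_nul xs j.+1 (@ideal_zid R); have h := @to_germ_diff j.+1 c.
split=> [/nul_to_germ hc|[_ hc]].
  split; first by apply: lift_good; apply: ideal_zid.
  exact: (submod_subl sN h hc).
by apply/nul_to_germ; exact: (submod_subr sN h hc).
Qed.

Lemma coboundary_germ j c : coboundary j c -> cech_boundary j zid (to_germ c).
Proof.
have iz := @ideal_zid R; case: j => [|j] /=.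
  by move=> /nul_to_germ; apply: nul_cob.
move=> [b /nul_to_germ hb]; have sN := submod_nul xs j.+1 iz.
exists (diff (to_germ b)); split; first by exists (to_germ b); split=> //; apply: lift_good.
have h1 := submod_subl sN (@to_germ_sub j.+1 (dco b) c) hb.
rewrite -opprB; apply: (submodN sN).
have := submodB sN h1 (@to_germ_diff j.+1 b); rewrite opprB addrC.
by rewrite subrKA.
Qed.

Lemma germ_surj j (g : germ) : cech_cocycle j zid g -> exists2 c, cocycle j c & null_germ j zid (g - to_germ c).
Proof.
have iz := @ideal_zid R; move=> cg; have [N hN] := good_lift iz cg.1.
have hn := hN N (leqnn N); exists (g N, N) => //.
apply/cocycle_germ; have := submodB (submod_coc _ _ iz) cg (cob_coc iz (nul_cob iz hn)).
by rewrite opprB addrC subrK.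
Qed.

(** The submodules of classes [c] with [x ^ i c] nilpotent increase with [i], so two neighbours
    agree at some [i <= L]. Agreement persists for larger [i], and by torsion the union is
    everything; hence [x ^ L] suffices. *)
Lemma finite_length_killed j : finite_length_quot xs p j ->
  exists k, forall x, x \in xs -> forall g : germ, cech_cocycle j zid g -> fnil p [::] j (x ^+ k *: g).
Proof.
have iz := @ideal_zid R.
move=> [L hL]; exists L => x xin.
have sn := submod_fnil xs charp [::] j.
have cn (g : germ) : cech_boundary j zid g -> fnil p [::] j g by move=> h; exists 0%N.
pose P i c := cocycle j c /\ fnil p [::] j (x ^+ i *: to_germ c).
have sC := submod_coc xs j iz.
have qP i : is_qsub p j (P i).
  split; first by move=> c [].
  split.
    move=> c [hc [e /coboundary_germ he]]; split=> //; apply: (submodZ _ sn).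
    exists e; apply: (submod_subr (submod_cob xs j iz) _ he).
    by apply: nul_cob => //; apply: to_germ_frob.
  split.
    move=> c c' [/cocycle_germ h1 h2] [/cocycle_germ h1' h2'].
    have ha := nul_cob iz (@to_germ_add j c c'); split.
      apply/cocycle_germ; apply: (submod_subr sC (cob_coc iz ha)); exact: (submodD sC h1 h1').
    apply: (@submod_subr _ _ _ _ (x ^+ i *: (to_germ c + to_germ c')) sn).
      by rewrite -scalerBr; apply: (submodZ _ sn); apply: cn.
    by rewrite scalerDr; exact: (submodD sn h2 h2').
  split.
    move=> r c [/cocycle_germ h1 h2]; split.
      by apply/cocycle_germ; rewrite to_germ_scale; exact: (submodZ r sC h1).
    by rewrite to_germ_scale scalerA mulrC -scalerA; exact: (submodZ r sn h2).
  move=> c c' [h1 h2] hc' /nul_to_germ h; split=> //.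
  have hd : null_germ j zid (to_germ c - to_germ c').
    exact: (submod_subl (submod_nul xs j iz) (@to_germ_sub j c c') h).
  apply: (submod_subl sn _ h2); rewrite -scalerBr; apply: (submodZ _ sn).
  by apply/cn/nul_cob.
have Pup i n c : (i <= n)%N -> P i c -> P n c.
  move=> /subnK <- [h1 h2]; split=> //; rewrite exprD -scalerA.
  exact: (submodZ _ sn h2).
have [i [iL hi]] : exists i, (i <= L)%N /\ forall c, P i.+1 c -> P i c.
  apply: contrapT => h; suff : (L.+1 <= L)%N by rewrite ltnn.
  apply: (hL _ P) => [i _|i]; first exact: qP.
  rewrite ltnS => iL; split; first by move=> c; apply: Pup.
  apply: contrapT => h2; apply: h; exists i; split=> // c Pc.
  by apply: contrapT => nP; apply: h2; exists c.
have Pdown n c : P (i + n)%N c -> P i c.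
  elim: n => [|n IH]; first by rewrite addn0.
  move=> [h1 h2]; apply: IH; split=> //.
  have [|_] := hi (scale_co (x ^+ n) c); last first.
    by rewrite to_germ_scale scalerA -exprD.
  split.
    by move/cocycle_germ: h1 => h1; apply/cocycle_germ; rewrite to_germ_scale; exact: (submodZ _ sC h1).
  by rewrite to_germ_scale scalerA -exprD addSnnS.
move=> g cg; have [c hc nc] := germ_surj cg.
have [N hN] := coc_torsion iz ((cocycle_germ j c).1 hc).
have [_ hPi] : P L c.
  apply: (Pup i) => //; apply: (Pdown N); apply: (Pup N); first exact: leq_addl.
  by split=> //; apply/cn/hN.
apply: (@submod_subr _ _ _ _ (x ^+ L *: to_germ c) sn) => //.
by rewrite -scalerBr; apply: (submodZ _ sn); apply/cn/nul_cob.
Qed.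

End Link.

(** * Uniform bound on the test exponent *)

Lemma frob_powE (R : comNzRingType) p (l : seq R) e : p \in [pchar R] ->
  frob_pow (p ^ e) (gen (@zid R) l) = Fpow p l e.
Proof.
move=> charp; apply: (predext (V := R^o)) => r.
  apply: ideal_gen_min; first exact: ideal_Fpow.
  by move=> _ [x [Ix ->]]; apply: gen_Fpow.
apply: gen_min; first exact: ideal_ideal_gen.
  by move=> s ->; apply: (ideal0 (ideal_ideal_gen _)).
move=> _ /mapP[x xl ->]; apply: ideal_gen_mem; exists x; split=> //.
by apply: gen_mem => //; apply: ideal_zid.
Qed.

Theorem theorem1p2 (R : comNzRingType) (p : nat) (m : R -> Prop) (d t : nat)
    (xs : seq R) :
  noetherian R -> is_local_max m -> krull_dim R d -> p \in [pchar R] ->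
  (0 < t)%N -> (t <= d)%N ->
  same_set m (ideal_of_seq xs) ->
  (forall j, (j < t)%N -> finite_length_quot xs p j) ->
  exists C : nat, (0 < C)%N /\
    forall ys : seq R, size ys = t -> filter_regular m ys ->
      Fte_le p (ideal_of_seq ys) C.
Proof.
move=> noeth hloc dim charp _ _ hxs hfl.
(* Finite length enters only for the empty sequence, in degrees below [t]. *)
have bounds i : forall j, ((i + j <= t)%N -> nil_bounded m xs p i j) /\
    ((i + j < t)%N -> nil_cofinite m xs p i j).
  elim: i => [|i IH] j; split=> hij.
  - exact: nil_bounded0.
  - have [k hk] := finite_length_killed charp (hfl j hij).
    by exists k => l /size0nil -> _ c cc x xin; apply: hk.
  - by apply: nil_boundedS => //; apply IH; lia.
  - by apply: nil_cofiniteS => //; apply IH; lia.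
have [eA hA] := closure_torsion (k := d) (i := t) hloc hxs noeth charp dim (leq_addl _ _).
have [eB hB] := (bounds t 0%N).1 (eq_leq (addn0 t)).
(* [eA] moves an element of the Frobenius closure into the saturation, and [eB] kills the nilpotent
   class it then defines in [H^0]; the successor makes [C] positive. *)
exists (eA + eB).+1; split=> // ys sz fr; exists (eA + eB)%N; split; first exact: leqnSn.
have frz := freg_of_filter_regular hxs noeth fr.
rewrite genE; set I := gen _ ys; have iI : ideal I := ideal_g ys.
move=> r; split; last first.
  apply: ideal_gen_min; first exact: ideal_ideal_gen.
  move=> _ [x [Ix ->]]; apply: ideal_gen_mem; exists x; split=> //; exists 0%N.
  by apply: ideal_gen_mem; exists x.
rewrite (frob_powE ys _ charp); apply: ideal_gen_min; first exact: ideal_Fpow.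
move=> y [x [[e' hx] ->]]; rewrite (frob_powE ys _ charp) in hx.
have sx := hA ys sz frz x (ex_intro _ e' hx).
pose z := x ^+ (p ^ eA); have iA := ideal_Fpow p ys eA.
have cz : cech_cocycle (xs := xs) 0 (Fpow p ys eA) (cst z) by apply/coc_cst.
have nz : fnil p (powl p ys eA) 0 (cst z : germ xs).
  exists e'; rewrite FpowD; apply/cob_fe_cst => //; first exact: ideal_Fpow.
    exact: (ideal0 (ideal_Fpow _ _ _)).
  by rewrite /z exprAC addnC -FpowD; apply: gen_Fpow.
have iF := ideal_Fpow p ys (eA + eB).
rewrite expnD exprM; apply/(cob_fe_cst xs p eB z iF (ideal0 iF)); rewrite -FpowD.
apply: hB cz nz; first by rewrite size_map.
exact: freg_powl.
Qed.
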